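(* For each $N\ge2$, there exists a totally disconnected, perfect (closed, without isolated points) subset of $\mathbb{C}^N$ that intersects every analytic subvariety of $\mathbb{C}^N$ of positive dimension. *)

(* Defs.v *)
From Stdlib Require Import Reals List.
From Stdlib Require Vectors.Fin.
Open Scope R_scope.

Definition C : Type := (R * R)%type.
Definition C0 : C := (0, 0).
Definition Cadd (z w : C) : C := (fst z + fst w, snd z + snd w).
Definition Csub (z w : C) : C := (fst z - fst w, snd z - snd w).
Definition Cmul (z w : C) : C :=
  (fst z * fst w - snd z * snd w, fst z * snd w + snd z * fst w).
Definition Cmod (z : C) : R := sqrt (fst z * fst z + snd z * snd z).

Definition CN (N : nat) : Type := Fin.t N -> C.

Fixpoint sumC (n : nat) : (Fin.t n -> C) -> C :=
  match n return (Fin.t n -> C) -> C with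
  | O => fun _ => C0
  | S m => fun f => Cadd (f Fin.F1) (sumC m (fun i => f (Fin.FS i)))
  end.

Fixpoint sumR (n : nat) : (Fin.t n -> R) -> R :=
  match n return (Fin.t n -> R) -> R with
  | O => fun _ => 0
  | S m => fun f => f Fin.F1 + sumR m (fun i => f (Fin.FS i))
  end.

(** Polydisc of radius r around p (gives the standard topology of C^N). *)
Definition ball {N : nat} (p : CN N) (r : R) (z : CN N) : Prop :=
  forall i, Cmod (Csub (z i) (p i)) < r.

Definition is_open {N : nat} (U : CN N -> Prop) : Prop :=
  forall p, U p -> exists r, 0 < r /\ forall z, ball p r z -> U z.

Definition is_closed {N : nat} (A : CN N -> Prop) : Prop :=
  is_open (fun z => ~ A z).

Definition C_differentiable_at {N : nat} (f : CN N -> C) (p : CN N) : Prop :=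
  exists a : Fin.t N -> C,
    forall eps, 0 < eps -> exists delta, 0 < delta /\
      forall z, ball p delta z ->
        Cmod (Csub (Csub (f z) (f p))
                   (sumC N (fun i => Cmul (a i) (Csub (z i) (p i)))))
        <= eps * sumR N (fun i => Cmod (Csub (z i) (p i))).

Definition holomorphic_on {N : nat} (U : CN N -> Prop) (f : CN N -> C) : Prop :=
  forall p, U p -> C_differentiable_at f p.

Definition analytic_subvariety {N : nat} (A : CN N -> Prop) : Prop :=
  is_closed A /\
  forall p, A p -> exists r, 0 < r /\ exists fs : list (CN N -> C),
    (forall f, In f fs -> holomorphic_on (ball p r) f) /\
    (forall z, ball p r z -> (A z <-> forall f, In f fs -> f z = C0)).

(** p is a regular point of A of dimension #|{i | sel i}| : near p, A is a
    complex submanifold, namely the graph of a holomorphic map over the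
    coordinate plane spanned by the coordinates selected by sel. *)
Definition regular_point_sel {N : nat} (A : CN N -> Prop) (p : CN N)
    (sel : Fin.t N -> bool) : Prop :=
  A p /\ exists r, 0 < r /\ exists g : Fin.t N -> CN N -> C,
    (forall j, holomorphic_on (ball p r) (g j)) /\
    (forall j z w, (forall i, sel i = true -> z i = w i) -> g j z = g j w) /\
    (forall z, ball p r z ->
       (A z <-> forall j, sel j = false -> z j = g j z)).

(** dim A = max of the dimensions of A at its regular points; so
    dim A > 0 iff A has a regular point of dimension >= 1. *)
Definition positive_dimensional {N : nat} (A : CN N -> Prop) : Prop :=
  exists p sel, (exists i, sel i = true) /\ regular_point_sel A p sel.

Definition connected_set {N : nat} (X : CN N -> Prop) : Prop :=
  forall U V : CN N -> Prop, is_open U -> is_open V ->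
    (forall z, X z -> U z \/ V z) ->
    (forall z, ~ (X z /\ U z /\ V z)) ->
    (forall z, X z -> U z) \/ (forall z, X z -> V z).

Definition totally_disconnected {N : nat} (K : CN N -> Prop) : Prop :=
  forall X : CN N -> Prop, (forall z, X z -> K z) -> connected_set X ->
    forall z w, X z -> X w -> z = w.

Definition perfect_set {N : nat} (K : CN N -> Prop) : Prop :=
  is_closed K /\
  forall p, K p -> forall r, 0 < r -> exists q, K q /\ q <> p /\ ball p r q.

(* Main.v *)
Require Import Defs.
From Stdlib Require Import Reals List.
From Stdlib Require Import ZArith Lra Lia Classical ClassicalEpsilon FunctionalExtensionality.
From Stdlib Require Vectors.Fin Arith.Cantor.
From Coquelicot Require Import Coquelicot.
Open Scope R_scope.

(** Remove from C^N thin open shells around a countable family of spheres that separates points, and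
    let K be the closure of (a slightly smaller version of) what remains: K is totally disconnected.
    Let X be the set of non-isolated points of an analytic set. Since |z-c|^2 - |z-p|^2 is the real part
    of a complex affine function, a maximum principle on X gives, for every p in X, every centre c and
    every s > 0, a point z of X with |z-p| = s and |z-c|^2 >= |p-c|^2 + s^2/2. So one move of length s_k
    leaves the k-th shell, and if the lengths s_k and the shell widths decrease fast enough the later
    moves do not bring the point back; the limit lies in X and in K. Applied to X = C^N starting near a
    point of K, the same moves show that K has no isolated point.

    The maximum principle says that near a non-isolated point q of an analytic set A and for a complex
    affine function l vanishing at q there are other non-isolated points of A with Re l >= 0. Adjoin
    w = l(z) as first coordinate and let k be the first index for which q is isolated in the set where
    the coordinates 0, ..., k vanish. Eliminating the coordinates after k one at a time
    (the norm of g over the roots of f in the last variable is holomorphic in the other variables, being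
    a polynomial in power sums given by the argument principle) leaves functions of one variable with
    accumulating zeros, hence identically zero; so A contains points with coordinates 0, ..., k-1 equal
    to zero and k-th coordinate equal to t, for all small t, and an accumulation point of those with
    t > 0 is the required point. *)

(** * Limits along neighbourhood bases and complex integrals *)

(** The maximum principle is needed only in a weak form: a nearby point with Re l >= 0, not one with
    Re l > 0. Strictness comes from the test function |z-c|^2 - |z-p|^2/2. Around any q it equals
    its value at q, plus the real part of a complex affine function vanishing at q, plus |z-q|^2/2.
    So it has no maximum over X at a point q with |q-p| < s; its maximum over |z-p| <= s lies on the
    sphere, and comparison with its value at p yields the gain s^2/2. The weak form makes sense at
    singular points of A and avoids irreducible components and dimension theory. Being non-isolated
    is all that is kept of positive dimension, and the set of non-isolated points is closed, as the
    limit of the moves requires. Adjoining w = l(z) turns the sign condition into a condition on one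
    coordinate: at the point constructed, w is 0 if k > 0 and positive if k = 0. Elimination with
    several equations uses norms of all linear combinations of the equations: if no root of f is a
    common zero, some combination is nonzero at every root. *)

Definition lim_at {P : Type} (N : R -> P -> Prop) (f : P -> C) (l : C) : Prop :=
  forall eps, 0 < eps -> exists d, 0 < d /\ forall p, N d p -> Cmod (f p - l) < eps.

Definition monoN {P : Type} (N : R -> P -> Prop) : Prop :=
  forall d d' p, d <= d' -> N d p -> N d' p.

Definition nR (t d s : R) : Prop := Rabs (s - t) < d.
Definition nC (z : C) (d : R) (w : C) : Prop := Cmod (w - z) < d.
(** Points of C^n are infinite sequences of which only the first n entries count. The number of
    variables can then change during elimination without any conversion between types. *)
Definition nX (n : nat) (x : nat -> C) (d : R) (y : nat -> C) : Prop :=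
  forall i, (i < n)%nat -> Cmod (y i - x i) < d.
Definition nP {P Q : Type} (N : R -> P -> Prop) (M : R -> Q -> Prop) (d : R) (p : P * Q) : Prop :=
  N d (fst p) /\ M d (snd p).

Lemma monoN_R t : monoN (nR t).
Proof. unfold monoN, nR; intros; lra. Qed.
Lemma monoN_C z : monoN (nC z).
Proof. unfold monoN, nC; intros; lra. Qed.
Lemma monoN_X n x : monoN (nX n x).
Proof. unfold monoN, nX; intros d d' p H H1 i Hi. specialize (H1 i Hi). lra. Qed.
Lemma monoN_P {P Q} (N : R -> P -> Prop) (M : R -> Q -> Prop) : monoN N -> monoN M -> monoN (nP N M).
Proof. unfold monoN, nP. intros HN HM d d' p H [H1 H2]. split; eauto. Qed.
#[local] Hint Resolve monoN_R monoN_C monoN_X monoN_P : mono.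

Lemma Cmod_sub_sym (a b : C) : Cmod (a - b) = Cmod (b - a).
Proof. replace (a - b)%C with (- (b - a))%C by ring. apply Cmod_opp. Qed.

Lemma Cmod_diag (a : C) : Cmod (a - a) = 0.
Proof. replace (a - a)%C with (RtoC 0) by ring. apply Cmod_0. Qed.

Lemma Cmod_tri (a b c : C) : Cmod (a - c) <= Cmod (a - b) + Cmod (b - c).
Proof. replace (a - c)%C with ((a - b) + (b - c))%C by ring. apply Cmod_triangle. Qed.

Lemma Cmod_ge_diff (a b : C) : Cmod a - Cmod b <= Cmod (a - b).
Proof.
  replace a with ((a - b) + b)%C at 1 by ring.
  generalize (Cmod_triangle (a - b) b); lra.
Qed.

Section Lim.
Context {P : Type} (N : R -> P -> Prop) (HN : monoN N).

Lemma lim_const (c : C) : lim_at N (fun _ => c) c.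
Proof. intros e He. exists 1. split; [lra|]. intros. rewrite Cmod_diag. lra. Qed.

Lemma lim_and (A B : P -> Prop) :
  (exists d, 0 < d /\ forall p, N d p -> A p) -> (exists d, 0 < d /\ forall p, N d p -> B p) ->
  exists d, 0 < d /\ forall p, N d p -> A p /\ B p.
Proof.
  intros [d1 [H1 K1]] [d2 [H2 K2]]. exists (Rmin d1 d2). split; [apply Rmin_glb_lt; auto|].
  intros p Hp. split; [apply K1|apply K2]; eapply HN; eauto; [apply Rmin_l|apply Rmin_r].
Qed.

Lemma lim_plus f g a b : lim_at N f a -> lim_at N g b -> lim_at N (fun p => f p + g p)%C (a + b)%C.
Proof.
  intros Hf Hg e He.
  destruct (lim_and _ _ (Hf (e/2) ltac:(lra)) (Hg (e/2) ltac:(lra))) as [d [Hd K]].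
  exists d; split; auto. intros p Hp. destruct (K p Hp).
  replace (f p + g p - (a + b))%C with ((f p - a) + (g p - b))%C by ring.
  eapply Rle_lt_trans; [apply Cmod_triangle|]. lra.
Qed.

Lemma lim_mult f g a b : lim_at N f a -> lim_at N g b -> lim_at N (fun p => f p * g p)%C (a * b)%C.
Proof.
  intros Hf Hg e He.
  set (A := Cmod a). set (B := Cmod b).
  assert (0 <= A) by apply Cmod_ge_0. assert (0 <= B) by apply Cmod_ge_0.
  set (h := Rmin 1 (e / (A + B + 2))).
  assert (Hh : 0 < h). { apply Rmin_glb_lt; [lra|]. apply Rdiv_lt_0_compat; lra. }
  destruct (lim_and _ _ (Hf h Hh) (Hg h Hh)) as [d [Hd K]].
  exists d; split; auto. intros p Hp. destruct (K p Hp) as [K1 K2].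
  replace (f p * g p - a * b)%C with ((f p - a) * (g p - b) + (f p - a) * b + a * (g p - b))%C by ring.
  assert (h <= 1) by apply Rmin_l.
  assert (h <= e / (A + B + 2)) by apply Rmin_r.
  assert (h * (A + B + 2) <= e). { apply (Rmult_le_compat_r (A+B+2)) in H2; [|lra].
    unfold Rdiv in H2. rewrite Rmult_assoc, Rinv_l, Rmult_1_r in H2; lra. }
  pose proof (Cmod_triangle ((f p - a) * (g p - b) + (f p - a) * b) (a * (g p - b))) as T1.
  pose proof (Cmod_triangle ((f p - a) * (g p - b)) ((f p - a) * b)) as T2.
  rewrite !Cmod_mult in *. fold A B in T1, T2.
  pose proof (Cmod_ge_0 (f p - a)). pose proof (Cmod_ge_0 (g p - b)).
  assert (Cmod (f p - a) * Cmod (g p - b) <= h * 1) by (apply Rmult_le_compat; lra).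
  assert (Cmod (f p - a) * B <= h * B) by (apply Rmult_le_compat; lra).
  assert (A * Cmod (g p - b) <= A * h) by (apply Rmult_le_compat; lra).
  nra.
Qed.

Lemma lim_opp f a : lim_at N f a -> lim_at N (fun p => - f p)%C (- a)%C.
Proof.
  intros Hf e He. destruct (Hf e He) as [d [Hd K]]. exists d; split; auto. intros p Hp.
  replace (- f p - - a)%C with (- (f p - a))%C by ring. rewrite Cmod_opp. auto.
Qed.

Lemma lim_minus f g a b : lim_at N f a -> lim_at N g b -> lim_at N (fun p => f p - g p)%C (a - b)%C.
Proof. intros. unfold Cminus. apply lim_plus; auto. apply lim_opp; auto. Qed.

Lemma lim_pow f a k : lim_at N f a -> lim_at N (fun p => f p ^ k)%C (a ^ k)%C.
Proof. intros H. induction k; simpl. apply lim_const. apply lim_mult; auto. Qed.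

Lemma lim_inv f (a : C) : a <> 0 -> lim_at N f a -> lim_at N (fun p => / f p)%C (/ a)%C.
Proof.
  intros Ha Hf e He. assert (HA : 0 < Cmod a) by (apply (proj1 (Cmod_gt_0 a)); auto).
  set (A := Cmod a) in *.
  destruct (lim_and _ _ (Hf (A/2) ltac:(lra)) (Hf (e*A*A/2) ltac:(assert (0 < e * A) by (apply Rmult_lt_0_compat; lra); assert (0 < e * A * A) by (apply Rmult_lt_0_compat; lra); lra))) as [d [Hd K]].
  exists d; split; auto. intros p Hp. destruct (K p Hp) as [K1 K2].
  assert (HB : A/2 < Cmod (f p)).
  { generalize (Cmod_ge_diff a (f p)). rewrite Cmod_sub_sym. fold A. lra. }
  assert (f p <> 0). { apply Cmod_gt_0. lra. }
  replace (/ f p - / a)%C with ((a - f p) / (f p * a))%C by (field; split; auto).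
  rewrite Cmod_div by (apply Cmult_neq_0; auto). rewrite Cmod_mult. fold A.
  rewrite Cmod_sub_sym. apply Rmult_lt_reg_r with (Cmod (f p) * A); [nra|].
  unfold Rdiv. rewrite Rmult_assoc, Rinv_l, Rmult_1_r by nra.
  assert (0 < e * A * (Cmod (f p) - A/2)) by (apply Rmult_lt_0_compat; [apply Rmult_lt_0_compat|]; lra). nra.
Qed.

Lemma lim_div f g (a b : C) : b <> 0 -> lim_at N f a -> lim_at N g b -> lim_at N (fun p => f p / g p)%C (a / b)%C.
Proof. intros. apply lim_mult; auto. apply lim_inv; auto. Qed.

Lemma lim_comp {Q} (M : R -> Q -> Prop) (phi : P -> Q) g l :
  (forall d, 0 < d -> exists d', 0 < d' /\ forall p, N d' p -> M d (phi p)) ->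
  lim_at M g l -> lim_at N (fun p => g (phi p)) l.
Proof.
  intros H Hg e He. destruct (Hg e He) as [d [Hd K]]. destruct (H d Hd) as [d' [Hd' K']].
  exists d'; split; auto.
Qed.

Lemma lim_compC f l g m : lim_at N f l -> lim_at (nC l) g m -> lim_at N (fun p => g (f p)) m.
Proof. intros Hf Hg. apply (lim_comp (nC l) f g m); auto. Qed.

Lemma lim_ext f g l : (exists d, 0 < d /\ forall p, N d p -> f p = g p) -> lim_at N f l -> lim_at N g l.
Proof.
  intros H Hf e He. destruct (lim_and _ _ H (Hf e He)) as [d [Hd K]].
  exists d; split; auto. intros p Hp. destruct (K p Hp) as [E L]. rewrite <- E. auto.
Qed.
End Lim.

Lemma lim_fst {P Q} (N : R -> P -> Prop) (M : R -> Q -> Prop) f l :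
  lim_at N f l -> lim_at (nP N M) (fun p => f (fst p)) l.
Proof. apply lim_comp. intros d Hd. exists d; split; auto. intros p []; auto. Qed.

Lemma lim_snd {P Q} (N : R -> P -> Prop) (M : R -> Q -> Prop) f l :
  lim_at M f l -> lim_at (nP N M) (fun p => f (snd p)) l.
Proof. apply lim_comp. intros d Hd. exists d; split; auto. intros p []; auto. Qed.

Lemma lim_id z : lim_at (nC z) (fun w => w) z.
Proof. intros e He. exists e; auto. Qed.

Lemma lim_coord n x i : (i < n)%nat -> lim_at (nX n x) (fun y => y i) (x i).
Proof. intros Hi e He. exists e; split; auto. Qed.

Definition cint (h : R -> C) (a b : R) : C :=
  (RInt (fun t => fst (h t)) a b, RInt (fun t => snd (h t)) a b).

Definition contR_at (h : R -> C) (t : R) : Prop := lim_at (nR t) h (h t).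

Lemma Rabs_fst_le (z : C) : Rabs (fst z) <= Cmod z.
Proof. apply Rle_trans with (2 := Rmax_Cmod z). apply Rmax_l. Qed.
Lemma Rabs_snd_le (z : C) : Rabs (snd z) <= Cmod z.
Proof. apply Rle_trans with (2 := Rmax_Cmod z). apply Rmax_r. Qed.

Lemma Cmod_le_sum (z : C) : Cmod z <= Rabs (fst z) + Rabs (snd z).
Proof.
  destruct z as [x y]. unfold Cmod; simpl fst; simpl snd.
  rewrite <- (sqrt_Rsqr (Rabs x + Rabs y)).
  2: generalize (Rabs_pos x), (Rabs_pos y); lra.
  apply sqrt_le_1_alt. unfold Rsqr.
  assert (x^2 = Rabs x * Rabs x) by (rewrite <- Rabs_mult; rewrite Rabs_pos_eq; nra).
  assert (y^2 = Rabs y * Rabs y) by (rewrite <- Rabs_mult; rewrite Rabs_pos_eq; nra).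
  generalize (Rabs_pos x), (Rabs_pos y). nra.
Qed.

Lemma continuous_Reps (f : R -> R) (t : R) :
  (forall e, 0 < e -> exists d, 0 < d /\ forall s, Rabs (s - t) < d -> Rabs (f s - f t) < e) -> continuous f t.
Proof.
  intros H. apply filterlim_locally. intros eps. destruct (H eps (cond_pos eps)) as [d [Hd K]].
  exists (mkposreal d Hd). intros y Hy. apply K. apply Hy.
Qed.

Lemma contR_at_fst h t : contR_at h t -> continuous (fun t => fst (h t)) t.
Proof.
  intros H. apply continuous_Reps. intros e He. destruct (H e He) as [d [Hd K]]. exists d; split; auto.
  intros s Hs. eapply Rle_lt_trans; [|apply (K s Hs)]. apply (Rabs_fst_le (h s - h t)).
Qed.
Lemma contR_at_snd h t : contR_at h t -> continuous (fun t => snd (h t)) t.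
Proof.
  intros H. apply continuous_Reps. intros e He. destruct (H e He) as [d [Hd K]]. exists d; split; auto.
  intros s Hs. eapply Rle_lt_trans; [|apply (K s Hs)]. apply (Rabs_snd_le (h s - h t)).
Qed.

Lemma contR_at_ex_fst h a b : a <= b -> (forall t, a <= t <= b -> contR_at h t) -> ex_RInt (fun t => fst (h t)) a b.
Proof.
  intros Hab H. apply (ex_RInt_continuous (V := R_CompleteNormedModule)). intros t. rewrite Rmin_left, Rmax_right by lra.
  intros. apply contR_at_fst; auto.
Qed.
Lemma contR_at_ex_snd h a b : a <= b -> (forall t, a <= t <= b -> contR_at h t) -> ex_RInt (fun t => snd (h t)) a b.
Proof.
  intros Hab H. apply (ex_RInt_continuous (V := R_CompleteNormedModule)). intros t. rewrite Rmin_left, Rmax_right by lra.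
  intros. apply contR_at_snd; auto.
Qed.

Lemma cint_ext h g a b : a <= b -> (forall t, a <= t <= b -> h t = g t) -> cint h a b = cint g a b.
Proof.
  intros Hab H. unfold cint. f_equal; apply RInt_ext; intros t Ht;
  rewrite Rmin_left, Rmax_right in Ht by lra; rewrite H; auto; lra.
Qed.

Section cint.
Variables (a b : R) (Hab : a <= b).

Lemma cint_plus h g : (forall t, a <= t <= b -> contR_at h t) -> (forall t, a <= t <= b -> contR_at g t) ->
  cint (fun t => h t + g t)%C a b = (cint h a b + cint g a b)%C.
Proof.
  intros Hh Hg. unfold cint, Cplus; simpl. f_equal.
  - apply (RInt_plus (V := R_CompleteNormedModule)); apply contR_at_ex_fst; auto.
  - apply (RInt_plus (V := R_CompleteNormedModule)); apply contR_at_ex_snd; auto.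
Qed.

Lemma cint_scal (c : C) h : (forall t, a <= t <= b -> contR_at h t) ->
  cint (fun t => c * h t)%C a b = (c * cint h a b)%C.
Proof.
  intros Hh. destruct c as [u v]. unfold cint, Cmult; simpl.
  pose proof (contR_at_ex_fst h a b Hab Hh) as E1. pose proof (contR_at_ex_snd h a b Hab Hh) as E2.
  f_equal.
  - etransitivity;
    [apply (RInt_minus (V := R_CompleteNormedModule) (fun t => scal u (fst (h t))) (fun t => scal v (snd (h t))));
     apply (ex_RInt_scal (V := R_NormedModule)); auto|].
    apply (f_equal2 Rminus); apply (RInt_scal (V := R_CompleteNormedModule)); auto.
  - etransitivity;
    [apply (RInt_plus (V := R_CompleteNormedModule) (fun t => scal u (snd (h t))) (fun t => scal v (fst (h t))));
     apply (ex_RInt_scal (V := R_NormedModule)); auto|].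
    apply (f_equal2 Rplus); apply (RInt_scal (V := R_CompleteNormedModule)); auto.
Qed.

(** The factor 2 comes from bounding the real and imaginary parts separately; all later estimates
    tolerate a constant factor. *)
Lemma cint_bound h M : (forall t, a <= t <= b -> contR_at h t) -> (forall t, a <= t <= b -> Cmod (h t) <= M) ->
  Cmod (cint h a b) <= 2 * (b - a) * M.
Proof.
  intros Hh HM. eapply Rle_trans; [apply Cmod_le_sum|]. unfold cint; simpl.
  assert (Rabs (RInt (fun t => fst (h t)) a b) <= (b - a) * M).
  { apply abs_RInt_le_const; auto. apply contR_at_ex_fst; auto. intros t Ht.
    eapply Rle_trans; [apply Rabs_fst_le|auto]. }
  assert (Rabs (RInt (fun t => snd (h t)) a b) <= (b - a) * M).
  { apply abs_RInt_le_const; auto. apply contR_at_ex_snd; auto. intros t Ht.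
    eapply Rle_trans; [apply Rabs_snd_le|auto]. }
  lra.
Qed.

Lemma cint_Chasles h c : b <= c -> (forall t, a <= t <= c -> contR_at h t) ->
  (cint h a b + cint h b c)%C = cint h a c.
Proof.
  intros Hbc Hh. unfold cint, Cplus; simpl. f_equal.
  - apply (RInt_Chasles (V := R_CompleteNormedModule)); apply contR_at_ex_fst; auto; intros; apply Hh; lra.
  - apply (RInt_Chasles (V := R_CompleteNormedModule)); apply contR_at_ex_snd; auto; intros; apply Hh; lra.
Qed.

Lemma cint_FTC (H h : R -> C) : (forall t, a <= t <= b -> contR_at h t) ->
  (forall t, is_derive (fun t => fst (H t)) t (fst (h t))) ->
  (forall t, is_derive (fun t => snd (H t)) t (snd (h t))) ->
  cint h a b = (H b - H a)%C.
Proof.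
  intros Hh H1 H2. unfold cint. rewrite (surjective_pairing (H b - H a)%C). f_equal.
  - apply is_RInt_unique. apply (is_RInt_derive (V := R_CompleteNormedModule) (fun t => fst (H t))).
    intros; apply H1. intros t. rewrite Rmin_left, Rmax_right by lra. intros. apply contR_at_fst; auto.
  - apply is_RInt_unique. apply (is_RInt_derive (V := R_CompleteNormedModule) (fun t => snd (H t))).
    intros; apply H2. intros t. rewrite Rmin_left, Rmax_right by lra. intros. apply contR_at_snd; auto.
Qed.

(* Uniformity over the compact interval via a Lebesgue number. *)
Lemma lim_unif {P} (N : R -> P -> Prop) (HN : monoN N) (p0 : P) (Hp0 : forall d, 0 < d -> N d p0)
  (G : P -> R -> C) :
  (forall t, a <= t <= b -> lim_at (nP N (nR t)) (fun q => G (fst q) (snd q)) (G p0 t)) ->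
  forall e, 0 < e -> exists d, 0 < d /\ forall p, N d p -> forall t, a <= t <= b -> Cmod (G p t - G p0 t) < e.
Proof.
  intros H e He.
  assert (S : forall t, exists d : posreal, a <= t <= b ->
     forall p s, N d p -> Rabs (s - t) < d -> Cmod (G p s - G p0 t) < e / 2).
  { intros t. destruct (classic (a <= t <= b)) as [Ht|Ht].
    - destruct (H t Ht (e/2) ltac:(lra)) as [d [Hd K]]. exists (mkposreal d Hd). intros _ p s Hp Hs.
      apply (K (p, s)). split; auto.
    - exists (mkposreal 1 Rlt_0_1). tauto. }
  destruct (choice _ S) as [dl Hdl].
  destruct (compactness_value_1d a b dl) as [d Hd].
  exists d. split; [apply cond_pos|]. intros p Hp t Ht.
  apply NNPP. intros Hn. apply (Hd t Ht). intros [t' [Ht' [H1 H2]]]. apply Hn.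
  pose proof (Hdl t' Ht' p t (HN _ _ _ H2 Hp) H1).
  pose proof (Hdl t' Ht' p0 t (Hp0 _ (cond_pos _)) H1).
  pose proof (Cmod_tri (G p t) (G p0 t') (G p0 t)).
  rewrite (Cmod_sub_sym (G p0 t') (G p0 t)) in *. lra.
Qed.

Lemma cint_lim {P} (N : R -> P -> Prop) (HN : monoN N) (p0 : P) (Hp0 : forall d, 0 < d -> N d p0)
  (G : P -> R -> C) :
  (exists d, 0 < d /\ forall p, N d p -> forall t, a <= t <= b -> contR_at (G p) t) ->
  (forall t, a <= t <= b -> lim_at (nP N (nR t)) (fun q => G (fst q) (snd q)) (G p0 t)) ->
  lim_at N (fun p => cint (G p) a b) (cint (G p0) a b).
Proof.
  intros [d0 [Hd0 K0]] H e He.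
  set (e' := e / (2 * (b - a) + 1)).
  assert (He' : 0 < e') by (apply Rdiv_lt_0_compat; lra).
  destruct (lim_unif N HN p0 Hp0 G H e' He') as [d [Hd K]].
  exists (Rmin d0 d). split; [apply Rmin_glb_lt; auto|]. intros p Hp.
  assert (Hp1 : N d0 p) by (eapply HN; [apply Rmin_l|eauto]).
  assert (Hp2 : N d p) by (eapply HN; [apply Rmin_r|eauto]).
  replace (cint (G p) a b - cint (G p0) a b)%C with (cint (fun t => G p t + (-1) * G p0 t)%C a b).
  - eapply Rle_lt_trans. apply (cint_bound _ e').
    + intros t Ht. apply lim_plus; auto with mono. apply K0; auto.
      apply lim_mult; auto with mono. apply lim_const. apply K0; auto.
    + intros t Ht. apply Rlt_le. replace (G p t + -1 * G p0 t)%C with (G p t - G p0 t)%C by ring. auto.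
    + assert (e = e' * (2 * (b - a) + 1)). { unfold e'. field. lra. } nra.
  - rewrite cint_plus, cint_scal; auto. ring.
    intros t Ht. apply lim_mult; auto with mono. apply lim_const. apply K0; auto.
Qed.
End cint.

(** * Complex derivatives *)

(** Complex differentiability in Caratheodory's form. *)
Definition isder (f : C -> C) (z l : C) : Prop :=
  exists q : C -> C, q z = l /\ lim_at (nC z) q (q z) /\
    exists d, 0 < d /\ forall w, nC z d w -> f w = (f z + q w * (w - z))%C.

Definition cdiff (f : C -> C) (z : C) : Prop := exists l, isder f z l.

Lemma nC_refl z d : 0 < d -> nC z d z.
Proof. intros. unfold nC. rewrite Cmod_diag. auto. Qed.
#[local] Hint Resolve nC_refl : mono.

Lemma isder_of_eps f z l :
  (forall e, 0 < e -> exists d, 0 < d /\ forall w, nC z d w -> Cmod (f w - f z - l * (w - z)) <= e * Cmod (w - z)) ->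
  isder f z l.
Proof.
  intros H.
  exists (fun w => if excluded_middle_informative (w = z) then l else (f w - f z) / (w - z))%C.
  destruct (excluded_middle_informative (z = z)) as [_|n]; [|exfalso; auto]. split; [auto|]. split.
  - intros e He. destruct (H (e/2) ltac:(lra)) as [d [Hd K]]. exists d; split; auto. intros w Hw.
    destruct (excluded_middle_informative (w = z)) as [E|E]. rewrite Cmod_diag; lra.
    specialize (K w Hw). assert (E' : (w - z)%C <> 0) by (apply Cminus_eq_contra; auto).
    replace ((f w - f z) / (w - z) - l)%C with ((f w - f z - l * (w - z)) / (w - z))%C by (field; auto).
    rewrite Cmod_div by auto. assert (0 < Cmod (w - z)) by (apply Cmod_gt_0; auto).
    apply Rle_lt_trans with (e/2); [|lra].
    apply Rmult_le_reg_r with (Cmod (w - z)); auto. unfold Rdiv at 1. rewrite Rmult_assoc, Rinv_l; lra.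
  - exists 1. split; [lra|]. intros w _. destruct (excluded_middle_informative (w = z)) as [E|E].
    subst. ring. field. apply Cminus_eq_contra; auto.
Qed.

Lemma isder_eps f z l : isder f z l ->
  forall e, 0 < e -> exists d, 0 < d /\ forall w, nC z d w -> Cmod (f w - f z - l * (w - z)) <= e * Cmod (w - z).
Proof.
  intros [q [E [Hq Hf]]] e He.
  destruct (lim_and (nC z) (monoN_C z) _ _ (Hq e He) Hf) as [d [Hd K]].
  exists d; split; auto. intros w Hw. destruct (K w Hw) as [K1 K2]. rewrite K2.
  replace (f z + q w * (w - z) - f z - l * (w - z))%C with ((q w - q z) * (w - z))%C by (rewrite E; ring).
  rewrite Cmod_mult. apply Rmult_le_compat_r. apply Cmod_ge_0. lra.
Qed.

Lemma isder_cont f z l : isder f z l -> lim_at (nC z) f (f z).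
Proof.
  intros [q [E [Hq Hf]]].
  replace (f z) with (f z + q z * (z - z))%C by ring.
  apply (lim_ext (nC z) (monoN_C z) (fun w => f z + q w * (w - z))%C).
  - destruct Hf as [d [Hd K]]. exists d. split; auto. intros p Hp. rewrite (K p Hp). ring.
  - apply lim_plus; auto with mono. apply lim_const. apply lim_mult; auto with mono.
    apply lim_minus; auto with mono. apply lim_id. apply lim_const.
Qed.

Lemma cdiff_cont f z : cdiff f z -> lim_at (nC z) f (f z).
Proof. intros [l H]. eapply isder_cont; eauto. Qed.

Lemma isder_unique f z l m : isder f z l -> isder f z m -> l = m.
Proof.
  intros H1 H2. apply NNPP. intros Hn.
  assert (Hp : 0 < Cmod (l - m)) by (apply Cmod_gt_0, Cminus_eq_contra; auto).
  destruct (lim_and (nC z) (monoN_C z) _ _ (isder_eps _ _ _ H1 (Cmod (l-m)/4) ltac:(lra)) (isder_eps _ _ _ H2 (Cmod (l-m)/4) ltac:(lra)))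
    as [d [Hd K]].
  assert (E : ((z + RtoC (d/2)) - z)%C = RtoC (d/2)) by ring.
  assert (Ed : Cmod (RtoC (d/2)) = d/2) by (rewrite Cmod_R, Rabs_pos_eq; lra).
  destruct (K (z + RtoC (d/2))%C) as [K1 K2].
  { unfold nC. rewrite E, Ed. lra. }
  rewrite E in *. set (u := (f (z + RtoC (d/2)) - f z)%C) in *.
  pose proof (Cmod_tri (u - l * RtoC (d/2)) 0 (u - m * RtoC (d/2))) as T.
  replace (u - l * RtoC (d/2) - (u - m * RtoC (d/2)))%C with (- ((l - m) * RtoC (d/2)))%C in T by ring.
  rewrite Cmod_opp, Cmod_mult in T. rewrite (Cmod_sub_sym 0) in T.
  replace (u - m * RtoC (d / 2) - 0)%C with (u - m * RtoC (d / 2))%C in T by ring.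
  replace (u - l * RtoC (d / 2) - 0)%C with (u - l * RtoC (d / 2))%C in T by ring.
  rewrite Ed in *. nra.
Qed.

Lemma isder_ext f g z l : (exists d, 0 < d /\ forall w, nC z d w -> f w = g w) -> isder f z l -> isder g z l.
Proof.
  intros H [q [E [Hq Hf]]]. exists q. split; auto. split; auto.
  destruct (lim_and (nC z) (monoN_C z) _ _ H Hf) as [d [Hd K]]. exists d; split; auto.
  intros w Hw. destruct (K w Hw) as [K1 K2]. destruct (K z ltac:(auto with mono)) as [K3 _].
  rewrite <- K1, <- K3. auto.
Qed.

Lemma cdiff_ext f g z : (exists d, 0 < d /\ forall w, nC z d w -> f w = g w) -> cdiff f z -> cdiff g z.
Proof. intros H [l Hl]. exists l. eapply isder_ext; eauto. Qed.

Lemma isder_const c z : isder (fun _ => c) z 0.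
Proof.
  exists (fun _ => RtoC 0). split; auto. split. apply lim_const. exists 1; split; [lra|]. intros. ring.
Qed.
Lemma isder_id z : isder (fun w => w) z 1.
Proof.
  exists (fun _ => RtoC 1). split; auto. split. apply lim_const. exists 1; split; [lra|]. intros. ring.
Qed.

Lemma isder_plus f g z l m : isder f z l -> isder g z m -> isder (fun w => f w + g w)%C z (l + m)%C.
Proof.
  intros [q [E [Hq Hf]]] [r [E' [Hr Hg]]]. exists (fun w => q w + r w)%C. split. rewrite E, E'; auto.
  split. apply lim_plus; auto with mono.
  destruct (lim_and (nC z) (monoN_C z) _ _ Hf Hg) as [d [Hd K]]. exists d; split; auto.
  intros w Hw. destruct (K w Hw) as [K1 K2]. rewrite K1, K2. ring.
Qed.

Lemma isder_mult f g z l m : isder f z l -> isder g z m ->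
  isder (fun w => f w * g w)%C z (l * g z + f z * m)%C.
Proof.
  intros Df Dg. pose proof (isder_cont _ _ _ Dg) as Cg.
  destruct Df as [q [E [Hq Hf]]], Dg as [r [E' [Hr Hg]]]. exists (fun w => q w * g w + f z * r w)%C.
  split. rewrite E, E'; auto.
  split. apply lim_plus; auto with mono; apply lim_mult; auto with mono. apply lim_const.
  destruct (lim_and (nC z) (monoN_C z) _ _ Hf Hg) as [d [Hd K]]. exists d; split; auto.
  intros w Hw. destruct (K w Hw) as [K1 K2]. rewrite K1 at 1. rewrite K2. ring.
Qed.

Lemma isder_inv (f : C -> C) z l : f z <> 0 -> isder f z l -> isder (fun w => / f w)%C z (- l / (f z * f z))%C.
Proof.
  intros Hz Df. pose proof (isder_cont _ _ _ Df) as Cf.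
  assert (NZ : exists d, 0 < d /\ forall w, nC z d w -> f w <> 0).
  { destruct (Cf (Cmod (f z)) ltac:(apply Cmod_gt_0; auto)) as [d [Hd K]]. exists d; split; auto.
    intros w Hw E. specialize (K w Hw). rewrite E in K. rewrite Cmod_sub_sym in K.
    replace (f z - 0)%C with (f z) in K by ring. lra. }
  destruct Df as [q [E [Hq Hf]]]. exists (fun w => - q w / (f w * f z))%C.
  split. rewrite E; auto.
  split. apply lim_div; auto with mono. apply Cmult_neq_0; auto. apply lim_opp; auto. apply lim_mult; auto with mono. apply lim_const.
  destruct (lim_and (nC z) (monoN_C z) _ _ Hf NZ) as [d [Hd K]]. exists d; split; auto.
  intros w Hw. destruct (K w Hw) as [K1 K2].
  replace (q w * (w - z))%C with (f w - f z)%C by (rewrite K1; ring).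
  assert (Ew : (- q w / (f w * f z) * (w - z))%C = (- (q w * (w - z)) / (f w * f z))%C) by (field; auto).
  rewrite Ew. replace (q w * (w - z))%C with (f w - f z)%C by (rewrite K1; ring). field; auto.
Qed.

Lemma cdiff_const c z : cdiff (fun _ => c) z.
Proof. eexists; apply isder_const. Qed.
Lemma cdiff_id z : cdiff (fun w => w) z.
Proof. eexists; apply isder_id. Qed.
Lemma cdiff_plus f g z : cdiff f z -> cdiff g z -> cdiff (fun w => f w + g w)%C z.
Proof. intros [l H] [m K]. eexists; apply isder_plus; eauto. Qed.
Lemma cdiff_mult f g z : cdiff f z -> cdiff g z -> cdiff (fun w => f w * g w)%C z.
Proof. intros [l H] [m K]. eexists; apply isder_mult; eauto. Qed.
Lemma cdiff_inv (f : C -> C) z : f z <> 0 -> cdiff f z -> cdiff (fun w => / f w)%C z.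
Proof. intros Hz [l H]. eexists; apply isder_inv; eauto. Qed.
Lemma cdiff_opp f z : cdiff f z -> cdiff (fun w => - f w)%C z.
Proof.
  intros H. apply (cdiff_ext (fun w => (-1) * f w)%C). exists 1; split; [lra|]; intros; ring.
  apply cdiff_mult; auto. apply cdiff_const.
Qed.
Lemma cdiff_minus f g z : cdiff f z -> cdiff g z -> cdiff (fun w => f w - g w)%C z.
Proof. intros. unfold Cminus. apply cdiff_plus; auto. apply cdiff_opp; auto. Qed.
Lemma cdiff_div (f g : C -> C) z : g z <> 0 -> cdiff f z -> cdiff g z -> cdiff (fun w => f w / g w)%C z.
Proof. intros. apply cdiff_mult; auto. apply cdiff_inv; auto. Qed.
Lemma cdiff_pow f z k : cdiff f z -> cdiff (fun w => f w ^ k)%C z.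
Proof. intros H. induction k; simpl. apply cdiff_const. apply cdiff_mult; auto. Qed.

Definition E (th : R) : C := (cos th, sin th).

Lemma Cmod_E th : Cmod (E th) = 1.
Proof.
  unfold Cmod, E; simpl fst; simpl snd. replace (cos th ^ 2 + sin th ^ 2) with 1. apply sqrt_1.
  generalize (sin2_cos2 th). unfold Rsqr. lra.
Qed.

Lemma E_0 : E 0 = 1.
Proof. unfold E. rewrite cos_0, sin_0. auto. Qed.
Lemma E_2PI : E (2 * PI) = 1.
Proof. unfold E. rewrite cos_2PI, sin_2PI. auto. Qed.

Lemma Cmod_E_diff s t : Cmod (E s - E t) <= 2 * Rabs (s - t).
Proof.
  eapply Rle_trans; [apply Cmod_le_sum|]. unfold E; simpl.
  assert (A : forall f f' : R -> R, (forall x, is_derive f x (f' x)) -> (forall x, Rabs (f' x) <= 1) ->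
     Rabs (f s - f t) <= Rabs (s - t)).
  { intros f f' D B. destruct (MVT_gen f t s f') as [c [_ Hc]].
    intros; apply D. intros x _. apply continuity_pt_filterlim. apply (ex_derive_continuous (V := R_NormedModule)). eexists; apply D.
    rewrite Hc, Rabs_mult. generalize (B c), (Rabs_pos (s - t)). nra. }
  pose proof (A cos (fun x => - sin x) ltac:(intros; apply is_derive_Reals, derivable_pt_lim_cos)
     ltac:(intros x; cbv beta; rewrite Rabs_Ropp; apply Rabs_le; apply SIN_bound)).
  pose proof (A sin cos ltac:(intros; apply is_derive_Reals, derivable_pt_lim_sin)
     ltac:(intros; apply Rabs_le; apply COS_bound)).
  unfold Rminus in *. lra.
Qed.

Lemma contR_at_E t : contR_at E t.
Proof.
  intros e He. exists (e/2). split; [lra|]. intros s Hs. unfold nR in Hs.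
  eapply Rle_lt_trans; [apply Cmod_E_diff|]. lra.
Qed.
Lemma contR_at_RtoC t : contR_at RtoC t.
Proof.
  intros e He. exists e. split; [lra|]. intros s Hs. rewrite <- RtoC_minus, Cmod_R. auto.
Qed.

(** Nested rectangles: if P failed for the whole, some quarter would fail at each stage, and the
    quarters would shrink to a point (t, u) contradicting the local hypothesis there. All quarters
    are similar to the whole, which is recorded as (b - a) * (D - C) = (d - c) * (B - A); Goursat's
    estimate needs this to compare the squared perimeter with the area. *)
Lemma bisection (P : R -> R -> R -> R -> Prop) (A B C D : R) : A <= B -> C <= D ->
  (forall a b c d, A <= a <= b -> b <= B -> C <= c <= d -> d <= D ->
     P a ((a+b)/2) c ((c+d)/2) -> P ((a+b)/2) b c ((c+d)/2) ->
     P a ((a+b)/2) ((c+d)/2) d -> P ((a+b)/2) b ((c+d)/2) d -> P a b c d) ->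
  (forall t u, A <= t <= B -> C <= u <= D -> exists del, 0 < del /\ forall a b c d,
     A <= a -> a <= t <= b -> b <= B -> C <= c -> c <= u <= d -> d <= D ->
     b - a < del -> d - c < del -> (b - a) * (D - C) = (d - c) * (B - A) -> P a b c d) ->
  P A B C D.
Proof.
  intros HAB HCD Hm Hl. apply NNPP. intros Hn.
  set (w := fun n => (B - A) / 2 ^ n). set (h := fun n => (D - C) / 2 ^ n).
  assert (p2 : forall n, 0 < 2 ^ n) by (intros; apply pow_lt; lra).
  assert (w0 : forall n, 0 <= w n) by (intros; apply Rdiv_le_0_compat; auto; lra).
  assert (h0 : forall n, 0 <= h n) by (intros; apply Rdiv_le_0_compat; auto; lra).
  assert (wS : forall n, w n = 2 * w (S n)) by (intros; unfold w; simpl; field; apply Rgt_not_eq, p2).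
  assert (hS : forall n, h n = 2 * h (S n)) by (intros; unfold h; simpl; field; apply Rgt_not_eq, p2).
  set (bad := fun n (q : R * R) => A <= fst q /\ fst q + w n <= B /\ C <= snd q /\ snd q + h n <= D /\
     ~ P (fst q) (fst q + w n) (snd q) (snd q + h n)).
  assert (step : forall nq : nat * (R * R), exists q' : R * R, bad (fst nq) (snd nq) ->
     bad (S (fst nq)) q' /\ fst (snd nq) <= fst q' /\ fst q' + w (S (fst nq)) <= fst (snd nq) + w (fst nq) /\
     snd (snd nq) <= snd q' /\ snd q' + h (S (fst nq)) <= snd (snd nq) + h (fst nq)).
  { intros [n [a c]]; unfold bad; simpl.
    specialize (wS n); specialize (hS n). pose proof (w0 (S n)); pose proof (h0 (S n)).
    destruct (classic (P a (a + w (S n)) c (c + h (S n)))) as [P1|P1];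
    [|exists (a, c); simpl; intros (?&?&?&?&?); repeat split; auto; lra].
    destruct (classic (P (a + w (S n)) (a + w n) c (c + h (S n)))) as [P2|P2].
    2: { exists (a + w (S n), c); simpl; intros (?&?&?&?&?).
         replace (a + w (S n) + w (S n)) with (a + w n) by lra. repeat split; auto; lra. }
    destruct (classic (P a (a + w (S n)) (c + h (S n)) (c + h n))) as [P3|P3].
    2: { exists (a, c + h (S n)); simpl; intros (?&?&?&?&?).
         replace (c + h (S n) + h (S n)) with (c + h n) by lra. repeat split; auto; lra. }
    destruct (classic (P (a + w (S n)) (a + w n) (c + h (S n)) (c + h n))) as [P4|P4].
    2: { exists (a + w (S n), c + h (S n)); simpl; intros (?&?&?&?&?).
         replace (c + h (S n) + h (S n)) with (c + h n) by lra.
         replace (a + w (S n) + w (S n)) with (a + w n) by lra. repeat split; auto; lra. }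
    exists (a, c). intros (?&?&?&?&N). exfalso. apply N. apply Hm; try lra;
    replace ((a + (a + w n)) / 2) with (a + w (S n)) by lra;
    replace ((c + (c + h n)) / 2) with (c + h (S n)) by lra; auto. }
  destruct (choice _ step) as [nxt Hnxt].
  set (s := fix s n := match n with O => (A, C) | S n => nxt (n, s n) end).
  assert (Hbad : forall n, bad n (s n)).
  { induction n. unfold bad, w, h; simpl. replace (A + (B - A)/1) with B by field.
    replace (C + (D - C)/1) with D by field. repeat split; auto; lra.
    simpl. apply (Hnxt (n, s n)); auto. }
  assert (mono : forall n k, fst (s n) <= fst (s (n + k)%nat) /\ fst (s (n+k)%nat) + w (n+k)%nat <= fst (s n) + w n /\
      snd (s n) <= snd (s (n + k)%nat) /\ snd (s (n+k)%nat) + h (n+k)%nat <= snd (s n) + h n).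
  { intros n k. induction k. rewrite Nat.add_0_r. lra.
    rewrite Nat.add_succ_r. destruct (Hnxt ((n+k)%nat, s (n+k)%nat) (Hbad _)) as [_ H]. simpl in H.
    change (s (S (n + k))) with (nxt ((n+k)%nat, s (n+k)%nat)). lra. }
  assert (ex : forall (x y : nat -> R), (forall n k, x n <= x (n+k)%nat /\ x (n+k)%nat <= y n /\ x n <= y (n + k)%nat) ->
     exists t, forall n, x n <= t <= y n).
  { intros x y H. destruct (completeness (fun v => exists n, v = x n)) as [t Ht].
    - exists (y O). intros v [n ->]. apply (H O n).
    - exists (x O), O. auto.
    - exists t. intros n. split. apply Ht. exists n; auto. apply Ht. intros v [m ->].
      destruct (Nat.le_ge_cases n m) as [L|L].
      + replace m with (n + (m - n))%nat by lia. apply H.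
      + replace n with (m + (n - m))%nat by lia. apply H. }
  destruct (ex (fun n => fst (s n)) (fun n => fst (s n) + w n)) as [t Ht].
  { intros n k. pose proof (mono n k). pose proof (w0 (n+k)%nat). lra. }
  destruct (ex (fun n => snd (s n)) (fun n => snd (s n) + h n)) as [u Hu].
  { intros n k. pose proof (mono n k). pose proof (h0 (n+k)%nat). lra. }
  simpl in Ht, Hu.
  assert (Bt : A <= t <= B). { destruct (Hbad O) as (?&?&?&?&?). specialize (Ht O). lra. }
  assert (Bu : C <= u <= D). { destruct (Hbad O) as (?&?&?&?&?). specialize (Hu O). lra. }
  destruct (Hl t u Bt Bu) as [del [Hdel K]].
  assert (Ex : exists n, w n < del /\ h n < del).
  { destruct (pow_lt_1_zero (/2) ltac:(rewrite Rabs_pos_eq; lra) (del / ((B - A) + (D - C) + 1))) as [n Hn'].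
    apply Rdiv_lt_0_compat; lra. exists n. specialize (Hn' n (Nat.le_refl _)).
    rewrite Rabs_pos_eq in Hn' by (apply pow_le; lra). rewrite pow_inv in Hn'.
    unfold w, h, Rdiv. apply (Rmult_lt_compat_l ((B - A) + (D - C) + 1)) in Hn'; [|lra].
    replace ((B - A + (D - C) + 1) * (del / (B - A + (D - C) + 1))) with del in Hn' by (field; lra).
    assert (0 < / 2 ^ n) by (apply Rinv_0_lt_compat; auto). nra. }
  destruct Ex as [n [E1 E2]]. destruct (Hbad n) as (?&?&?&?&N). apply N. apply K; auto; try lra.
  all: try (specialize (Ht n); specialize (Hu n); lra).
  unfold w, h. field. apply Rgt_not_eq, p2.
Qed.

(** * Goursat's lemma and Cauchy's formula *)

Section Goursat.
Variables (rho : R) (zt : C) (Hzt : Cmod zt < rho).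

(** Affine homotopy from the point [zt] at t = 0 to the circle of radius [rho] about 0 at t = 1.
    Goursat's lemma is run over rectangles of parameters (t, th); t > 0 keeps their images away from
    [zt], the pole of f(x) / (x - zt). *)
Definition homotopy (t th : R) : C := (zt + t * (rho * E th - zt))%C.
(** The factors multiplying F in the two edge integrals are the derivatives of [homotopy] in t and
    in th, so that [boundary_int] is the contour integral of F along the image of the boundary of
    [a, b] x [c, d]. *)
Definition radial_edge (F : C -> C) (th a b : R) : C := cint (fun t => F (homotopy t th) * (rho * E th - zt))%C a b.
Definition circular_edge (F : C -> C) (t c d : R) : C := cint (fun th => F (homotopy t th) * (t * rho * Ci * E th))%C c d.
Definition boundary_int (F : C -> C) (a b c d : R) : C :=
  (radial_edge F c a b + circular_edge F b c d - radial_edge F d a b - circular_edge F a c d)%C.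

Definition cont_on_homotopy (F : C -> C) : Prop :=
  forall t th, 0 < t <= 1 -> lim_at (nC (homotopy t th)) F (F (homotopy t th)).

Lemma contR_at_gam_t t th : contR_at (fun t => homotopy t th) t.
Proof.
  unfold contR_at, homotopy. apply lim_plus; auto with mono. apply lim_const. apply lim_mult; auto with mono.
  apply contR_at_RtoC. apply lim_const.
Qed.
Lemma contR_at_gam_th t th : contR_at (fun th => homotopy t th) th.
Proof.
  unfold contR_at, homotopy. apply lim_plus; auto with mono. apply lim_const. apply lim_mult; auto with mono.
  apply lim_const. apply lim_minus; auto with mono. apply lim_mult; auto with mono. apply lim_const.
  apply contR_at_E. apply lim_const.
Qed.

Lemma contR_at_Sed F t th : cont_on_homotopy F -> 0 < t <= 1 -> contR_at (fun t => F (homotopy t th) * (rho * E th - zt))%C t.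
Proof.
  intros H Ht. unfold contR_at. apply lim_mult; auto with mono. 2: apply lim_const.
  apply (lim_compC (nR t) (fun t => homotopy t th) (homotopy t th)). apply contR_at_gam_t. apply H; auto.
Qed.
Lemma contR_at_Ted F t th : cont_on_homotopy F -> 0 < t <= 1 -> contR_at (fun th => F (homotopy t th) * (t * rho * Ci * E th))%C th.
Proof.
  intros H Ht. unfold contR_at. apply lim_mult; auto with mono.
  apply (lim_compC (nR th) (fun th => homotopy t th) (homotopy t th)). apply contR_at_gam_th. apply H; auto.
  apply lim_mult; auto with mono. apply lim_const. apply contR_at_E.
Qed.

Lemma boundary_int_split_t F a m b c d : cont_on_homotopy F -> 0 < a <= m -> m <= b <= 1 -> c <= d ->
  boundary_int F a b c d = (boundary_int F a m c d + boundary_int F m b c d)%C.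
Proof.
  intros HF H1 H2 H3. unfold boundary_int, radial_edge.
  rewrite <- (cint_Chasles a m ltac:(lra) (fun t => F (homotopy t c) * (rho * E c - zt))%C b); try lra.
  rewrite <- (cint_Chasles a m ltac:(lra) (fun t => F (homotopy t d) * (rho * E d - zt))%C b); try lra.
  ring. all: intros; apply contR_at_Sed; auto; lra.
Qed.
Lemma boundary_int_split_th F a b c m d : cont_on_homotopy F -> 0 < a <= b -> b <= 1 -> c <= m <= d ->
  boundary_int F a b c d = (boundary_int F a b c m + boundary_int F a b m d)%C.
Proof.
  intros HF H1 H2 H3. unfold boundary_int, circular_edge.
  rewrite <- (cint_Chasles c m ltac:(lra) (fun th => F (homotopy a th) * (a * rho * Ci * E th))%C d); try lra.
  rewrite <- (cint_Chasles c m ltac:(lra) (fun th => F (homotopy b th) * (b * rho * Ci * E th))%C d); try lra.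
  ring. all: intros; apply contR_at_Ted; auto; lra.
Qed.

Lemma cont_on_homotopy_lin al be : cont_on_homotopy (fun x => al + be * x)%C.
Proof.
  intros t th _. apply lim_plus; auto with mono. apply lim_const. apply lim_mult; auto with mono.
  apply lim_const. apply lim_id.
Qed.

Lemma boundary_int_lin al be a b c d : 0 < a <= b -> b <= 1 -> c <= d ->
  boundary_int (fun x => al + be * x)%C a b c d = 0.
Proof.
  intros H1 H2 H3.
  (* A primitive of the affine function: every edge integral becomes a difference of corner values,
     and these cancel around the boundary. *)
  set (Pr := fun x : C => (al * x + be * (x * x) * RtoC (/2))%C).
  assert (HS : forall th, radial_edge (fun x => al + be * x)%C th a b = (Pr (homotopy b th) - Pr (homotopy a th))%C).
  { intros th. apply (cint_FTC a b ltac:(lra) (fun t => Pr (homotopy t th))).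
    - intros. apply (contR_at_Sed (fun x => al + be * x)%C); [apply cont_on_homotopy_lin|lra].
    - intros t. unfold Pr, homotopy, E, Cplus, Cminus, Cmult, Copp, RtoC, Ci; simpl. auto_derive; auto. field.
    - intros t. unfold Pr, homotopy, E, Cplus, Cminus, Cmult, Copp, RtoC, Ci; simpl. auto_derive; auto. field. }
  assert (HT : forall t, a <= t <= b -> circular_edge (fun x => al + be * x)%C t c d = (Pr (homotopy t d) - Pr (homotopy t c))%C).
  { intros t Ht. apply (cint_FTC c d ltac:(lra) (fun th => Pr (homotopy t th))).
    - intros. apply (contR_at_Ted (fun x => al + be * x)%C); [apply cont_on_homotopy_lin|lra].
    - intros th. unfold Pr, homotopy, E, Cplus, Cminus, Cmult, Copp, RtoC, Ci; simpl. auto_derive; auto. field.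
    - intros th. unfold Pr, homotopy, E, Cplus, Cminus, Cmult, Copp, RtoC, Ci; simpl. auto_derive; auto. field. }
  unfold boundary_int. rewrite !HS, !HT by lra. ring.
Qed.

Lemma boundary_int_plus F G a b c d : cont_on_homotopy F -> cont_on_homotopy G -> 0 < a <= b -> b <= 1 -> c <= d ->
  boundary_int (fun x => F x + G x)%C a b c d = (boundary_int F a b c d + boundary_int G a b c d)%C.
Proof.
  intros HF HG H1 H2 H3.
  assert (HS : forall th, radial_edge (fun x => F x + G x)%C th a b = (radial_edge F th a b + radial_edge G th a b)%C).
  { intros th. unfold radial_edge. rewrite <- cint_plus; try lra.
    apply cint_ext; try lra. intros; ring. all: intros; apply contR_at_Sed; auto; lra. }
  assert (HT : forall t, a <= t <= b -> circular_edge (fun x => F x + G x)%C t c d = (circular_edge F t c d + circular_edge G t c d)%C).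
  { intros t Ht. unfold circular_edge. rewrite <- cint_plus; try lra.
    apply cint_ext; try lra. intros; ring. all: intros; apply contR_at_Ted; auto; lra. }
  unfold boundary_int. rewrite !HS, !HT by lra. ring.
Qed.

Lemma rho_pos : 0 < rho.
Proof. generalize (Cmod_ge_0 zt); lra. Qed.

Lemma Cmod_rhoE th : Cmod (rho * E th) = rho.
Proof. rewrite Cmod_mult, Cmod_E, Cmod_R, Rabs_pos_eq; generalize rho_pos; lra. Qed.

Lemma Cmod_edge th : Cmod (rho * E th - zt) <= 2 * rho.
Proof.
  pose proof (Cmod_triangle (rho * E th) (- zt)). rewrite Cmod_opp, Cmod_rhoE in H.
  unfold Cminus. lra.
Qed.

Lemma boundary_int_bound F a b c d M : cont_on_homotopy F -> 0 < a <= b -> b <= 1 -> c <= d -> 0 <= M ->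
  (forall t th, a <= t <= b -> c <= th <= d -> Cmod (F (homotopy t th)) <= M) ->
  Cmod (boundary_int F a b c d) <= 8 * rho * M * ((b - a) + (d - c)).
Proof.
  intros HF H1 H2 H3 HM HB. pose proof rho_pos as Hr.
  assert (HS : forall th, c <= th <= d -> Cmod (radial_edge F th a b) <= 2 * (b - a) * (M * (2 * rho))).
  { intros th Hth. apply cint_bound; try lra. intros; apply contR_at_Sed; auto; lra.
    intros t Ht. rewrite Cmod_mult. apply Rmult_le_compat; auto using Cmod_ge_0, Cmod_edge. }
  assert (HT : forall t, a <= t <= b -> Cmod (circular_edge F t c d) <= 2 * (d - c) * (M * rho)).
  { intros t Ht. apply cint_bound; try lra. intros; apply contR_at_Ted; auto; lra.
    intros th Hth. rewrite Cmod_mult. apply Rmult_le_compat; auto using Cmod_ge_0.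
    rewrite !Cmod_mult, Cmod_E, Cmod_Ci, !Cmod_R, !Rabs_pos_eq by lra. nra. }
  unfold boundary_int.
  pose proof (Cmod_triangle (radial_edge F c a b + circular_edge F b c d - radial_edge F d a b) (- circular_edge F a c d)) as T1.
  pose proof (Cmod_triangle (radial_edge F c a b + circular_edge F b c d) (- radial_edge F d a b)) as T2.
  pose proof (Cmod_triangle (radial_edge F c a b) (circular_edge F b c d)) as T3.
  rewrite Cmod_opp in T1, T2. fold (Cminus (radial_edge F c a b + circular_edge F b c d - radial_edge F d a b) (circular_edge F a c d)) in T1.
  fold (Cminus (radial_edge F c a b + circular_edge F b c d) (radial_edge F d a b)) in T2.
  pose proof (HS c ltac:(lra)). pose proof (HS d ltac:(lra)).
  pose proof (HT a ltac:(lra)). pose proof (HT b ltac:(lra)).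
  assert (0 <= rho * M * (d - c)) by (apply Rmult_le_pos; [apply Rmult_le_pos|]; lra). nra.
Qed.

Lemma homotopy_lip t th u ph : 0 <= t <= 1 -> 
  Cmod (homotopy t th - homotopy u ph) <= 2 * rho * (Rabs (t - u) + Rabs (th - ph)).
Proof.
  intros Ht. pose proof rho_pos as Hr.
  replace (homotopy t th - homotopy u ph)%C with ((t - u)%R * (rho * E ph - zt) + t * rho * (E th - E ph))%C
    by (unfold homotopy; rewrite RtoC_minus; ring).
  eapply Rle_trans; [apply Cmod_triangle|]. rewrite !Cmod_mult, !Cmod_R.
  rewrite (Rabs_pos_eq t), (Rabs_pos_eq rho) by lra.
  pose proof (Cmod_edge ph). pose proof (Cmod_E_diff th ph). pose proof (Rabs_pos (t - u)). pose proof (Rabs_pos (th - ph)).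
  pose proof (Cmod_ge_0 (E th - E ph)).
  assert (t * rho * Cmod (E th - E ph) <= rho * (2 * Rabs (th - ph))).
  { apply Rle_trans with (rho * Cmod (E th - E ph)). apply Rmult_le_compat_r; auto. nra. apply Rmult_le_compat_l; lra. }
  nra.
Qed.

(** The claim |boundary integral| <= K * area is stable under quartering, hence suited to
    [bisection]; K = eps / (W * H) makes it a bound by eps for the whole rectangle. Near a point of
    differentiability F is affine up to an error e0 * |x - x0|, and the affine part integrates to
    0. *)
Lemma Goursat F a b c d : (forall t th, 0 < t <= 1 -> cdiff F (homotopy t th)) ->
  0 < a < b -> b <= 1 -> c < d -> boundary_int F a b c d = 0.
Proof.
  intros HD H1 H2 H3. pose proof rho_pos as Hr.
  assert (HF : cont_on_homotopy F) by (intros t th Ht; apply cdiff_cont; auto).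
  apply Cmod_eq_0. apply Rle_antisym; [|apply Cmod_ge_0].
  apply le_epsilon. intros eps Heps. rewrite Rplus_0_l.
  set (W := b - a). set (H := d - c).
  assert (0 < W) by (unfold W; lra). assert (0 < H) by (unfold H; lra).
  assert (X : Cmod (boundary_int F a b c d) <= eps / (W * H) * ((b - a) * (d - c))).
  2: { replace (eps / (W * H) * ((b - a) * (d - c))) with eps in X; auto. unfold W, H in *. field. lra. }
  set (K := eps / (W * H)).
  assert (HK : 0 < K) by (apply Rdiv_lt_0_compat; [|apply Rmult_lt_0_compat]; lra).
  apply (bisection (fun a b c d => Cmod (boundary_int F a b c d) <= K * ((b - a) * (d - c)))); try lra.
  - intros a' b' c' d' A1 A2 A3 A4 B1 B2 B3 B4. set (m := (a'+b')/2) in *. set (n := (c'+d')/2) in *.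
    assert (a' <= m <= b') by (unfold m; lra). assert (c' <= n <= d') by (unfold n; lra).
    rewrite (boundary_int_split_t F a' m b' c' d') by (auto; lra).
    rewrite (boundary_int_split_th F a' m c' n d'), (boundary_int_split_th F m b' c' n d') by (auto; lra).
    pose proof (Cmod_triangle (boundary_int F a' m c' n + boundary_int F a' m n d') (boundary_int F m b' c' n + boundary_int F m b' n d')).
    pose proof (Cmod_triangle (boundary_int F a' m c' n) (boundary_int F a' m n d')).
    pose proof (Cmod_triangle (boundary_int F m b' c' n) (boundary_int F m b' n d')).
    nra.
  - intros t u Ht Hu. destruct (HD t u ltac:(lra)) as [l Hl].
    (* The error term integrates to at most 16 * rho^2 * e0 * (w + h)^2. For sides w, h proportional
       to W, H this choice of e0 makes the bound exactly K * (w * h). *)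
    set (e0 := K * (W * H) / (16 * rho * rho * ((W + H) * (W + H)))).
    assert (He0 : 0 < e0).
    { apply Rdiv_lt_0_compat. apply Rmult_lt_0_compat; auto. apply Rmult_lt_0_compat; auto.
      repeat apply Rmult_lt_0_compat; lra. }
    destruct (isder_eps _ _ _ Hl e0 He0) as [del [Hdel D]].
    exists (del / (8 * rho)). split. apply Rdiv_lt_0_compat; lra.
    intros a' b' c' d' A1 A2 A3 A4 A5 A6 A7 A8 A9.
    set (x0 := homotopy t u) in *.
    set (G := fun x => (F x + (-1) * (F x0 - l * x0) + (-1) * l * x)%C).
    assert (HG : cont_on_homotopy G).
    { intros s th Hs. unfold G. apply lim_plus; auto with mono. apply lim_plus; auto with mono. apply lim_const.
      apply lim_mult; auto with mono. apply lim_const. apply lim_id. }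
    replace (boundary_int F a' b' c' d') with (boundary_int (fun x => G x + ((F x0 - l * x0) + l * x))%C a' b' c' d').
    2: { f_equal. apply functional_extensionality. intros x. unfold G. ring. }
    rewrite boundary_int_plus; try lra; auto using cont_on_homotopy_lin. rewrite boundary_int_lin by lra. rewrite Cplus_0_r.
    set (w := b' - a') in *. set (h := d' - c') in *.
    assert (Hw : 0 <= w) by (unfold w; lra). assert (Hh : 0 <= h) by (unfold h; lra).
    assert (Lp : forall s th, a' <= s <= b' -> c' <= th <= d' -> Cmod (homotopy s th - x0) <= 2 * rho * (w + h)).
    { intros s th Hs Hth. eapply Rle_trans. apply homotopy_lip; lra. apply Rmult_le_compat_l; [lra|].
      apply Rplus_le_compat; apply Rabs_le; unfold w, h; lra. }
    eapply Rle_trans. apply (boundary_int_bound G a' b' c' d' (e0 * (2 * rho * (w + h)))); try lra; auto.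
    { apply Rmult_le_pos; [lra|]. apply Rmult_le_pos; lra. }
    { intros s th Hs Hth. specialize (Lp s th Hs Hth).
      replace (G (homotopy s th)) with (F (homotopy s th) - F x0 - l * (homotopy s th - x0))%C by (unfold G; ring).
      eapply Rle_trans. apply D. unfold nC. eapply Rle_lt_trans; [apply Lp|].
      assert (Hwh : w + h < 2 * (del / (8 * rho))) by lra.
      apply (Rmult_lt_compat_l (2 * rho)) in Hwh; [|lra].
      replace (2 * rho * (2 * (del / (8 * rho)))) with (del / 2) in Hwh by (field; lra). lra.
      apply Rmult_le_compat_l; lra. }
    fold w h W H in A9 |- *.
    assert (Hh' : h = w * H / W) by (apply (Rmult_eq_reg_r W); [|lra]; rewrite <- A9; field; lra).
    right. unfold e0. rewrite Hh'. field. lra.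
Qed.
End Goursat.

(** The Cauchy kernel d zeta / (i * (zeta - zt)) on the circle |zeta| = [rho], expressed in the
    angle. *)
Definition kern (rho : R) (zt : C) (th : R) : C := (rho * E th / (rho * E th - zt))%C.

Lemma rhoE_sub_nz rho zt th : Cmod zt < rho -> (rho * E th - zt)%C <> 0.
Proof.
  intros H. apply Cmod_gt_0. pose proof (Cmod_ge_diff (rho * E th) zt). rewrite (Cmod_rhoE rho zt H) in H0. lra.
Qed.

Lemma contR_at_kern rho zt th : Cmod zt < rho -> contR_at (kern rho zt) th.
Proof.
  intros H. unfold contR_at, kern. apply lim_div; auto with mono. apply rhoE_sub_nz; auto.
  apply lim_mult; auto with mono. apply lim_const. apply contR_at_E.
  apply lim_minus; auto with mono. apply lim_mult; auto with mono. apply lim_const. apply contR_at_E. apply lim_const.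
Qed.

Lemma Cmod_gam rho zt t th : Cmod zt < rho -> 0 <= t <= 1 -> Cmod (homotopy rho zt t th) <= rho.
Proof.
  intros H Ht. replace (homotopy rho zt t th) with ((1 - t)%R * zt + t * (rho * E th))%C
   by (unfold homotopy; rewrite RtoC_minus; ring).
  eapply Rle_trans; [apply Cmod_triangle|]. rewrite Cmod_mult, (Cmod_mult t), (Cmod_rhoE rho zt), !Cmod_R, !Rabs_pos_eq by (auto; lra).
  nra.
Qed.

(** Let Psi t be the integral of f against the kernel along the image of the circle at time t of the
    homotopy. Goursat's lemma for f(x) / (x - zt) shows that Psi is constant for t > 0, the radial
    edges at angles 0 and 2 PI being equal; continuity at t = 0, where the image is the single point
    [zt], gives the formula. *)
Lemma Cauchy_kern f Rr rho zt : Cmod zt < rho -> rho < Rr -> (forall z, Cmod z < Rr -> cdiff f z) ->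
  (f zt * cint (kern rho zt) 0 (2 * PI))%C = cint (fun th => f (rho * E th) * kern rho zt th)%C 0 (2 * PI).
Proof.
  intros H1 H2 Hf. pose proof PI_RGT_0 as HPI. pose proof (rho_pos _ _ H1) as Hr.
  set (Psi := fun t => cint (fun th => f (homotopy rho zt t th) * kern rho zt th)%C 0 (2 * PI)).
  assert (Hc : forall t, 0 < t < 1 -> Psi 1 = Psi t).
  { intros t Ht.
    set (F := fun x => (f x / (x - zt))%C).
    assert (Hg : forall s th, s <> 0 -> (homotopy rho zt s th - zt)%C <> 0).
    { intros s th Hs. replace (homotopy rho zt s th - zt)%C with (s * (rho * E th - zt))%C by (unfold homotopy; ring).
      apply Cmult_neq_0; [|apply rhoE_sub_nz; auto]. intros E0. apply Hs. apply RtoC_inj; auto. }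
    assert (HF : forall s th, 0 < s <= 1 -> cdiff F (homotopy rho zt s th)).
    { intros s th Hs. apply cdiff_div. apply Hg; lra. apply Hf.
      apply Rle_lt_trans with rho; auto. apply Cmod_gam; auto; lra.
      apply cdiff_minus. apply cdiff_id. apply cdiff_const. }
    assert (HT : forall s, 0 < s <= 1 -> circular_edge rho zt F s 0 (2 * PI) = (Ci * Psi s)%C).
    { intros s Hs. unfold circular_edge, Psi. rewrite <- cint_scal; try lra.
      - apply cint_ext; try lra. intros th _. unfold F, kern, homotopy. field. split. apply rhoE_sub_nz; auto.
        replace (zt + s * (rho * E th - zt) - zt)%C with (homotopy rho zt s th - zt)%C by (unfold homotopy; ring).
        apply Hg; lra.
      - intros th _. unfold contR_at. apply lim_mult; auto with mono. 2: apply contR_at_kern; auto.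
        apply (lim_compC (nR th) (fun th => homotopy rho zt s th) (homotopy rho zt s th)). apply contR_at_gam_th.
        apply cdiff_cont, Hf. apply Rle_lt_trans with rho; auto. apply Cmod_gam; auto; lra. }
    pose proof (Goursat rho zt H1 F t 1 0 (2 * PI) HF ltac:(lra) ltac:(lra) ltac:(lra)) as G.
    unfold boundary_int in G.
    assert (ES : radial_edge rho zt F 0 t 1 = radial_edge rho zt F (2 * PI) t 1).
    { unfold radial_edge, homotopy. rewrite E_0, E_2PI. auto. }
    rewrite ES, !HT in G by lra.
    assert (Ci <> 0) by apply Ci_nz.
    assert (G' : (Ci * (Psi 1 - Psi t))%C = 0) by (rewrite <- G; ring).
    apply Ceq_minus. apply NNPP. intros Hn. apply (Cmult_neq_0 _ _ H Hn). auto. }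
  assert (HL : lim_at (nR 0) Psi (Psi 0)).
  (* The neighbourhood of t = 0 is two-sided: for small negative t the homotopy must also stay in
     the disc where f is differentiable. *)
  { assert (Hin : exists d, 0 < d /\ forall t, nR 0 d t -> forall th, Cmod (homotopy rho zt t th) < Rr).
    { exists ((Rr - rho) / (2 * rho)). split. apply Rdiv_lt_0_compat; lra. unfold nR. intros t Ht th.
      pose proof (homotopy_lip rho zt H1 0 th t th ltac:(lra)) as L. rewrite Cmod_sub_sym in L.
      replace (th - th) with 0 in L by ring. rewrite Rabs_R0, Rplus_0_r in L.
      rewrite <- Rabs_Ropp in L. replace (- (0 - t)) with (t - 0) in L by ring.
      pose proof (Cmod_ge_diff (homotopy rho zt t th) (homotopy rho zt 0 th)).
      pose proof (Cmod_gam rho zt 0 th H1 ltac:(lra)).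
      apply (Rmult_lt_compat_l (2 * rho)) in Ht; [|lra].
      replace (2 * rho * ((Rr - rho) / (2 * rho))) with (Rr - rho) in Ht by (field; lra). lra. }
    destruct Hin as [dd [Hdd Hin]].
    assert (cg : forall t th, Cmod (homotopy rho zt t th) < Rr ->
      lim_at (nP (nR t) (nR th)) (fun q => f (homotopy rho zt (fst q) (snd q)) * kern rho zt (snd q))%C
         (f (homotopy rho zt t th) * kern rho zt th)%C).
    { intros t th Ht. apply lim_mult; auto with mono.
      - apply (lim_compC _ (fun q => homotopy rho zt (fst q) (snd q)) (homotopy rho zt t th)).
        2: apply cdiff_cont; auto.
        unfold homotopy. apply lim_plus; auto with mono. apply lim_const. apply lim_mult; auto with mono.
        apply (lim_fst _ _ RtoC), contR_at_RtoC. apply lim_minus; auto with mono. 2: apply lim_const.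
        apply lim_mult; auto with mono. apply lim_const. apply (lim_snd _ _ E), contR_at_E.
      - apply (lim_snd _ _ (kern rho zt)). apply contR_at_kern; auto. }
    apply (cint_lim 0 (2*PI) ltac:(lra) (nR 0) (monoN_R 0) 0).
    - intros d Hd. unfold nR. replace (0 - 0) with 0 by ring. rewrite Rabs_R0; auto.
    - exists dd; split; auto. intros t Ht th _.
      apply (lim_comp (nR th) (nP (nR t) (nR th)) (fun th => (t, th)) (fun q => f (homotopy rho zt (fst q) (snd q)) * kern rho zt (snd q))%C).
      intros d Hd. exists d; split; auto. intros p Hp. split; auto. unfold nR; simpl.
      replace (t - t) with 0 by ring. rewrite Rabs_R0; auto. apply cg; auto.
    - intros th _. apply (cg 0 th). apply Hin. unfold nR. replace (0 - 0) with 0 by ring. rewrite Rabs_R0; auto. }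
  assert (E01 : Psi 1 = Psi 0).
  { apply NNPP. intros Hn. destruct (HL (Cmod (Psi 1 - Psi 0))) as [d [Hd K]].
    apply Cmod_gt_0, Cminus_eq_contra; auto.
    pose proof (Rmin_l (d/2) (1/2)). pose proof (Rmin_r (d/2) (1/2)).
    assert (0 < Rmin (d/2) (1/2)) by (apply Rmin_glb_lt; lra).
    specialize (K (Rmin (d/2) (1/2))). rewrite (Hc (Rmin (d/2) (1/2))) in K by lra.
    unfold nR in K. rewrite Rminus_0_r, Rabs_pos_eq in K by lra. specialize (K ltac:(lra)). lra. }
  transitivity (Psi 0).
  - unfold Psi. rewrite <- cint_scal; try lra. apply cint_ext; try lra. intros th _. unfold homotopy.
    replace (zt + 0 * (rho * E th - zt))%C with zt by ring. auto. intros; apply contR_at_kern; auto.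
  - rewrite <- E01. unfold Psi. apply cint_ext; try lra. intros th _. unfold homotopy.
    replace (zt + 1 * (rho * E th - zt))%C with (rho * E th)%C by ring. auto.
Qed.

Lemma E_pow n th : (E th ^ n)%C = E (INR n * th).
Proof.
  induction n. simpl. rewrite Rmult_0_l, E_0. auto.
  rewrite Cpow_S, IHn, S_INR. unfold E, Cmult; simpl.
  replace ((INR n + 1) * th) with (th + INR n * th) by ring. rewrite cos_plus, sin_plus. f_equal; ring.
Qed.

Lemma E_inv th : (/ E th)%C = E (- th).
Proof.
  assert (H : (E th * E (- th))%C = 1).
  { unfold E, Cmult, RtoC; simpl. rewrite cos_neg, sin_neg. f_equal; [|ring].
    generalize (sin2_cos2 th). unfold Rsqr. lra. }
  assert (E th <> 0). { apply Cmod_gt_0. rewrite Cmod_E; lra. }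
  apply (f_equal (fun x => / E th * x)%C) in H. rewrite Cmult_assoc, Cinv_l, Cmult_1_l, Cmult_1_r in H; auto.
Qed.

Lemma cint_Epow n : (1 <= n)%nat -> cint (fun th => (/ E th) ^ n)%C 0 (2 * PI) = 0.
Proof.
  intros Hn. pose proof PI_RGT_0. assert (Hn' : INR n <> 0) by (apply not_0_INR; lia).
  rewrite (cint_ext _ (fun th => E (INR n * (- th))) 0 (2*PI)); try lra.
  2: { intros th _. rewrite E_inv, E_pow. auto. }
  rewrite (cint_FTC 0 (2*PI) ltac:(lra) (fun th => (- sin (INR n * (- th)) / INR n, cos (INR n * (- th)) / INR n))).
  - assert (P1 : forall k, cos (INR k * - (2 * PI)) = 1 /\ sin (INR k * - (2 * PI)) = 0).
    { induction k. simpl. rewrite Rmult_0_l, cos_0, sin_0. auto.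
      rewrite S_INR. replace ((INR k + 1) * - (2 * PI)) with (INR k * - (2 * PI) - 2 * PI) by ring.
      rewrite cos_minus, sin_minus. destruct IHk as [-> ->]. rewrite cos_2PI, sin_2PI. lra. }
    destruct (P1 n) as [-> ->]. replace (INR n * - 0) with 0 by ring. rewrite cos_0, sin_0.
    unfold Cminus, Cplus, Copp, RtoC; simpl. f_equal; field; auto.
  - intros t _. apply (lim_comp (nR t) (nR (INR n * - t)) (fun t => INR n * - t) E); [|apply contR_at_E].
    intros d Hd. assert (0 < INR n) by (apply lt_0_INR; lia). exists (d / INR n). split. apply Rdiv_lt_0_compat; auto.
    unfold nR. intros s Hs. replace (INR n * - s - INR n * - t) with (- (INR n * (s - t))) by ring.
    rewrite Rabs_Ropp, Rabs_mult, (Rabs_pos_eq (INR n)) by lra.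
    apply (Rmult_lt_compat_l (INR n)) in Hs; auto. replace (INR n * (d / INR n)) with d in Hs by (field; auto). auto.
  - intros t. unfold E; simpl. auto_derive; auto. field; auto.
  - intros t. unfold E; simpl. auto_derive; auto. field; auto.
Qed.

Lemma cint_const_one : cint (fun _ => RtoC 1) 0 (2 * PI) = RtoC (2 * PI).
Proof.
  unfold cint, RtoC; simpl. rewrite !RInt_const. unfold scal; simpl. unfold mult; simpl. f_equal; ring.
Qed.

(** Geometric series: the kernel satisfies kern = 1 + (zt / rho) * E^(-1) * kern. Iterating, all
    powers E^(-n) with n >= 1 integrate to 0, and the remainder carries the factor (|zt| /
    rho)^(m+1) against a bound independent of m. *)
Lemma cint_kern rho zt : Cmod zt < rho -> cint (kern rho zt) 0 (2 * PI) = RtoC (2 * PI).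
Proof.
  intros H. pose proof PI_RGT_0 as HPI. pose proof (rho_pos _ _ H) as Hr.
  assert (Hrc : RtoC rho <> 0) by (intros E0; apply RtoC_inj in E0; lra).
  assert (HE : forall th, E th <> 0) by (intros th; apply Cmod_gt_0; rewrite Cmod_E; lra).
  set (c := Cmod zt / rho). assert (Hc : 0 <= c < 1).
  { unfold c. split. apply Rdiv_le_0_compat; auto; apply Cmod_ge_0.
    apply Rmult_lt_reg_r with rho; auto. unfold Rdiv. rewrite Rmult_assoc, Rinv_l; lra. }
  assert (cE : forall th, contR_at (fun th => / E th)%C th).
  { intros th. unfold contR_at. apply lim_inv; auto with mono. apply contR_at_E. }
  assert (step : forall m, cint (kern rho zt) 0 (2 * PI) =
     (RtoC (2 * PI) + (zt / rho) ^ (S m) * cint (fun th => (/ E th) ^ (S m) * kern rho zt th) 0 (2 * PI))%C).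
  { assert (cont : forall m th, contR_at (fun th => (/ E th) ^ m * kern rho zt th)%C th).
    { intros m th. unfold contR_at. apply lim_mult; auto with mono. apply lim_pow; auto with mono. apply cE. apply contR_at_kern; auto. }
    assert (st : forall m, cint (fun th => (/ E th) ^ m * kern rho zt th)%C 0 (2 * PI) =
       (cint (fun th => (/ E th) ^ m) 0 (2*PI) + (zt / rho) * cint (fun th => (/ E th) ^ (S m) * kern rho zt th) 0 (2 * PI))%C).
    { intros m. rewrite <- cint_scal, <- cint_plus; try lra; auto.
      - apply cint_ext; try lra. intros th _. rewrite Cpow_S. unfold kern. field. repeat split; auto. apply rhoE_sub_nz; auto.
      - intros th _. unfold contR_at. apply lim_pow; auto with mono. apply cE.
      - intros th _. unfold contR_at. apply lim_mult; auto with mono. apply lim_const. apply cont. }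
    induction m.
    - rewrite <- cint_const_one.
      transitivity (cint (fun th => (/ E th) ^ 0 * kern rho zt th)%C 0 (2 * PI)).
      apply cint_ext; try lra. intros. simpl. ring. rewrite st. simpl. ring.
    - rewrite IHm at 1. rewrite (st (S m)), cint_Epow by lia. rewrite (Cpow_S _ (S m)). ring. }
  destruct (classic (cint (kern rho zt) 0 (2 * PI) = RtoC (2 * PI))) as [|Hn]; auto. exfalso.
  set (D := Cmod (cint (kern rho zt) 0 (2 * PI) - RtoC (2 * PI))).
  assert (HD : 0 < D) by (apply Cmod_gt_0, Cminus_eq_contra; auto).
  set (M := rho / (rho - Cmod zt)). assert (HM : 0 < M) by (apply Rdiv_lt_0_compat; lra).
  assert (bk : forall th, Cmod (kern rho zt th) <= M).
  { intros th. unfold kern. rewrite Cmod_div by (apply rhoE_sub_nz; auto). rewrite (Cmod_rhoE rho zt H). unfold M, Rdiv.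
    apply Rmult_le_compat_l; [lra|]. apply Rinv_le_contravar; [lra|].
    pose proof (Cmod_ge_diff (rho * E th) zt). rewrite (Cmod_rhoE rho zt H) in H0. lra. }
  assert (bnd : forall m, D <= c ^ (S m) * (2 * (2 * PI - 0) * M)).
  { intros m. unfold D. rewrite (step m) at 1.
    match goal with |- Cmod (?a + ?b - ?a) <= _ => replace (a + b - a)%C with b by ring end.
    rewrite Cmod_mult, Cmod_pow, Cmod_div, Cmod_R, (Rabs_pos_eq rho) by (auto; lra). fold c.
    apply Rmult_le_compat_l. apply pow_le; lra. apply cint_bound; try lra.
    - intros th _. unfold contR_at. apply lim_mult; auto with mono. apply lim_pow; auto with mono. apply cE. apply contR_at_kern; auto.
    - intros th _. rewrite Cmod_mult, Cmod_pow, Cmod_inv, Cmod_E, Rinv_1, pow1, Rmult_1_l; auto. }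
  destruct (pow_lt_1_zero c ltac:(rewrite Rabs_pos_eq; lra) (D / (2 * (2 * PI - 0) * M))) as [n Hn'].
  apply Rdiv_lt_0_compat; auto. apply Rmult_lt_0_compat; lra.
  specialize (Hn' (S n) ltac:(lia)). rewrite Rabs_pos_eq in Hn' by (apply pow_le; lra).
  specialize (bnd n). assert (0 < 2 * (2 * PI - 0) * M) by (apply Rmult_lt_0_compat; lra).
  apply (Rmult_lt_compat_r (2 * (2 * PI - 0) * M)) in Hn'; auto.
  set (X := 2 * (2 * PI - 0) * M) in *.
  replace (D / X * X) with D in Hn' by (field; lra). lra.
Qed.

Definition Mean (h : R -> C) : C := (RtoC (/ (2 * PI)) * cint h 0 (2 * PI))%C.

Theorem Cauchy_formula f Rr rho zt : Cmod zt < rho -> rho < Rr -> (forall z, Cmod z < Rr -> cdiff f z) ->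
  f zt = Mean (fun th => f (rho * E th) * kern rho zt th)%C.
Proof.
  intros H1 H2 Hf. unfold Mean. rewrite <- (Cauchy_kern f Rr rho zt) by auto. rewrite cint_kern by auto.
  pose proof PI_RGT_0. rewrite RtoC_inv by lra. field. intros E0. apply RtoC_inj in E0. lra.
Qed.

(** * Holomorphic dependence on parameters *)

Lemma Mean_ext h g : (forall t, h t = g t) -> Mean h = Mean g.
Proof. intros H. replace g with h; auto. apply functional_extensionality; auto. Qed.

Lemma Mean_plus h g : (forall t, contR_at h t) -> (forall t, contR_at g t) -> Mean (fun t => h t + g t)%C = (Mean h + Mean g)%C.
Proof. intros. pose proof PI_RGT_0. unfold Mean. rewrite cint_plus; auto; try lra. ring. Qed.

Lemma Mean_scal c h : (forall t, contR_at h t) -> Mean (fun t => c * h t)%C = (c * Mean h)%C.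
Proof. intros. pose proof PI_RGT_0. unfold Mean. rewrite cint_scal; auto; try lra. ring. Qed.

Lemma Mean_bound h M : (forall t, contR_at h t) -> (forall t, 0 <= t <= 2 * PI -> Cmod (h t) <= M) -> Cmod (Mean h) <= 2 * M.
Proof.
  intros Hh HM. pose proof PI_RGT_0. unfold Mean. rewrite Cmod_mult, Cmod_R.
  assert (0 < / (2 * PI)) by (apply Rinv_0_lt_compat; lra).
  rewrite Rabs_pos_eq by lra.
  pose proof (cint_bound 0 (2 * PI) ltac:(lra) h M ltac:(auto) ltac:(auto)) as B.
  apply Rle_trans with (/ (2 * PI) * (2 * (2 * PI - 0) * M)). apply Rmult_le_compat_l; lra.
  right. field. lra.
Qed.

Lemma Mean_lim {P} (N : R -> P -> Prop) (HN : monoN N) (p0 : P) (Hp0 : forall d, 0 < d -> N d p0) (G : P -> R -> C) :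
  (exists d, 0 < d /\ forall p, N d p -> forall t, contR_at (G p) t) ->
  (forall t, lim_at (nP N (nR t)) (fun q => G (fst q) (snd q)) (G p0 t)) ->
  lim_at N (fun p => Mean (G p)) (Mean (G p0)).
Proof.
  intros [d [Hd K]] H. pose proof PI_RGT_0. unfold Mean. apply lim_mult; auto. apply lim_const.
  apply (cint_lim 0 (2 * PI) ltac:(lra) N HN p0 Hp0 G); auto. exists d; split; auto.
Qed.

Lemma nR_refl t d : 0 < d -> nR t d t.
Proof. intros. unfold nR. replace (t - t) with 0 by ring. rewrite Rabs_R0; auto. Qed.
Lemma nX_refl n x d : 0 < d -> nX n x d x.
Proof. intros H i Hi. rewrite Cmod_diag; auto. Qed.
#[local] Hint Resolve nR_refl nX_refl : mono.

Lemma lim_sec_snd {P} (N : R -> P -> Prop) (p0 : P) (Hp0 : forall d, 0 < d -> N d p0) (F : P * R -> C) t l :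
  lim_at (nP N (nR t)) F l -> lim_at (nR t) (fun s => F (p0, s)) l.
Proof. apply lim_comp. intros d Hd. exists d; split; auto. intros p Hp. split; simpl; auto. Qed.

Lemma contR_at_rhoE rho t : contR_at (fun t => rho * E t)%C t.
Proof. unfold contR_at. apply lim_mult; auto with mono. apply lim_const. apply contR_at_E. Qed.

(** The divided difference of the Cauchy kernel with respect to its pole; at w = z it is the kernel
    of Cauchy's formula for the derivative. *)
Definition kern2 (rho : R) (z w : C) (th : R) : C := (rho * E th / ((rho * E th - w) * (rho * E th - z)))%C.

Lemma kern_diff rho z w th : Cmod z < rho -> Cmod w < rho ->
  kern rho w th = (kern rho z th + (w - z) * kern2 rho z w th)%C.
Proof. intros Hz Hw. unfold kern, kern2. field. split; apply rhoE_sub_nz; auto. Qed.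

Lemma lim_kern2 {P} (N : R -> P -> Prop) (HN : monoN N) rho z (w : P -> C) (th : P -> R) w0 th0 :
  Cmod z < rho -> Cmod w0 < rho -> lim_at N w w0 -> lim_at N (fun p => E (th p)) (E th0) ->
  lim_at N (fun p => kern2 rho z (w p) (th p)) (kern2 rho z w0 th0).
Proof.
  intros Hz Hw0 Lw Lth. unfold kern2. assert (lim_at N (fun p => rho * E (th p))%C (rho * E th0)%C).
  { apply lim_mult; auto. apply lim_const. }
  apply lim_div; auto. apply Cmult_neq_0; apply rhoE_sub_nz; auto.
  apply lim_mult; auto; apply lim_minus; auto. apply lim_const.
Qed.

Lemma disc_open (z : C) rho : Cmod z < rho -> exists d, 0 < d /\ forall w, nC z d w -> Cmod w < rho.
Proof.
  intros H. exists (rho - Cmod z). split; [lra|]. unfold nC. intros w Hw. pose proof (Cmod_ge_diff w z). lra.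
Qed.

Definition cauchy_transform (h : R -> C) (rho : R) (z : C) : C := Mean (fun th => h th * kern rho z th)%C.

Section CauchyTransform.
Variables (h : R -> C) (rho : R) (Hh : forall t, contR_at h t).

Lemma contR_at_kern2 z w : Cmod z < rho -> Cmod w < rho -> forall t, contR_at (fun th => h th * kern2 rho z w th)%C t.
Proof.
  intros Hz Hw t. unfold contR_at. apply lim_mult; auto with mono. apply Hh.
  apply (lim_kern2 (nR t) (monoN_R t) rho z (fun _ => w) (fun s => s)); auto. apply lim_const. apply contR_at_E.
Qed.

Lemma cauchy_transform_diff z w : Cmod z < rho -> Cmod w < rho ->
  cauchy_transform h rho w = (cauchy_transform h rho z + Mean (fun th => h th * kern2 rho z w th) * (w - z))%C.
Proof.
  intros Hz Hw. unfold cauchy_transform.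
  rewrite (Cmult_comm _ (w - z)%C). rewrite <- Mean_scal by (apply contR_at_kern2; auto). rewrite <- Mean_plus.
  - apply Mean_ext. intros t. rewrite (kern_diff rho z w) by auto. ring.
  - intros t. unfold contR_at. apply lim_mult; auto with mono. apply Hh. apply contR_at_kern; auto.
  - intros t. unfold contR_at. apply lim_mult; auto with mono. apply lim_const. apply contR_at_kern2; auto.
Qed.

(** In Caratheodory's form, differentiation under the integral sign reduces to continuity of an
    integral in a parameter: the slope function is the mean of h against [kern2]. *)
Lemma isder_CT z : Cmod z < rho -> isder (cauchy_transform h rho) z (Mean (fun th => h th * kern2 rho z z th)%C).
Proof.
  intros Hz. exists (fun w => Mean (fun th => h th * kern2 rho z w th)%C). split; auto.
  destruct (disc_open z rho Hz) as [d [Hd K]]. split.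
  - apply (Mean_lim (nC z) (monoN_C z) z (nC_refl z) (fun w th => h th * kern2 rho z w th)%C).
    + exists d; split; auto. intros w Hw. apply contR_at_kern2; auto.
    + intros t. apply lim_mult; auto with mono. apply (lim_snd _ _ h). apply Hh.
      apply (lim_kern2 _ (monoN_P _ _ (monoN_C z) (monoN_R t)) rho z fst snd); auto.
      apply (lim_fst _ _ (fun w => w)), lim_id. apply (lim_snd _ _ E), contR_at_E.
  - exists d; split; auto. intros w Hw. apply cauchy_transform_diff; auto.
Qed.
End CauchyTransform.

Definition hol (Rr : R) (f : C -> C) : Prop := forall z, Cmod z < Rr -> cdiff f z.

Lemma hol_circ Rr f rho : hol Rr f -> 0 <= rho < Rr -> forall t, contR_at (fun th => f (rho * E th))%C t.
Proof.
  intros Hf Hr t. unfold contR_at. apply (lim_compC (nR t) (fun th => rho * E th)%C (rho * E t)%C). apply contR_at_rhoE.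
  apply cdiff_cont, Hf. rewrite Cmod_mult, Cmod_E, Cmod_R, Rabs_pos_eq; lra.
Qed.

Lemma hol_CT Rr f rho z : hol Rr f -> rho < Rr -> Cmod z < rho -> f z = cauchy_transform (fun th => f (rho * E th))%C rho z.
Proof. intros Hf H1 H2. apply (Cauchy_formula f Rr); auto. Qed.

Lemma hol_isder Rr f rho z : hol Rr f -> rho < Rr -> Cmod z < rho ->
  isder f z (Mean (fun th => f (rho * E th) * kern2 rho z z th)%C).
Proof.
  intros Hf H1 H2. pose proof (Cmod_ge_0 z).
  apply (isder_ext (cauchy_transform (fun th => f (rho * E th))%C rho)).
  - destruct (disc_open z rho H2) as [d [Hd K]]. exists d; split; auto. intros w Hw. symmetry. eapply hol_CT; eauto.
  - apply isder_CT; auto. apply (hol_circ Rr); auto; lra.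
Qed.

Lemma hol_mean Rr f rho : hol Rr f -> 0 < rho < Rr -> Mean (fun th => f (rho * E th)%C) = f 0.
Proof.
  intros Hf Hr. rewrite (hol_CT Rr f rho 0); auto; try lra. 2: rewrite Cmod_0; lra.
  unfold cauchy_transform. apply Mean_ext. intros t. unfold kern.
  assert (RtoC rho <> 0) by (intros E0; apply RtoC_inj in E0; lra).
  assert (E t <> 0) by (apply Cmod_gt_0; rewrite Cmod_E; lra). field. split; auto.
Qed.

(** Near [a] the quotient f(z) / (z - a) coincides with a Cauchy transform, that of f(zeta) / (zeta
    - a) on a circle enclosing [a]. The singularity is therefore removable, with value [q a]. *)
Lemma hol_factor Rr f a : hol Rr f -> Cmod a < Rr -> f a = 0 ->
  exists g, hol Rr g /\ forall z, Cmod z < Rr -> f z = ((z - a) * g z)%C.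
Proof.
  intros Hf Ha Hfa. pose proof (Cmod_ge_0 a). set (rho := (Cmod a + Rr) / 2).
  assert (Hr : Cmod a < rho < Rr) by (unfold rho; lra).
  set (q := fun w => Mean (fun th => f (rho * E th) * kern2 rho a w th)%C).
  assert (Hc : forall t, contR_at (fun th => f (rho * E th))%C t) by (apply (hol_circ Rr); auto; lra).
  assert (Hq : forall w, Cmod w < rho -> f w = ((w - a) * q w)%C).
  { intros w Hw. rewrite (hol_CT Rr f rho w); auto; try lra. rewrite (cauchy_transform_diff _ rho Hc a w); try lra.
    rewrite <- (hol_CT Rr f rho a); auto; try lra. rewrite Hfa. unfold q. ring. }
  exists (fun z => if excluded_middle_informative (z = a) then q a else (f z / (z - a))%C). split.
  - intros z Hz. destruct (excluded_middle_informative (z = a)) as [->|Hn].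
    + apply (cdiff_ext (cauchy_transform (fun th => f (rho * E th) / (rho * E th - a))%C rho)).
      * destruct (disc_open a rho ltac:(lra)) as [d [Hd K]]. exists d; split; auto. intros w Hw.
        specialize (K w Hw). transitivity (q w).
        { unfold cauchy_transform, q. apply Mean_ext. intros t. unfold kern, kern2. field. split; apply rhoE_sub_nz; lra. }
        destruct (excluded_middle_informative (w = a)) as [->|Hn]; auto.
        rewrite (Hq w K). field. apply Cminus_eq_contra; auto.
      * eexists. apply isder_CT; try lra. intros t. unfold contR_at. apply lim_div; auto with mono.
        apply rhoE_sub_nz; lra. apply Hc. apply lim_minus; auto with mono. apply contR_at_rhoE. apply lim_const.
    + apply (cdiff_ext (fun z => f z / (z - a))%C).
      * exists (Cmod (z - a)). split. apply Cmod_gt_0, Cminus_eq_contra; auto. unfold nC. intros w Hw.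
        destruct (excluded_middle_informative (w = a)) as [->|]; auto. rewrite Cmod_sub_sym in Hw. lra.
      * apply cdiff_div; auto. apply Cminus_eq_contra; auto. apply cdiff_minus. apply cdiff_id. apply cdiff_const.
  - intros z Hz. destruct (excluded_middle_informative (z = a)) as [->|Hn]. rewrite Hfa. ring.
    field. apply Cminus_eq_contra; auto.
Qed.

(** * Holomorphic functions of several variables *)

Definition upd (x : nat -> C) (i : nat) (w : C) : nat -> C := fun j => if Nat.eqb j i then w else x j.

Lemma upd_eq x i w : upd x i w i = w.
Proof. unfold upd. rewrite Nat.eqb_refl. auto. Qed.
Lemma upd_neq x i w j : j <> i -> upd x i w j = x j.
Proof. intros H. unfold upd. apply Nat.eqb_neq in H. rewrite H. auto. Qed.
Lemma upd_self x i : upd x i (x i) = x.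
Proof. apply functional_extensionality. intros j. unfold upd. destruct (Nat.eqb_spec j i); subst; auto. Qed.
Lemma upd_upd x i v w : upd (upd x i v) i w = upd x i w.
Proof. apply functional_extensionality. intros j. unfold upd. destruct (Nat.eqb_spec j i); auto. Qed.
Lemma upd_comm x i j v w : i <> j -> upd (upd x i v) j w = upd (upd x j w) i v.
Proof.
  intros H. apply functional_extensionality. intros k. unfold upd.
  destruct (Nat.eqb_spec k i), (Nat.eqb_spec k j); subst; auto; contradiction.
Qed.

(** Joint continuity together with complex differentiability in each variable separately. This pair
    is stable under the circle means of [Mean_hol], and only restrictions to one variable are ever
    differentiated. *)
Definition hol_at (n : nat) (f : (nat -> C) -> C) (x : nat -> C) : Prop :=
  lim_at (nX n x) f (f x) /\ forall i, (i < n)%nat -> cdiff (fun w => f (upd x i w)) (x i).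

Lemma hol_at_const n c x : hol_at n (fun _ => c) x.
Proof. split. apply lim_const. intros; apply cdiff_const. Qed.
Lemma hol_at_coord n j x : (j < n)%nat -> hol_at n (fun y => y j) x.
Proof.
  intros Hj. split. apply lim_coord; auto. intros i Hi. destruct (Nat.eq_dec j i) as [->|H].
  - apply (cdiff_ext (fun w => w)). exists 1; split; [lra|]. intros; rewrite upd_eq; auto. apply cdiff_id.
  - apply (cdiff_ext (fun w => x j)). exists 1; split; [lra|]. intros; rewrite upd_neq; auto. apply cdiff_const.
Qed.
Lemma hol_at_plus n f g x : hol_at n f x -> hol_at n g x -> hol_at n (fun y => f y + g y)%C x.
Proof. intros [H1 H2] [K1 K2]. split. apply lim_plus; auto with mono. intros. apply cdiff_plus; auto. Qed.
Lemma hol_at_mult n f g x : hol_at n f x -> hol_at n g x -> hol_at n (fun y => f y * g y)%C x.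
Proof. intros [H1 H2] [K1 K2]. split. apply lim_mult; auto with mono. intros. apply cdiff_mult; auto. Qed.
Lemma hol_at_minus n f g x : hol_at n f x -> hol_at n g x -> hol_at n (fun y => f y - g y)%C x.
Proof. intros [H1 H2] [K1 K2]. split. apply lim_minus; auto with mono. intros. apply cdiff_minus; auto. Qed.
Lemma hol_at_div n (f g : (nat -> C) -> C) x : g x <> 0 -> hol_at n f x -> hol_at n g x -> hol_at n (fun y => f y / g y)%C x.
Proof.
  intros Hg [H1 H2] [K1 K2]. split. apply lim_div; auto with mono. intros. apply cdiff_div; auto. rewrite upd_self; auto.
Qed.
Lemma hol_at_pow n f x k : hol_at n f x -> hol_at n (fun y => f y ^ k)%C x.
Proof. intros H. induction k; simpl. apply hol_at_const. apply hol_at_mult; auto. Qed.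

(** The open polydisc about 0 with radii [r i]; no polynomial is meant. *)
Definition poly (n : nat) (r : nat -> R) (x : nat -> C) : Prop := forall i, (i < n)%nat -> Cmod (x i) < r i.

Lemma poly_open n r x : poly n r x -> exists d, 0 < d /\ forall y, nX n x d y -> poly n r y.
Proof.
  induction n; intros H.
  - exists 1; split; [lra|]. intros y _ i Hi. lia.
  - destruct IHn as [d [Hd K]]. intros i Hi; apply H; lia.
    destruct (disc_open (x n) (r n) (H n ltac:(lia))) as [d' [Hd' K']].
    exists (Rmin d d'). split. apply Rmin_glb_lt; auto. intros y Hy i Hi.
    destruct (Nat.eq_dec i n) as [->|Hn].
    + apply K'. apply (Rlt_le_trans _ _ _ (Hy n Hi)). apply Rmin_r.
    + apply (K y); try lia. intros j Hj. apply (Rlt_le_trans _ _ _ (Hy j ltac:(lia))). apply Rmin_l.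
Qed.

Lemma poly_upd n r x i w : poly n r x -> Cmod w < r i -> poly n r (upd x i w).
Proof. intros H Hw j Hj. unfold upd. destruct (Nat.eqb_spec j i); subst; auto. Qed.

Lemma hol_at_slice n f x i w : (i < n)%nat -> hol_at n f (upd x i w) -> cdiff (fun w => f (upd x i w)) w.
Proof.
  intros Hi [_ H]. specialize (H i Hi). rewrite upd_eq in H. eapply cdiff_ext; [|apply H].
  exists 1; split; [lra|]. intros v _. rewrite upd_upd. auto.
Qed.

(** Variable m is averaged over a circle. In a remaining variable i the slope of the mean is the
    mean over th of slopes [q w th]. Each slope is itself a Cauchy mean, over a circle of radius s >
    |y i| in that variable, so that its joint continuity in (w, th) follows from [Mean_lim]. *)
Lemma Mean_hol (m : nat) (r : nat -> R) (G : (nat -> C) -> C) (rho : R) :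
  (forall y, poly m r y -> forall th, hol_at (S m) G (upd y m (rho * E th)%C)) ->
  forall y, poly m r y -> hol_at m (fun y => Mean (fun th => G (upd y m (rho * E th)%C))) y.
Proof.
  intros HG y Hy. split.
  - apply (Mean_lim (nX m y) (monoN_X m y) y (nX_refl m y) (fun y th => G (upd y m (rho * E th)%C))).
    + destruct (poly_open m r y Hy) as [d [Hd K]]. exists d; split; auto. intros y' Hy' t.
      destruct (HG y' (K y' Hy') t) as [L _]. unfold contR_at.
      apply (lim_comp (nR t) (nX (S m) (upd y' m (rho * E t)%C)) (fun th => upd y' m (rho * E th)%C) G _); auto.
      intros e He. destruct (contR_at_rhoE rho t e He) as [d' [Hd' K']]. exists d'; split; auto.
      intros s Hs i Hi. unfold upd. destruct (Nat.eqb_spec i m). apply K'; auto. rewrite Cmod_diag; auto.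
    + intros t. destruct (HG y Hy t) as [L _].
      apply (lim_comp _ (nX (S m) (upd y m (rho * E t)%C)) (fun q => upd (fst q) m (rho * E (snd q))%C) G _); auto.
      intros e He. destruct (contR_at_rhoE rho t e He) as [d' [Hd' K']]. exists (Rmin e d'); split. apply Rmin_glb_lt; auto.
      intros [y' s] [H1 H2] i Hi; simpl in *. unfold upd. destruct (Nat.eqb_spec i m).
      apply K'. apply (Rlt_le_trans _ _ _ H2), Rmin_r.
      apply (Rlt_le_trans _ _ _ (H1 i ltac:(lia))), Rmin_l.
  - intros i Hi. set (w0 := y i). assert (Hw0 : Cmod w0 < r i) by (apply Hy; auto).
    set (s := (Cmod w0 + r i) / 2). assert (Hs : Cmod w0 < s < r i) by (unfold s; lra).
    pose proof (Cmod_ge_0 w0).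
    set (g := fun th w => G (upd (upd y i w) m (rho * E th)%C)).
    assert (Hg : forall th, hol (r i) (g th)).
    { intros th w Hw. unfold g.
      apply (cdiff_ext (fun w => G (upd (upd y m (rho * E th)%C) i w))).
      exists 1; split; [lra|]. intros v _. rewrite upd_comm by lia. auto.
      apply (hol_at_slice (S m)). lia. rewrite upd_comm by lia. apply HG. apply poly_upd; auto. }
    assert (Hgc : forall w th, Cmod w < r i -> lim_at (nP (nR th) (nC w)) (fun q => g (fst q) (snd q)) (g th w)).
    { intros w th Hw. destruct (HG (upd y i w) (poly_upd _ _ _ _ _ Hy Hw) th) as [L _]. unfold g.
      apply (lim_comp _ (nX (S m) (upd (upd y i w) m (rho * E th)%C)) (fun q => upd (upd y i (snd q)) m (rho * E (fst q))%C) G _); auto.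
      intros e He. destruct (contR_at_rhoE rho th e He) as [d' [Hd' K']]. exists (Rmin e d'); split. apply Rmin_glb_lt; auto.
      intros [u v] [H1 H2] k Hk; simpl in *. unfold upd.
      destruct (Nat.eqb_spec k m). apply K'. apply (Rlt_le_trans _ _ _ H1), Rmin_r.
      destruct (Nat.eqb_spec k i). apply (Rlt_le_trans _ _ _ H2), Rmin_l. rewrite Cmod_diag; auto. }
    set (q := fun w th => Mean (fun sg => g th (s * E sg) * kern2 s w0 w sg)%C).
    assert (Es : forall sg, Cmod (s * E sg) < r i).
    { intros. rewrite Cmod_mult, Cmod_E, Cmod_R, Rabs_pos_eq; lra. }
    assert (Hq : forall w th, Cmod w < s -> lim_at (nP (nC w) (nR th)) (fun p => q (fst p) (snd p)) (q w th)).
    { intros w th Hw. unfold q.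
      apply (Mean_lim (nP (nC w) (nR th)) ltac:(auto with mono) (w, th)
        ltac:(intros; split; simpl; auto with mono)
        (fun p sg => g (snd p) (s * E sg) * kern2 s w0 (fst p) sg)%C).
      - destruct (disc_open w s Hw) as [d [Hd K]]. exists d; split; auto. intros [w' th'] [Hw' _] sg; simpl in *.
        apply (contR_at_kern2 (fun sg => g th' (s * E sg)%C) s); auto; try lra.
        apply (hol_circ (r i) (g th')); auto; lra.
      - intros sg. simpl. apply lim_mult; auto with mono.
        + apply (lim_comp _ (nP (nR th) (nC (s * E sg)%C)) (fun p => (snd (fst p), s * E (snd p))%C) (fun q => g (fst q) (snd q))).
          2: apply Hgc; auto.
          intros e He. destruct (contR_at_rhoE s sg e He) as [d' [Hd' K']]. exists (Rmin e d'); split. apply Rmin_glb_lt; auto.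
          intros [[u v] z] [[H1 H2] H3]; simpl in *. split; simpl.
          apply (Rlt_le_trans _ _ _ H2), Rmin_l. apply K'. apply (Rlt_le_trans _ _ _ H3), Rmin_r.
        + apply (lim_kern2 (nP (nP (nC w) (nR th)) (nR sg)) ltac:(auto with mono) s w0 (fun p => fst (fst p)) snd); auto; try lra.
          apply (lim_fst _ _ (fun p => fst p)). apply (lim_fst _ _ (fun p => p)). apply lim_id. apply (lim_snd _ _ E), contR_at_E. }
    assert (Hqc : forall w, Cmod w < s -> forall th, contR_at (q w) th).
    { intros w Hw th. apply (lim_sec_snd (nC w) w (nC_refl w) (fun p => q (fst p) (snd p))). apply Hq; auto. }
    assert (Hgd : forall w th, Cmod w < s -> g th w = (g th w0 + (w - w0) * q w th)%C).
    { intros w th Hw. rewrite (hol_CT (r i) (g th) s w); auto; try lra.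
      rewrite (cauchy_transform_diff (fun sg => g th (s * E sg)%C) s ltac:(apply (hol_circ (r i) (g th)); [apply Hg|lra]) w0 w); auto; try lra.
      rewrite <- (hol_CT (r i) (g th) s w0); auto; try lra. unfold q. ring. }
    assert (Hgcc : forall w, Cmod w < r i -> forall th, contR_at (fun th => g th w) th).
    { intros w Hw th. apply (lim_comp _ (nP (nR th) (nC w)) (fun th => (th, w)) (fun q => g (fst q) (snd q))).
      intros d Hd; exists d; split; auto. intros p Hp; split; simpl; auto with mono. apply Hgc; auto. }
    destruct (disc_open w0 s ltac:(lra)) as [d [Hd K]].
    exists (Mean (q w0)), (fun w => Mean (q w)). split; auto. split.
    + apply (Mean_lim (nC w0) (monoN_C w0) w0 (nC_refl w0) q).
      exists d; split; auto. intros th. apply Hq; lra.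
    + exists d; split; auto. intros w Hw.
      change (Mean (fun th => g th w) = (Mean (fun th => g th w0) + Mean (q w) * (w - w0))%C).
      assert (Hqw : forall t, contR_at (q w) t) by (apply Hqc; auto).
      assert (Hqm : forall t, contR_at (fun th => (w - w0) * q w th)%C t).
      { intros t. unfold contR_at. apply lim_mult; auto with mono. apply lim_const. apply Hqw. }
      assert (Hg0 : forall t, contR_at (fun th => g th w0) t) by (apply Hgcc; lra).
      rewrite (Cmult_comm (Mean (q w))), <- Mean_scal, <- Mean_plus by assumption.
      apply Mean_ext. intros th. apply Hgd; auto.
Qed.

(** * Roots, the argument principle and Newton's identities *)

Lemma contR_at_bounded h a b : a <= b -> (forall t, contR_at h t) -> exists M, forall t, a <= t <= b -> Cmod (h t) <= M.
Proof.
  intros Hab Hh. destruct (continuity_ab_maj (fun t => Cmod (h t)) a b Hab) as [m [Hm _]].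
  - intros c _. apply continuity_pt_filterlim, continuous_Reps. intros e He.
    destruct (Hh c e He) as [d [Hd K]]. exists d; split; auto. intros s Hs. specialize (K s Hs).
    eapply Rle_lt_trans; [|apply K]. apply Rabs_le. split.
    + pose proof (Cmod_ge_diff (h c) (h s)). rewrite Cmod_sub_sym in H. lra.
    + pose proof (Cmod_ge_diff (h s) (h c)). lra.
  - exists (Cmod (h m)). auto.
Qed.

Fixpoint root_prod (l : list C) (z : C) : C := match l with nil => RtoC 1 | a :: l => ((z - a) * root_prod l z)%C end.

Definition factors (Rr : R) (f : C -> C) (l : list C) (u : C -> C) : Prop :=
  hol Rr u /\ forall z, Cmod z < Rr -> f z = (root_prod l z * u z)%C.

Lemma root_prod_zero l z : root_prod l z = 0 <-> In z l.
Proof.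
  induction l; simpl.
  - split; [|tauto]. intros H. exfalso. apply C1_nz; auto.
  - split.
    + intros H. destruct (classic (z - a = 0)%C) as [E0|E0].
      left. symmetry. apply Ceq_minus; auto. right. apply IHl. apply NNPP. intros N.
      apply (Cmult_neq_0 _ _ E0 N); auto.
    + intros [->|H]. ring. rewrite (proj2 IHl H). ring.
Qed.

Lemma factors_snoc Rr f l u a : factors Rr f l u -> Cmod a < Rr -> u a = 0 ->
  exists v, factors Rr f (a :: l) v /\ forall z, Cmod z < Rr -> u z = ((z - a) * v z)%C.
Proof.
  intros [Hu Hf] Ha H0. destruct (hol_factor Rr u a Hu Ha H0) as [v [Hv K]].
  exists v. split; [split|]; auto. intros z Hz. rewrite (Hf z Hz), (K z Hz). simpl. ring.
Qed.

Lemma root_prod_lower l z r0 : 0 < r0 -> (forall a, In a l -> Cmod a <= r0) -> Cmod z = 4 * r0 -> (3 * r0) ^ (length l) <= Cmod (root_prod l z).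
Proof.
  intros Hr Hl Hz. induction l; simpl. rewrite Cmod_1; lra.
  rewrite Cmod_mult. apply Rmult_le_compat; try lra. apply pow_le; lra.
  pose proof (Cmod_ge_diff z a). pose proof (Hl a ltac:(simpl; auto)). lra.
  apply IHl. intros; apply Hl; simpl; auto.
Qed.

Lemma root_prod_upper l z r0 : 0 < r0 -> (forall a, In a l -> Cmod a <= r0) -> Cmod z <= r0 -> Cmod (root_prod l z) <= (2 * r0) ^ (length l).
Proof.
  intros Hr Hl Hz. induction l; simpl. rewrite Cmod_1; lra.
  rewrite Cmod_mult. apply Rmult_le_compat; try apply Cmod_ge_0.
  pose proof (Cmod_triangle z (- a)). rewrite Cmod_opp in H. pose proof (Hl a ltac:(simpl; auto)). unfold Cminus; lra.
  apply IHl. intros; apply Hl; simpl; auto.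
Qed.

(* Jensen-type bound: each extracted root in the disc of radius r0 costs a factor 2/3. *)
Lemma too_many_roots Rr f r0 : hol Rr f -> 0 < r0 -> 4 * r0 < Rr ->
  (forall k, exists l u, length l = k /\ (forall a, In a l -> Cmod a <= r0) /\ factors Rr f l u) ->
  forall a, Cmod a <= r0 -> f a = 0.
Proof.
  intros Hf Hr0 HR H a Ha. pose proof PI_RGT_0. apply Cmod_eq_0.
  pose proof (hol_circ Rr f (4 * r0) Hf ltac:(lra)) as Hfc.
  destruct (contR_at_bounded _ 0 (2 * PI) ltac:(lra) Hfc) as [M HM].
  assert (HE : forall t, Cmod (RtoC (4 * r0) * E t) = 4 * r0).
  { intros t. rewrite Cmod_mult, Cmod_E, Cmod_R, Rabs_pos_eq; lra. }
  assert (HM0 : 0 <= M). { eapply Rle_trans; [apply Cmod_ge_0|apply (HM 0); lra]. }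
  assert (bnd : forall k, Cmod (f a) <= (2/3) ^ k * (4 * M)).
  { intros k. destruct (H k) as [l [u [Hl [Hin [Hu Hfu]]]]].
    rewrite (Hfu a) by lra. rewrite Cmod_mult.
    assert (p3 : 0 < (3 * r0) ^ k) by (apply pow_lt; lra).
    (* One factor 2 is the loss in [Mean_bound]; the other bounds the kernel on the circle of radius
       4 * r0, which is at most 4 * r0 / (4 * r0 - |a|) <= 4/3. *)
    assert (Hu1 : Cmod (u a) <= 2 * (M / (3 * r0) ^ k * 2)).
    { rewrite (hol_CT Rr u (4 * r0) a Hu) by lra. unfold cauchy_transform. apply Mean_bound.
      - intros t. unfold contR_at. apply lim_mult; auto with mono. apply (hol_circ Rr u (4*r0)); auto; lra. apply contR_at_kern; lra.
      - intros t Ht. rewrite Cmod_mult. apply Rmult_le_compat; try apply Cmod_ge_0.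
        + specialize (HM t Ht). rewrite (Hfu (RtoC (4 * r0) * E t)%C), Cmod_mult in HM by (rewrite HE; lra).
          pose proof (root_prod_lower l (RtoC (4 * r0) * E t)%C r0 Hr0 Hin (HE t)) as L. rewrite Hl in L.
          apply Rmult_le_reg_r with ((3 * r0) ^ k); auto. unfold Rdiv. rewrite Rmult_assoc, Rinv_l, Rmult_1_r by lra.
          eapply Rle_trans; [|apply HM]. rewrite Rmult_comm. apply Rmult_le_compat_r; auto. apply Cmod_ge_0.
        + unfold kern. rewrite Cmod_div by (apply rhoE_sub_nz; lra). rewrite HE.
          pose proof (Cmod_ge_diff (RtoC (4 * r0) * E t) a). rewrite HE in H1.
          apply Rmult_le_reg_r with (Cmod (RtoC (4 * r0) * E t - a)); [lra|].
          unfold Rdiv. rewrite Rmult_assoc, Rinv_l by lra. lra. }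
    pose proof (root_prod_upper l a r0 Hr0 Hin Ha) as U. rewrite Hl in U.
    eapply Rle_trans. apply Rmult_le_compat; try apply Cmod_ge_0; eauto.
    right. replace (2 * r0) with (2/3 * (3 * r0)) by field. rewrite (Rpow_mult_distr (2/3)). field. lra. }
  destruct (Rle_lt_or_eq_dec 0 (Cmod (f a)) (Cmod_ge_0 _)) as [Hp|]; auto. exfalso.
  destruct (pow_lt_1_zero (2/3) ltac:(rewrite Rabs_pos_eq; lra) (Cmod (f a) / (4 * M + 1))) as [n Hn].
  apply Rdiv_lt_0_compat; lra. specialize (Hn n (Nat.le_refl _)). rewrite Rabs_pos_eq in Hn by (apply pow_le; lra).
  specialize (bnd n). assert (0 <= (2/3)^n) by (apply pow_le; lra).
  apply (Rmult_lt_compat_r (4 * M + 1)) in Hn; [|lra].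
  replace (Cmod (f a) / (4 * M + 1) * (4 * M + 1)) with (Cmod (f a)) in Hn by (field; lra). nra.
Qed.

(** The origin is a root of every order: once z^k has been divided out, the quotient still vanishes
    at the zeros z <> 0 near 0, hence at 0 by continuity. The lists [repeat 0 k] then contradict any
    nonzero value through [too_many_roots]. *)
Lemma identity_thm Rr f r0 : hol Rr f -> 0 < r0 -> 4 * r0 < Rr ->
  (forall d, 0 < d -> exists z, z <> RtoC 0 /\ Cmod z < d /\ f z = 0) ->
  forall a, Cmod a <= r0 -> f a = 0.
Proof.
  intros Hf Hr0 HR H. apply (too_many_roots Rr f r0 Hf Hr0 HR). intros k.
  exists (repeat (RtoC 0) k). rewrite repeat_length.
  assert (X : exists u, factors Rr f (repeat (RtoC 0) k) u).
  { induction k.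
    - exists f. split; auto. intros; simpl; ring.
    - destruct IHk as [u Hu]. destruct (factors_snoc Rr f _ u 0 Hu) as [v [Hv _]].
      + rewrite Cmod_0; lra.
      + destruct Hu as [Hu Hfu]. apply NNPP. intros Hn.
        destruct (cdiff_cont u 0 (Hu _ ltac:(rewrite Cmod_0; lra)) (Cmod (u 0)) ltac:(apply Cmod_gt_0; auto)) as [d [Hd K]].
        destruct (H (Rmin d Rr)) as [z [Hz [Hzd Hfz]]]. apply Rmin_glb_lt; lra.
        assert (Hz1 : Cmod z < d) by (apply (Rlt_le_trans _ _ _ Hzd), Rmin_l).
        assert (Hz2 : Cmod z < Rr) by (apply (Rlt_le_trans _ _ _ Hzd), Rmin_r).
        assert (u z = 0).
        { rewrite (Hfu z Hz2) in Hfz. apply NNPP. intros Hn'. apply (Cmult_neq_0 (root_prod (repeat (RtoC 0) k) z) (u z)); auto.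
          intros E0. apply root_prod_zero in E0. apply repeat_spec in E0. auto. }
        specialize (K z). unfold nC in K. replace (z - 0)%C with z in K by ring. specialize (K Hz1).
        rewrite H0 in K. replace (0 - u 0)%C with (- u 0)%C in K by ring. rewrite Cmod_opp in K. lra.
      + exists v. auto. }
  destruct X as [u Hu]. exists u. split; auto. split; auto.
  intros a Ha. apply repeat_spec in Ha. subst. rewrite Cmod_0; lra.
Qed.

(** Extraction of roots must stop: otherwise [too_many_roots] would make f vanish at the point r0,
    which lies in the zero-free annulus. *)
Lemma all_roots Rr f r0 : hol Rr f -> 0 < r0 -> 4 * r0 < Rr ->
  (forall z, r0 <= Cmod z < Rr -> f z <> 0) ->
  exists l u, (forall a, In a l -> Cmod a < r0) /\ factors Rr f l u /\ (forall z, Cmod z < Rr -> u z <> 0).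
Proof.
  intros Hf Hr0 HR Hnz. apply NNPP. intros Hn.
  apply (Hnz (RtoC r0)). rewrite Cmod_R, Rabs_pos_eq; lra.
  apply (too_many_roots Rr f r0 Hf Hr0 HR). 2: rewrite Cmod_R, Rabs_pos_eq; lra.
  assert (X : forall k, exists l u, length l = k /\ (forall a, In a l -> Cmod a < r0) /\ factors Rr f l u).
  { induction k.
    - exists nil, f. split; auto. split. simpl; tauto. split; auto. intros; simpl; ring.
    - destruct IHk as [l [u [Hl [Hin Hu]]]].
      destruct (classic (exists z, Cmod z < Rr /\ u z = 0)) as [[z [Hz Huz]]|Hnu].
      + destruct (factors_snoc Rr f l u z Hu Hz Huz) as [v [Hv _]].
        exists (z :: l), v. split; [simpl; auto|]. split; auto. intros a [<-|Ha]; auto.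
        destruct (Rlt_le_dec (Cmod z) r0) as [|L]; auto. exfalso. apply (Hnz z); auto.
        destruct Hu as [_ Hfu]. rewrite (Hfu z Hz), Huz. ring.
      + exfalso. apply Hn. exists l, u. split; auto. split; auto. intros z Hz E0. apply Hnu. eauto. }
  intros k. destruct (X k) as [l [u [H1 [H2 H3]]]]. exists l, u. split; auto. split; auto.
  intros a Ha. apply Rlt_le; auto.
Qed.

Lemma hol_at_comp1 n j f x : (j < n)%nat -> cdiff f (x j) -> hol_at n (fun y => f (y j)) x.
Proof.
  intros Hj Hf. split.
  - apply (lim_compC _ (fun y => y j) (x j)). apply lim_coord; auto. apply cdiff_cont; auto.
  - intros i Hi. destruct (Nat.eq_dec j i) as [->|H].
    + apply (cdiff_ext f); auto. exists 1; split; [lra|]. intros; rewrite upd_eq; auto.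
    + apply (cdiff_ext (fun w => f (x j))). exists 1; split; [lra|]. intros; rewrite upd_neq; auto. apply cdiff_const.
Qed.

(** Cauchy's integral for the derivative over a fixed contour. It equals f' on |z| < rho when f is
    holomorphic on a larger disc ([hol_isder]), and it is a circle mean with z as a parameter, so
    that [Mean_hol] applies to it. *)
Definition der (rho : R) (f : C -> C) (z : C) : C := Mean (fun th => f (rho * E th) * kern2 rho z z th)%C.

Lemma hol_der Rr rho f : hol Rr f -> 0 <= rho < Rr -> hol rho (der rho f).
Proof.
  intros Hf Hr z Hz.
  (* Variable 0 is the point z of evaluation, variable 1 runs over the contour. *)
  set (G := fun y : nat -> C => (f (y 1%nat) * (y 1%nat / ((y 1%nat - y 0%nat) * (y 1%nat - y 0%nat))))%C).
  pose proof (Mean_hol 1 (fun _ => rho) G rho) as M.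
  assert (HG : forall y, poly 1 (fun _ => rho) y -> forall th, hol_at 2 G (upd y 1 (rho * E th)%C)).
  { intros y Hy th. unfold G. apply hol_at_mult.
    - apply hol_at_comp1; auto. rewrite upd_eq. apply Hf. rewrite Cmod_mult, Cmod_E, Cmod_R, Rabs_pos_eq; lra.
    - apply hol_at_div. 2: apply hol_at_coord; lia.
      + rewrite upd_eq, upd_neq by lia. apply Cmult_neq_0; apply rhoE_sub_nz; apply Hy; lia.
      + apply hol_at_mult; apply hol_at_minus; apply hol_at_coord; lia. }
  specialize (M HG (fun _ => z)). destruct M as [_ M]. intros i Hi; auto.
  specialize (M 0%nat ltac:(lia)). eapply cdiff_ext; [|apply M]. exists 1; split; [lra|]. intros w _.
  unfold der, G. apply Mean_ext. intros th. rewrite upd_eq, upd_neq, upd_eq by lia. auto.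
Qed.

Fixpoint list_sum (h : C -> C) (l : list C) : C := match l with nil => RtoC 0 | a :: l => (h a + list_sum h l)%C end.

Lemma logder l u z d du : isder u z du -> u z <> 0 -> ~ In z l ->
  isder (fun z => root_prod l z * u z)%C z d -> (d / (root_prod l z * u z) = list_sum (fun a => / (z - a)) l + du / u z)%C.
Proof.
  intros Hu Hz. revert d. induction l as [|a l IH]; intros d Hn Hd.
  - simpl. assert (d = du).
    { apply (isder_unique _ _ _ _ Hd). apply (isder_ext u); auto. exists 1; split; [lra|]. intros; simpl; ring. }
    subst. field; auto.
  - simpl in Hn. assert (Ha : (z - a)%C <> 0) by (apply Cminus_eq_contra; intros ->; tauto).
    assert (Hl : root_prod l z <> 0) by (intros H; apply root_prod_zero in H; tauto).
    assert (Xd : exists d', isder (fun z => root_prod l z * u z)%C z d').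
    { assert (HP : exists p, isder (root_prod l) z p).
      { clear. induction l. eexists; apply isder_const. destruct IHl as [p Hp]. eexists.
        apply (isder_mult (fun z => z - a)%C (root_prod l)); eauto. apply (isder_plus (fun z => z) (fun _ => - a)%C).
        apply isder_id. apply isder_const. }
      destruct HP as [p Hp]. eexists. apply isder_mult; eauto. }
    destruct Xd as [d' Hd'].
    assert (E0 : d = ((1 + 0) * (root_prod l z * u z) + (z - a) * d')%C).
    { apply (isder_unique _ _ _ _ Hd). apply (isder_ext (fun z => (z - a) * (root_prod l z * u z))%C).
      exists 1; split; [lra|]. intros; simpl; ring.
      apply (isder_mult (fun z => z - a)%C (fun z => root_prod l z * u z)%C); auto. apply (isder_plus (fun z => z) (fun _ => - a)%C).
      apply isder_id. apply isder_const. }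
    specialize (IH d' ltac:(tauto) Hd'). simpl. rewrite E0.
    rewrite <- Cplus_assoc, <- IH. field. auto.
Qed.

(** The logarithmic derivative of f splits into 1 / (z - a) over the roots a and u' / u. Multiplied
    by z, each root term becomes a Cauchy kernel and reproduces g(a); the rest, g z u' / u, is
    holomorphic and vanishes at 0, so its mean is 0. The roots lie within r0, the contour is at 2 *
    r0, and the derivative is computed from the circle of radius 4 * r0. *)
Lemma argument_principle Rr r0 f g l u : 0 < r0 -> 4 * r0 < Rr -> hol Rr f -> hol Rr g ->
  (forall a, In a l -> Cmod a < r0) -> factors Rr f l u -> (forall z, Cmod z < Rr -> u z <> 0) ->
  Mean (fun th => let z := (RtoC (2 * r0) * E th)%C in g z * (z * der (4 * r0) f z / f z))%C = list_sum g l.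
Proof.
  intros Hr0 HR Hf Hg Hl [Hu Hfu] Hnz.
  set (rho := 2 * r0).
  assert (HE : forall t, Cmod (RtoC rho * E t) = 2 * r0).
  { intros t. rewrite Cmod_mult, Cmod_E, Cmod_R, Rabs_pos_eq; unfold rho; lra. }
  set (U := fun z => (g z * (z * der (4 * r0) u z / u z))%C).
  assert (HU : hol (4 * r0) U).
  { intros z Hz. unfold U. apply cdiff_mult. apply Hg; lra. apply cdiff_div. apply Hnz; lra.
    apply cdiff_mult. apply cdiff_id. apply (hol_der Rr); auto; lra. apply Hu; lra. }
  pose proof (hol_circ _ _ rho HU ltac:(unfold rho; lra)) as HUc.
  pose proof (hol_circ _ _ rho Hg ltac:(unfold rho; lra)) as Hgc.
  transitivity (Mean (fun th => list_sum (fun a => g (rho * E th) * kern rho a th)%C l + U (rho * E th))%C).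
  { apply Mean_ext. intros t. cbv zeta. fold rho. set (z := (RtoC rho * E t)%C).
    assert (Hz : Cmod z = 2 * r0) by (apply HE).
    assert (Hzl : ~ In z l) by (intros Hi; apply Hl in Hi; lra).
    pose proof (hol_isder Rr f (4 * r0) z Hf ltac:(lra) ltac:(lra)) as Df.
    pose proof (hol_isder Rr u (4 * r0) z Hu ltac:(lra) ltac:(lra)) as Du.
    fold (der (4 * r0) f z) in Df. fold (der (4 * r0) u z) in Du.
    assert (Df' : isder (fun z => root_prod l z * u z)%C z (der (4 * r0) f z)).
    { eapply isder_ext; [|apply Df]. destruct (disc_open z Rr ltac:(lra)) as [d [Hd K]]. exists d; split; auto. }
    pose proof (logder l u z _ _ Du (Hnz z ltac:(lra)) Hzl Df') as LD.
    rewrite (Hfu z) by lra.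
    replace (g z * (z * der (4 * r0) f z / (root_prod l z * u z)))%C with (g z * z * (der (4 * r0) f z / (root_prod l z * u z)))%C by (unfold Cdiv; ring).
    rewrite LD. unfold U.
    assert (EL : forall l, (g z * z * list_sum (fun a => / (z - a)) l)%C = list_sum (fun a => g z * kern rho a t)%C l).
    { clear. intros l. induction l; simpl. ring. rewrite <- IHl. unfold kern. fold z. unfold Cdiv. ring. }
    rewrite <- EL. unfold Cdiv. ring. }
  assert (Hs : forall l, (forall a, In a l -> Cmod a < r0) ->
     (forall t, contR_at (fun th => list_sum (fun a => g (rho * E th) * kern rho a th)%C l) t) /\
     Mean (fun th => list_sum (fun a => g (rho * E th) * kern rho a th)%C l) = list_sum g l).
  { clear Hl Hfu l. induction l as [|a l IH]; intros Hl; simpl.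
    - split. intros t. apply lim_const. unfold Mean. 
      replace (cint (fun _ => RtoC 0) 0 (2 * PI)) with (RtoC 0). ring.
      unfold cint, RtoC; simpl. rewrite RInt_const. unfold scal; simpl; unfold mult; simpl. rewrite Rmult_0_r. auto.
    - destruct IH as [H1 H2]. intros; apply Hl; simpl; auto. pose proof (Hl a ltac:(simpl; auto)) as Ha.
      assert (H3 : forall t, contR_at (fun th => g (rho * E th) * kern rho a th)%C t).
      { intros t. unfold contR_at. apply lim_mult; auto with mono. apply Hgc. apply contR_at_kern. unfold rho; lra. }
      split. intros t. unfold contR_at. apply lim_plus; auto with mono. apply H3. apply H1.
      rewrite Mean_plus by auto. rewrite H2. f_equal.
      symmetry. apply (hol_CT Rr g rho a Hg); unfold rho; lra. }
  destruct (Hs l Hl) as [H1 H2]. rewrite Mean_plus by auto. rewrite H2.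
  rewrite (hol_mean (4 * r0) U rho) by (auto; unfold rho; lra). unfold U. unfold Cdiv. ring.
Qed.

(** * Elementary symmetric functions in terms of power sums *)

Fixpoint nat_sum (f : nat -> C) (n : nat) : C :=
  match n with O => RtoC 0 | S n => (f O + nat_sum (fun i => f (S i)) n)%C end.

Fixpoint esym (l : list C) (k : nat) : C :=
  match k, l with
  | O, _ => RtoC 1
  | S _, nil => RtoC 0
  | S k', a :: l' => (esym l' (S k') + a * esym l' k')%C
  end.

Lemma esym_0 l : esym l 0 = 1.
Proof. destruct l; auto. Qed.

Lemma nat_sum_ext f g n : (forall i, (i < n)%nat -> f i = g i) -> nat_sum f n = nat_sum g n.
Proof.
  revert f g. induction n; intros f g H; simpl; auto. rewrite (H 0%nat) by lia. f_equal.
  apply IHn. intros; apply H; lia.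
Qed.
Lemma nat_sum_plus f g n : nat_sum (fun i => f i + g i)%C n = (nat_sum f n + nat_sum g n)%C.
Proof. revert f g. induction n; intros; simpl. ring. rewrite IHn. ring. Qed.
Lemma nat_sum_scal c f n : nat_sum (fun i => c * f i)%C n = (c * nat_sum f n)%C.
Proof. revert f. induction n; intros; simpl. ring. rewrite IHn. ring. Qed.

(** Coefficient form of E_{a::l}(T) = (1 + a T) E_l(T), where E_l is the generating function of
    [esym l], after multiplication by an arbitrary series with coefficients c. *)
Lemma esym_shift a l k : forall c : nat -> C,
  nat_sum (fun i => c i * esym (a :: l) (k - i))%C (S k) =
  (nat_sum (fun i => c i * esym l (k - i)) (S k) + a * nat_sum (fun i => c i * esym l (k - 1 - i)) k)%C.
Proof.
  induction k; intros c.
  - cbn [nat_sum Nat.sub]. rewrite !esym_0. ring.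
  - pose proof (IHk (fun i => c (S i))) as H. 
    change (nat_sum (fun i => c i * esym (a :: l) (S k - i))%C (S (S k)))
      with (c 0%nat * esym (a :: l) (S k) + nat_sum (fun i => c (S i) * esym (a :: l) (k - i)) (S k))%C.
    rewrite H.
    change (nat_sum (fun i => c i * esym l (S k - i))%C (S (S k)))
      with (c 0%nat * esym l (S k) + nat_sum (fun i => c (S i) * esym l (k - i)) (S k))%C.
    change (nat_sum (fun i => c i * esym l (S k - 1 - i))%C (S k))
      with (c 0%nat * esym l (S k - 1 - 0) + nat_sum (fun i => c (S i) * esym l (S k - 1 - S i)) k)%C.
    replace (S k - 1 - 0)%nat with k by lia.
    rewrite (nat_sum_ext (fun i => c (S i) * esym l (S k - 1 - S i))%C (fun i => c (S i) * esym l (k - 1 - i))%C).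
    2: { intros i Hi. do 2 f_equal. lia. }
    cbn [esym]. ring.
Qed.

(** Coefficient form of a / (1 + a T) * E_{a::l}(T) = a E_l(T). *)
Lemma esym_tele a l k : nat_sum (fun i => ((-1) ^ i * a ^ (S i)) * esym (a :: l) (k - i))%C (S k) = (a * esym l k)%C.
Proof.
  induction k. cbn [nat_sum Nat.sub]. rewrite !esym_0. simpl. ring.
  change (nat_sum (fun i => ((-1) ^ i * a ^ (S i)) * esym (a :: l) (S k - i))%C (S (S k)))
    with (((-1) ^ 0 * a ^ 1) * esym (a :: l) (S k) + nat_sum (fun i => ((-1) ^ (S i) * a ^ (S (S i))) * esym (a :: l) (k - i)) (S k))%C.
  rewrite (nat_sum_ext _ (fun i => (- a) * (((-1) ^ i * a ^ (S i)) * esym (a :: l) (k - i)))%C).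
  2: { intros i _. rewrite !Cpow_S. ring. }
  rewrite nat_sum_scal, IHk. cbn [esym]. simpl. ring.
Qed.

(** Newton's identities, by induction on the list. Adding a root a adds a^j to the j-th power sum:
    these new terms are collected by [esym_tele], the old ones by [esym_shift] and the induction
    hypothesis. *)
Lemma newton l : forall k, (RtoC (INR (S k)) * esym l (S k) =
   nat_sum (fun i => ((-1) ^ i * list_sum (fun a => a ^ (S i)) l) * esym l (k - i)) (S k))%C.
Proof.
  induction l as [|a l IH]; intros k.
  - rewrite (nat_sum_ext _ (fun i => 0 * 0)%C). rewrite nat_sum_scal. simpl. ring. intros; simpl. ring.
  - rewrite (nat_sum_ext _ (fun i => ((-1) ^ i * list_sum (fun a => a ^ (S i)) l) * esym (a :: l) (k - i) + ((-1) ^ i * a ^ (S i)) * esym (a :: l) (k - i))%C).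
    2: { intros i _. cbn [list_sum]. ring. }
    rewrite nat_sum_plus, esym_tele, (esym_shift a l k (fun i => (-1) ^ i * list_sum (fun a => a ^ (S i)) l)%C).
    rewrite <- IH. destruct k.
    + cbn [nat_sum esym]. rewrite esym_0. simpl. ring.
    + replace (S k - 1)%nat with k by lia. rewrite <- IH. cbn [esym]. rewrite (S_INR (S k)), RtoC_plus. ring.
Qed.

Lemma esym_over l k : (length l < k)%nat -> esym l k = 0.
Proof.
  revert k. induction l as [|a l IH]; intros k H; destruct k; simpl in *; try lia; auto.
  rewrite !IH by lia. ring.
Qed.

Lemma esym_full l : esym l (length l) = fold_right Cmult (RtoC 1) l.
Proof.
  induction l as [|a l IH]; cbn [length esym fold_right]; auto. rewrite esym_over by lia. rewrite IH. ring.
Qed.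

(** The [N i] are universal polynomials in the power sums, defined by Newton's identity divided by
    its index. Polynomiality is recorded as the second clause: substituting functions holomorphic at
    x gives a function holomorphic at x. *)
Lemma esym_of_power_sums k : exists N : nat -> (nat -> C) -> C, forall i, (i <= k)%nat ->
  (forall l, esym l i = N i (fun j => list_sum (fun a => a ^ j)%C l)) /\
  (forall n x (S : nat -> (nat -> C) -> C), (forall j, hol_at n (S j) x) -> hol_at n (fun y => N i (fun j => S j y)) x).
Proof.
  induction k.
  - exists (fun _ _ => RtoC 1). intros i Hi. replace i with 0%nat by lia. split. intros; apply esym_0. intros; apply hol_at_const.
  - destruct IHk as [N HN].
    exists (fun i p => if Nat.eqb i (S k) then (/ RtoC (INR (S k)) * nat_sum (fun i => ((-1) ^ i * p (S i)) * N (k - i)%nat p) (S k))%C else N i p).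
    intros i Hi. destruct (Nat.eqb_spec i (S k)) as [->|Hn]; [|apply HN; lia]. split.
    + intros l. assert (RtoC (INR (S k)) <> 0). { intros H. apply RtoC_inj in H. revert H. apply not_0_INR. lia. }
      rewrite <- (nat_sum_ext (fun i => ((-1) ^ i * list_sum (fun a => a ^ (S i)) l) * esym l (k - i))%C).
      rewrite <- newton. field; auto. intros j Hj. rewrite (proj1 (HN (k - j)%nat ltac:(lia))). auto.
    + intros n x S HS. apply hol_at_mult. apply hol_at_const.
      assert (X : forall m (F : nat -> (nat -> C) -> C), (forall j, hol_at n (F j) x) -> hol_at n (fun y => nat_sum (fun j => F j y) m) x).
      { induction m; intros F HF; simpl. apply hol_at_const. apply hol_at_plus; auto. }
      apply (X _ (fun j y => ((-1) ^ j * S (Datatypes.S j) y) * N (k - j)%nat (fun j => S j y))%C).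
      intros j. apply hol_at_mult. apply hol_at_mult. apply hol_at_const. auto. apply HN; auto. lia.
Qed.

(** * Compactness and elimination of a variable *)

Definition cvC (u : nat -> C) (l : C) : Prop :=
  forall e, 0 < e -> exists N, forall n, (N <= n)%nat -> Cmod (u n - l) < e.

Lemma cvC_sub u l phi : (forall n, (n <= phi n)%nat) -> cvC u l -> cvC (fun n => u (phi n)) l.
Proof.
  intros Hp H e He. destruct (H e He) as [N K]. exists N. intros n Hn. apply K. specialize (Hp n). lia.
Qed.

Lemma inv_INR_lt e : 0 < e -> exists N, forall n, (N <= n)%nat -> / (INR n + 1) < e.
Proof.
  intros He. destruct (archimed_cor1 e He) as [N [H1 H2]]. exists N. intros n Hn.
  apply Rlt_trans with (/ INR N); auto. apply Rinv_lt_contravar.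
  apply Rmult_lt_0_compat. apply lt_0_INR; auto. pose proof (pos_INR n); lra.
  apply le_INR in Hn. lra.
Qed.

(** The extraction [phi] satisfies only n <= phi n and need not be increasing. This is enough to
    carry limits along it, and it is preserved when extractions are composed coordinate by
    coordinate. *)
Lemma BW_R (u : nat -> R) M : (forall n, Rabs (u n) <= M) ->
  exists phi l, (forall n, (n <= phi n)%nat) /\ forall e, 0 < e -> exists N, forall n, (N <= n)%nat -> Rabs (u (phi n) - l) < e.
Proof.
  intros H. destruct (Bolzano_Weierstrass u _ (compact_P3 (- M) M)) as [l Hl].
  { intros n. apply Rabs_le_between. auto. }
  assert (X : forall n, exists p, (n <= p)%nat /\ Rabs (u p - l) < / (INR n + 1)).
  { intros n. assert (Hp : 0 < / (INR n + 1)) by (apply Rinv_0_lt_compat; pose proof (pos_INR n); lra).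
    destruct (Hl (disc l (mkposreal _ Hp)) n) as [p [Hp1 Hp2]]. exists (mkposreal _ Hp). intros x; auto.
    exists p. split; auto. }
  destruct (choice _ X) as [phi Hphi]. exists phi, l. split. intros; apply Hphi.
  intros e He. destruct (inv_INR_lt e He) as [N HN]. exists N. intros n Hn.
  apply Rlt_trans with (/ (INR n + 1)). apply Hphi. auto.
Qed.

Lemma BW_C (u : nat -> C) M : (forall n, Cmod (u n) <= M) ->
  exists phi l, (forall n, (n <= phi n)%nat) /\ cvC (fun n => u (phi n)) l.
Proof.
  intros H. destruct (BW_R (fun n => fst (u n)) M) as [p1 [a [H1 H2]]].
  { intros n. eapply Rle_trans; [apply Rabs_fst_le|auto]. }
  destruct (BW_R (fun n => snd (u (p1 n))) M) as [p2 [b [H3 H4]]].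
  { intros n. eapply Rle_trans; [apply Rabs_snd_le|auto]. }
  exists (fun n => p1 (p2 n)), (a, b). split. intros n. specialize (H1 (p2 n)). specialize (H3 n). lia.
  intros e He. destruct (H2 (e/2) ltac:(lra)) as [N1 K1]. destruct (H4 (e/2) ltac:(lra)) as [N2 K2].
  exists (max N1 N2). intros n Hn. eapply Rle_lt_trans; [apply Cmod_le_sum|].
  specialize (H3 n). specialize (K1 (p2 n) ltac:(lia)). specialize (K2 n ltac:(lia)).
  simpl. unfold Rminus in *. lra.
Qed.

Lemma BW_X m (u : nat -> nat -> C) M : (forall n i, (i < m)%nat -> Cmod (u n i) <= M) ->
  exists phi l, (forall n, (n <= phi n)%nat) /\ forall i, (i < m)%nat -> cvC (fun n => u (phi n) i) (l i).
Proof.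
  induction m; intros H.
  - exists (fun n => n), (fun _ => RtoC 0). split; intros; lia.
  - destruct IHm as [p1 [l [H1 H2]]]. intros; apply H; lia.
    destruct (BW_C (fun n => u (p1 n) m) M) as [p2 [b [H3 H4]]]. intros; apply H; lia.
    exists (fun n => p1 (p2 n)), (upd l m b). split. intros n. specialize (H1 (p2 n)). specialize (H3 n). lia.
    intros i Hi. destruct (Nat.eq_dec i m) as [->|Hn]. rewrite upd_eq; auto. rewrite upd_neq by auto.
    apply (cvC_sub (fun n => u (p1 n) i)); auto. apply H2; lia.
Qed.

Lemma cvC_unif m (v : nat -> nat -> C) l : (forall i, (i < m)%nat -> cvC (fun n => v n i) (l i)) ->
  forall d, 0 < d -> exists K, forall n, (K <= n)%nat -> nX m l d (v n).
Proof.
  unfold nX. induction m; intros Hl d Hd. exists 0%nat; intros; lia.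
  destruct (IHm ltac:(intros; apply Hl; lia) d Hd) as [M1 K1]. destruct (Hl m ltac:(lia) d Hd) as [M2 K2].
  exists (max M1 M2). intros n Hn i Hi. destruct (Nat.eq_dec i m) as [->|]. apply K2; lia. apply K1; lia.
Qed.

Lemma lim_at_seq n f x (u : nat -> nat -> C) : lim_at (nX n x) f (f x) ->
  (forall i, (i < n)%nat -> cvC (fun k => u k i) (x i)) -> cvC (fun k => f (u k)) (f x).
Proof.
  intros Hf Hu e He. destruct (Hf e He) as [d [Hd K]].
  destruct (cvC_unif n u x Hu d Hd) as [N HN]. exists N. auto.
Qed.

Lemma cvC_unique u a b : cvC u a -> cvC u b -> a = b.
Proof.
  intros Ha Hb. apply NNPP. intros Hn. assert (Hp : 0 < Cmod (a - b)) by (apply Cmod_gt_0, Cminus_eq_contra; auto).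
  destruct (Ha (Cmod (a - b)/2) ltac:(lra)) as [N1 K1]. destruct (Hb (Cmod (a - b)/2) ltac:(lra)) as [N2 K2].
  specialize (K1 (max N1 N2) ltac:(lia)). specialize (K2 (max N1 N2) ltac:(lia)).
  pose proof (Cmod_tri a (u (max N1 N2)) b). rewrite (Cmod_sub_sym a (u (max N1 N2))) in H. lra.
Qed.

Lemma cvC_const u l : (forall n, u n = l) -> cvC u l.
Proof. intros H e He. exists 0%nat. intros. rewrite H, Cmod_diag. auto. Qed.

Lemma cvC_Cmod_le u l M : cvC u l -> (forall n, Cmod (u n) <= M) -> Cmod l <= M.
Proof.
  intros H HM. apply le_epsilon. intros e He. destruct (H e He) as [N K]. specialize (K N (Nat.le_refl _)).
  specialize (HM N). rewrite Cmod_sub_sym in K. pose proof (Cmod_ge_diff l (u N)). lra.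
Qed.
Lemma cvC_Cmod_ge u l M : cvC u l -> (forall n, M <= Cmod (u n)) -> M <= Cmod l.
Proof.
  intros H HM. apply le_epsilon. intros e He. destruct (H e He) as [N K]. specialize (K N (Nat.le_refl _)).
  specialize (HM N). pose proof (Cmod_ge_diff (u N) l). lra.
Qed.

(** A sequence that agrees with x in the first n entries lies in every neighbourhood of x, so
    continuity at x alone forces equal values. *)
Lemma hol_at_dep n f x y : hol_at n f x -> (forall i, (i < n)%nat -> y i = x i) -> f y = f x.
Proof.
  intros [H _] E0. apply NNPP. intros Hn. destruct (H (Cmod (f y - f x))) as [d [Hd K]].
  apply Cmod_gt_0, Cminus_eq_contra; auto.
  specialize (K y). assert (nX n x d y) by (intros i Hi; rewrite E0, Cmod_diag; auto). specialize (K H0). lra.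
Qed.

Lemma nX_upd n x i w d : 0 < d -> Cmod (w - x i) < d -> nX n x d (upd x i w).
Proof. intros Hd H j Hj. unfold upd. destruct (Nat.eqb_spec j i); subst; auto. rewrite Cmod_diag; auto. Qed.

Lemma hol_at_ext n f g x : (exists d, 0 < d /\ forall y, nX n x d y -> f y = g y) -> hol_at n f x -> hol_at n g x.
Proof.
  intros [d [Hd K]] [H1 H2]. split.
  - rewrite <- (K x) by auto with mono. eapply lim_ext; eauto with mono.
  - intros i Hi. eapply cdiff_ext; [|apply H2; auto]. exists d; split; auto. intros w Hw. apply K. apply nX_upd; auto.
Qed.

Definition zeroX : nat -> C := fun _ => RtoC 0.

Lemma poly_zero n r : (forall i, (i < n)%nat -> 0 < r i) -> poly n r zeroX.
Proof. intros H i Hi. unfold zeroX. rewrite Cmod_0; auto. Qed.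

(** Compactness of the annulus: zeros lying over base points that tend to 0 would accumulate at a
    zero over 0. *)
Lemma nonvanishing_near n f a b : 
  (forall w, a <= Cmod w <= b -> lim_at (nX (S n) (upd zeroX n w)) f (f (upd zeroX n w)) /\ f (upd zeroX n w) <> 0) ->
  exists d, 0 < d /\ forall x, nX n zeroX d x -> forall w, a <= Cmod w <= b -> f (upd x n w) <> 0.
Proof.
  intros H. apply NNPP. intros Hn.
  assert (X : forall k : nat, exists xw : (nat -> C) * C, nX n zeroX (/ (INR k + 1)) (fst xw) /\ a <= Cmod (snd xw) <= b /\ f (upd (fst xw) n (snd xw)) = 0).
  { intros k. apply NNPP. intros Hk. apply Hn. exists (/ (INR k + 1)). split.
    apply Rinv_0_lt_compat; pose proof (pos_INR k); lra. intros x Hx w Hw E0. apply Hk. exists (x, w); auto. }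
  destruct (choice _ X) as [s Hs].
  destruct (BW_C (fun k => snd (s k)) b) as [phi [l [Hp Hl]]]. intros k; apply Hs.
  assert (Hlb : a <= Cmod l <= b).
  { split. apply (cvC_Cmod_ge _ _ _ Hl). intros; apply Hs. apply (cvC_Cmod_le _ _ _ Hl). intros; apply Hs. }
  destruct (H l Hlb) as [L NZ]. apply NZ.
  apply (cvC_unique (fun k => f (upd (fst (s (phi k))) n (snd (s (phi k)))))).
  - apply (lim_at_seq (S n) f (upd zeroX n l) (fun k => upd (fst (s (phi k))) n (snd (s (phi k))))); auto.
    intros i Hi. destruct (Nat.eq_dec i n) as [->|Hin].
    + intros e He. destruct (Hl e He) as [N K]. exists N. intros k Hk. rewrite !upd_eq. auto.
    + intros e He. destruct (inv_INR_lt e He) as [N K]. exists N. intros k Hk. rewrite !upd_neq by auto.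
      destruct (Hs (phi k)) as [H1 _]. specialize (H1 i ltac:(lia)). eapply Rlt_trans; [apply H1|]. apply K.
      specialize (Hp k). lia.
  - apply cvC_const. intros; apply Hs.
Qed.

(** * Elimination of the last variable by norms *)

Inductive span (F : ((nat -> C) -> C) -> Prop) : ((nat -> C) -> C) -> Prop :=
  | span_zero : span F (fun _ => RtoC 0)
  | span_add g f c : span F g -> F f -> span F (fun x => g x + c * f x)%C.

(** If g is nonzero at the old points but vanishes at the new one, add s * f with f nonzero there
    and s a real number exceeding every |g / f| at the old points. Only finitely many points matter,
    because they will be the roots of one function of one variable. *)
Lemma span_avoid (F : ((nat -> C) -> C) -> Prop) (p : C -> nat -> C) l :
  (forall a, In a l -> exists f, F f /\ f (p a) <> 0) -> exists g, span F g /\ forall a, In a l -> g (p a) <> 0.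
Proof.
  induction l as [|a l IH]; intros H.
  - exists (fun _ => RtoC 0). split. constructor. simpl; tauto.
  - destruct IH as [g [Hg Hl]]. intros; apply H; simpl; auto.
    destruct (classic (g (p a) = 0)) as [E0|E0].
    2: { exists g. split; auto. intros b [<-|Hb]; auto. }
    destruct (H a ltac:(simpl; auto)) as [f [Hf Hfa]].
    (* Starting the sum at 1 makes s nonzero and strictly larger than each quotient. *)
    set (s := fold_right (fun b acc => Cmod (g (p b) / f (p b)) + acc) 1 l).
    assert (Hs : 1 <= s /\ forall b, In b l -> Cmod (g (p b) / f (p b)) < s).
    { unfold s. clear. induction l; simpl. split; [lra|tauto]. destruct IHl as [H1 H2].
      pose proof (Cmod_ge_0 (g (p a) / f (p a))). split; [lra|]. intros b [<-|Hb]. lra. specialize (H2 b Hb). lra. }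
    destruct Hs as [Hs1 Hs2].
    exists (fun x => g x + RtoC s * f x)%C. split. constructor; auto.
    intros b [<-|Hb].
    + rewrite E0. rewrite Cplus_0_l. apply Cmult_neq_0; auto. intros K. apply RtoC_inj in K. lra.
    + intros K. destruct (classic (f (p b) = 0)) as [Ef|Ef].
      * rewrite Ef in K. apply (Hl b Hb). rewrite <- K. ring.
      * specialize (Hs2 b Hb). replace (g (p b) / f (p b))%C with (- RtoC s)%C in Hs2.
        rewrite Cmod_opp, Cmod_R, Rabs_pos_eq in Hs2; lra.
        replace (g (p b)) with (g (p b) + RtoC s * f (p b) - RtoC s * f (p b))%C by ring. rewrite K. field; auto.
Qed.

Section Elimination.
Variables (n : nat) (r r0 r1 : R) (f : (nat -> C) -> C).
Hypotheses (Hr0 : 0 < r0) (Hr : 5 * r0 < r) (Hr1 : 0 < r1 <= r).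
Hypothesis Hf : forall x, poly (S n) (fun _ => r) x -> hol_at (S n) f x.
Hypothesis Hnz : forall x, poly n (fun _ => r1) x -> forall w, r0 <= Cmod w <= 5 * r0 -> f (upd x n w) <> 0.

(** The derivative of f in variable n, as a Cauchy integral over |w| = 4 * r0. As an integral it is
    holomorphic in all n + 1 variables together, which the power sums below require. *)
Definition dlast (y : nat -> C) : C :=
  Mean (fun th => f (upd y n (RtoC (4 * r0) * E th)) * kern2 (4 * r0) (y n) (y n) th)%C.

Lemma poly_ext_last x w : poly n (fun _ => r1) x -> Cmod w < r -> poly (S n) (fun _ => r) (upd x n w).
Proof.
  intros Hx Hw i Hi. unfold upd. destruct (Nat.eqb_spec i n); auto. specialize (Hx i ltac:(lia)). simpl in Hx. lra.
Qed.

Lemma slice_hol g x : (forall x, poly (S n) (fun _ => r) x -> hol_at (S n) g x) -> poly n (fun _ => r1) x ->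
  hol (5 * r0) (fun w => g (upd x n w)).
Proof.
  intros Hg Hx w Hw. apply (hol_at_slice (S n)); auto. apply Hg. apply poly_ext_last; auto. lra.
Qed.

Lemma circ4 th : Cmod (RtoC (4 * r0) * E th) = 4 * r0.
Proof. rewrite Cmod_mult, Cmod_E, Cmod_R, Rabs_pos_eq; lra. Qed.

Lemma dlast_hol x w : poly n (fun _ => r1) x -> Cmod w < 4 * r0 -> hol_at (S n) dlast (upd x n w).
Proof.
  intros Hx Hw.
  set (rr := fun i => if Nat.ltb i n then r1 else 4 * r0).
  assert (rrn : rr n = 4 * r0) by (unfold rr; rewrite Nat.ltb_irrefl; auto).
  assert (rri : forall i, (i < n)%nat -> rr i = r1).
  { intros i Hi. unfold rr. apply Nat.ltb_lt in Hi. rewrite Hi. auto. }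
  assert (Hrr : forall y, poly (S n) rr y -> poly n (fun _ => r1) y /\ Cmod (y n) < 4 * r0).
  { intros y Hy. split. intros i Hi. specialize (Hy i ltac:(lia)). rewrite rri in Hy by auto. auto.
    specialize (Hy n ltac:(lia)). rewrite rrn in Hy. auto. }
  assert (Hxr : poly (S n) rr (upd x n w)).
  { intros i Hi. unfold upd. destruct (Nat.eqb_spec i n). subst. rewrite rrn; auto. rewrite rri by lia. apply Hx; lia. }
  set (m := S n).
  (* The contour variable receives the fresh index m = S n. It replaces variable n inside f, while
     variable n survives as the point of evaluation in the kernel. *)
  set (G := fun z : nat -> C => (f (upd z n (z m)) * (z m / ((z m - z n) * (z m - z n))))%C).
  assert (HG : forall y, poly (S n) rr y -> forall th, hol_at (S m) G (upd y m (RtoC (4 * r0) * E th)%C)).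
  { intros y Hy th. destruct (Hrr y Hy) as [Hy1 Hy2].
    set (e := (RtoC (4 * r0) * E th)%C). set (z := upd y m e).
    assert (He : Cmod e = 4 * r0) by apply circ4.
    assert (zm : z m = e) by (unfold z; rewrite upd_eq; auto).
    assert (zi : forall i, (i <= n)%nat -> z i = y i) by (intros; unfold z; rewrite upd_neq; auto; unfold m; lia).
    assert (Hz : poly n (fun _ => r1) z) by (intros i Hi; rewrite zi by lia; auto).
    assert (Hfz : forall v, Cmod v < r -> hol_at (S n) f (upd z n v)).
    { intros v Hv. apply Hf. apply poly_ext_last; auto. }
    apply hol_at_mult.
    - split.
      + apply (lim_comp _ (nX (S n) (upd z n (z m))) (fun z => upd z n (z m)) f).
        2: { apply Hfz. rewrite zm. lra. }
        intros d Hd. exists d; split; auto. intros z' Hz' i Hi. unfold upd. destruct (Nat.eqb_spec i n).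
        apply Hz'; unfold m; lia. apply Hz'. unfold m; lia.
      + intros i Hi. destruct (Nat.eq_dec i m) as [->|Him].
        * apply (cdiff_ext (fun v => f (upd z n v))).
          { destruct (disc_open (z m) r ltac:(rewrite zm; lra)) as [d [Hd K]]. exists d; split; auto.
            intros v Hv. symmetry. apply (hol_at_dep (S n)). apply Hfz; auto.
            intros j Hj. rewrite upd_eq. unfold upd. destruct (Nat.eqb_spec j n); auto.
            destruct (Nat.eqb_spec j m); auto. unfold m in *; lia. }
          apply (hol_at_slice (S n)). lia. apply Hfz. rewrite zm; lra.
        * destruct (Nat.eq_dec i n) as [->|Hin].
          { apply (cdiff_ext (fun v => f (upd z n (z m)))). 2: apply cdiff_const.
            exists 1; split; [lra|]. intros v _. rewrite upd_upd, (upd_neq z n v m); auto. }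
          { apply (cdiff_ext (fun v => f (upd (upd z n (z m)) i v))).
            - exists 1; split; [lra|]. intros v _. rewrite (upd_neq z i v m) by auto. rewrite upd_comm; auto.
            - destruct (Hfz (z m) ltac:(rewrite zm; lra)) as [_ K]. specialize (K i ltac:(unfold m in *; lia)).
              rewrite upd_neq in K by auto. auto. }
    - apply hol_at_div. 2: apply hol_at_coord; lia.
      + rewrite zm, zi by lia. apply Cmult_neq_0; apply rhoE_sub_nz; auto.
      + apply hol_at_mult; apply hol_at_minus; apply hol_at_coord; unfold m; lia. }
  pose proof (Mean_hol (S n) rr G (4 * r0) HG (upd x n w) Hxr) as M.
  eapply hol_at_ext; [|apply M].
  destruct (poly_open (S n) rr (upd x n w) Hxr) as [d [Hd K]]. exists d; split; auto. intros y Hy.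
  destruct (Hrr y (K y Hy)) as [Hy1 Hy2]. unfold dlast, G, kern2. apply Mean_ext. intros th.
  fold m. rewrite upd_eq, (upd_neq y m _ n) by (unfold m; lia). f_equal.
  apply (hol_at_dep (S n)). apply Hf. apply poly_ext_last; auto. rewrite circ4; lra.
  intros i Hi. unfold upd. destruct (Nat.eqb_spec i n); auto. destruct (Nat.eqb_spec i m); auto. unfold m in *; lia.
Qed.

(** By the argument principle this is the sum of g(x, a)^k over the roots a of f(x, .) with |a| <
    r0. The contour integral makes it holomorphic in x without following individual roots, which may
    branch. *)
Definition psum (g : (nat -> C) -> C) (k : nat) (x : nat -> C) : C :=
  Mean (fun th => let y := upd x n (RtoC (2 * r0) * E th)%C in g y ^ k * (y n * dlast y / f y))%C.

Lemma circ2 th : Cmod (RtoC (2 * r0) * E th) = 2 * r0.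
Proof. rewrite Cmod_mult, Cmod_E, Cmod_R, Rabs_pos_eq; lra. Qed.

Lemma psum_hol g k x : (forall x, poly (S n) (fun _ => r) x -> hol_at (S n) g x) ->
  poly n (fun _ => r1) x -> hol_at n (psum g k) x.
Proof.
  intros Hg Hx.
  apply (Mean_hol n (fun _ => r1) (fun y => g y ^ k * (y n * dlast y / f y))%C (2 * r0)); auto.
  intros y Hy th. pose proof (circ2 th).
  apply hol_at_mult. apply hol_at_pow. apply Hg, poly_ext_last; auto; lra.
  apply hol_at_div. apply Hnz; auto; lra. apply hol_at_mult. apply hol_at_coord; lia.
  apply dlast_hol; auto; lra. apply Hf, poly_ext_last; auto; lra.
Qed.

Lemma psum_roots g k x l u : (forall x, poly (S n) (fun _ => r) x -> hol_at (S n) g x) ->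
  poly n (fun _ => r1) x -> (forall a, In a l -> Cmod a < r0) ->
  factors (5 * r0) (fun w => f (upd x n w)) l u -> (forall z, Cmod z < 5 * r0 -> u z <> 0) ->
  psum g k x = list_sum (fun a => a ^ k)%C (map (fun a => g (upd x n a)) l).
Proof.
  intros Hg Hx Hl Hfu Hu.
  transitivity (list_sum (fun a => (g (upd x n a)) ^ k)%C l).
  2: { clear. induction l; simpl; auto. rewrite IHl. auto. }
  etransitivity; [|apply (argument_principle (5 * r0) r0 (fun w => f (upd x n w)) (fun a => (g (upd x n a)) ^ k)%C l u)]; auto; try lra.
  - unfold psum. apply Mean_ext. intros t. cbv zeta. rewrite upd_eq. do 3 f_equal.
    unfold dlast, der. apply Mean_ext. intros s. rewrite upd_upd, upd_eq. auto.
  - apply slice_hol; auto.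
  - intros w Hw. apply cdiff_pow. apply (slice_hol g x); auto.
Qed.

Lemma roots_at x : poly n (fun _ => r1) x -> exists l u, (forall a, In a l -> Cmod a < r0) /\
  factors (5 * r0) (fun w => f (upd x n w)) l u /\ (forall z, Cmod z < 5 * r0 -> u z <> 0).
Proof.
  intros Hx. apply all_roots; auto; try lra. apply slice_hol; auto. intros z Hz. apply Hnz; auto; lra.
Qed.

(** The number of roots is a power sum of the constant function 1, hence continuous in x. Being an
    integer, it is constant wherever it differs from its value at 0 by less than 1. *)
Lemma root_count : exists d r2, 0 < r2 <= r1 /\ forall x, poly n (fun _ => r2) x ->
  exists l u, length l = d /\ (forall a, In a l -> Cmod a < r0) /\
  factors (5 * r0) (fun w => f (upd x n w)) l u /\ (forall z, Cmod z < 5 * r0 -> u z <> 0).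
Proof.
  set (one := fun _ : nat -> C => RtoC 1).
  assert (H1 : forall x, poly (S n) (fun _ => r) x -> hol_at (S n) one x) by (intros; apply hol_at_const).
  assert (Hlen : forall l x, list_sum (fun a => a ^ 0)%C (map (fun a => one (upd x n a)) l) = RtoC (INR (length l))).
  { intros l x. induction l; auto. cbn [map list_sum length]. rewrite IHl, S_INR, RtoC_plus. simpl. ring. }
  assert (Hz : poly n (fun _ => r1) zeroX) by (apply poly_zero; intros; lra).
  destruct (roots_at zeroX Hz) as [l0 [u0 [A1 [A2 A3]]]].
  destruct (psum_hol one 0 zeroX H1 Hz) as [L _]. destruct (L 1 ltac:(lra)) as [d [Hd K]].
  exists (length l0), (Rmin d r1). split. split. apply Rmin_glb_lt; lra. apply Rmin_r.
  intros x Hx. assert (Hx1 : poly n (fun _ => r1) x). { intros i Hi. apply (Rlt_le_trans _ _ _ (Hx i Hi)), Rmin_r. }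
  destruct (roots_at x Hx1) as [l [u [B1 [B2 B3]]]]. exists l, u. split; auto.
  specialize (K x). rewrite (psum_roots one 0 x l u), (psum_roots one 0 zeroX l0 u0), !Hlen in K; auto.
  rewrite <- RtoC_minus, Cmod_R in K.
  assert (Hk : nX n zeroX d x).
  { intros i Hi. unfold zeroX. replace (x i - 0)%C with (x i) by ring. apply (Rlt_le_trans _ _ _ (Hx i Hi)), Rmin_l. }
  specialize (K Hk). apply Rabs_def2 in K.
  destruct (Nat.lt_trichotomy (length l) (length l0)) as [Hlt|[He|Hlt]]; auto;
    apply le_INR in Hlt; rewrite S_INR in Hlt; lra.
Qed.

(** [F'] consists of the norms, that is the products of g(x, a) over the roots a of f(x, .), for g
    in the span of F. If no root is a common zero of F, [span_avoid] gives a g whose norm is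
    nonzero; conversely a common zero is a root of f, and it makes a factor of every norm vanish.
    The constant number d of roots lets the single polynomial [N d] express the norm for all x. *)
Lemma elimination_aux (F : ((nat -> C) -> C) -> Prop) :
  (forall g, F g -> forall x, poly (S n) (fun _ => r) x -> hol_at (S n) g x) -> F f ->
  exists r2, 0 < r2 <= r1 /\ exists F' : ((nat -> C) -> C) -> Prop,
    (forall g, F' g -> forall x, poly n (fun _ => r2) x -> hol_at n g x) /\
    forall x, poly n (fun _ => r2) x ->
      ((forall g, F' g -> g x = 0) <-> exists w, Cmod w < r0 /\ forall g, F g -> g (upd x n w) = 0).
Proof.
  intros HF HFf. destruct root_count as [d [r2 [Hr2 Hroots]]].
  destruct (esym_of_power_sums d) as [N HN]. destruct (HN d (Nat.le_refl _)) as [N1 N2].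
  assert (Hsp : forall g, span F g -> forall x, poly (S n) (fun _ => r) x -> hol_at (S n) g x).
  { induction 1. intros; apply hol_at_const. intros x Hx. apply hol_at_plus; auto. apply hol_at_mult; auto. apply hol_at_const. }
  exists r2. split; auto. exists (fun G => exists g, span F g /\ G = fun x => N d (fun k => psum g k x)).
  assert (H21 : forall x, poly n (fun _ => r2) x -> poly n (fun _ => r1) x).
  { intros x Hx i Hi. specialize (Hx i Hi). simpl in Hx. lra. }
  split.
  - intros G [g [Hg ->]] x Hx. apply N2. intros k. apply psum_hol; auto.
  - intros x Hx. destruct (Hroots x Hx) as [l [u [Hl [L1 [L2 L3]]]]].
    assert (Hprod : forall g, span F g -> N d (fun k => psum g k x) = fold_right Cmult (RtoC 1) (map (fun a => g (upd x n a)) l)).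
    { intros g Hg. rewrite <- esym_full, length_map, Hl, N1. f_equal. apply functional_extensionality. intros k.
      apply (psum_roots g k x l u); auto. }
    split.
    + intros H. apply NNPP. intros Hn.
      destruct (span_avoid F (fun a => upd x n a) l) as [g [Hg Hga]].
      { intros a Ha. apply NNPP. intros Hna. apply Hn. exists a. split; auto. intros g Hg. apply NNPP. intros Hga.
        apply Hna. exists g; auto. }
      assert (E0 : N d (fun k => psum g k x) = 0) by (apply (H (fun x => N d (fun k => psum g k x))); eauto).
      rewrite Hprod in E0 by auto. revert E0. clear - Hga. induction l; simpl. apply C1_nz.
      apply Cmult_neq_0. apply Hga; simpl; auto. intros K0. apply IHl; auto. intros; apply Hga; simpl; auto.
    + intros [w [Hw Hgw]] G [g [Hg ->]]. rewrite Hprod by auto.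
      assert (Hin : In w l).
      { apply root_prod_zero. destruct L2 as [_ L2]. specialize (L2 w ltac:(lra)). rewrite (Hgw f HFf) in L2.
        apply NNPP. intros Hn. apply (Cmult_neq_0 _ _ Hn (L3 w ltac:(lra))). auto. }
      assert (g (upd x n w) = 0).
      { induction Hg; auto. rewrite IHHg, Hgw by auto. ring. }
      revert Hin H. clear. induction l; simpl. tauto. intros [->|Hi] H0. rewrite H0. ring. rewrite IHl; auto. ring.
Qed.
End Elimination.

Lemma elimination n r (F : ((nat -> C) -> C) -> Prop) f r1 : 0 < r ->
  (forall g, F g -> forall x, poly (S n) (fun _ => r) x -> hol_at (S n) g x) -> F f ->
  0 < r1 -> (forall w, 0 < Cmod w < r1 -> f (upd zeroX n w) <> 0) ->
  exists r2 r0, 0 < r2 <= r /\ 0 < r0 < r /\ exists F' : ((nat -> C) -> C) -> Prop,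
    (forall g, F' g -> forall x, poly n (fun _ => r2) x -> hol_at n g x) /\
    forall x, poly n (fun _ => r2) x ->
      ((forall g, F' g -> g x = 0) <-> exists w, Cmod w < r0 /\ forall g, F g -> g (upd x n w) = 0).
Proof.
  (* Division by 6 places the closed annulus r0 <= |w| <= 5 * r0 inside |w| < r and inside the
     punctured disc of radius r1 where f has no zero. *)
  intros Hr HF Hf Hr1 Hnz. set (r0 := Rmin r r1 / 6).
  assert (0 < Rmin r r1) by (apply Rmin_glb_lt; auto). pose proof (Rmin_l r r1). pose proof (Rmin_r r r1).
  destruct (nonvanishing_near n f r0 (5 * r0)) as [d [Hd K]].
  { intros w Hw. split. 2: apply Hnz; unfold r0 in *; lra.
    apply HF; auto. intros i Hi. unfold upd. destruct (Nat.eqb_spec i n). unfold r0 in *; lra. unfold zeroX. rewrite Cmod_0; auto. }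
  destruct (elimination_aux n r r0 (Rmin d r) f) with (F := F) as [r2 [Hr2 X]]; auto.
  - unfold r0; lra.
  - unfold r0; lra.
  - split. apply Rmin_glb_lt; auto. apply Rmin_r.
  - intros x Hx w Hw. apply K; auto. intros i Hi. unfold zeroX. replace (x i - 0)%C with (x i) by ring.
    apply (Rlt_le_trans _ _ _ (Hx i Hi)), Rmin_l.
  - exists r2, r0. split. split; [lra|]. apply Rle_trans with (Rmin d r); [lra|apply Rmin_r]. split; auto. unfold r0; lra.
Qed.

(** * Local structure of analytic sets *)

(** Induction on the number j of variables after the k-th. For j = 0 every g, restricted to the k-th
    axis, has zeros accumulating at 0 and so vanishes on a disc. For j + 1 the hypothesis on x k = 0
    keeps the last axis out of the zero set, so some f in F does not vanish identically along it and
    the last variable can be eliminated. The three hypotheses on the zero set pass to its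
    projection. *)
Lemma zero_locus_hits_slices k j : forall r (F : ((nat -> C) -> C) -> Prop), let n := (k + j)%nat in 0 < r ->
  (forall g, F g -> forall x, poly (S n) (fun _ => r) x -> hol_at (S n) g x) ->
  (forall x, poly (S n) (fun _ => r) x -> (forall g, F g -> g x = 0) -> forall i, (i < k)%nat -> x i = 0) ->
  (forall x, poly (S n) (fun _ => r) x -> (forall g, F g -> g x = 0) -> x k = 0 -> forall i, (i < S n)%nat -> x i = 0) ->
  (forall d, 0 < d -> exists x, poly (S n) (fun _ => d) x /\ (forall g, F g -> g x = 0) /\ exists i, (i < S n)%nat /\ x i <> 0) ->
  exists t0, 0 < t0 /\ forall t, Cmod t < t0 -> exists x, poly (S n) (fun _ => r) x /\ (forall g, F g -> g x = 0) /\ x k = t.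
Proof.
  induction j; intros r F n Hr HF H0 H1 H2.
  - replace n with k in * by (unfold n; lia). clear n.
    exists (r / 8). split; [lra|]. intros t Ht. exists (upd zeroX k t).
    assert (Hp : forall t, Cmod t < r -> poly (S k) (fun _ => r) (upd zeroX k t)).
    { intros s Hs i Hi. unfold upd. destruct (Nat.eqb_spec i k); auto. unfold zeroX; rewrite Cmod_0; auto. }
    split. apply Hp; lra. split; [|apply upd_eq].
    intros g Hg. apply (identity_thm r (fun t => g (upd zeroX k t)) (r/8)); try lra.
    + intros z Hz. apply (hol_at_slice (S k)); auto.
    + intros d Hd. destruct (H2 (Rmin d r)) as [x [Hx [Hz [i [Hi Hxi]]]]]. apply Rmin_glb_lt; auto.
      assert (Hxr : poly (S k) (fun _ => r) x) by (intros l Hl; apply (Rlt_le_trans _ _ _ (Hx l Hl)), Rmin_r).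
      exists (x k). split; [|split].
      * intros E0. apply Hxi. apply (H1 x); auto.
      * apply (Rlt_le_trans _ _ _ (Hx k ltac:(lia))), Rmin_l.
      * rewrite (hol_at_dep (S k) g x); auto. intros l Hl. unfold upd. destruct (Nat.eqb_spec l k); subst; auto.
        symmetry. apply (H0 x); auto. lia.
  - set (m := (k + j)%nat). assert (En : n = S m) by (unfold n, m; lia). rewrite En in *. clear n En.
    assert (Hp : forall t, Cmod t < r -> poly (S (S m)) (fun _ => r) (upd zeroX (S m) t)).
    { intros s Hs i Hi. unfold upd. destruct (Nat.eqb_spec i (S m)); auto. unfold zeroX; rewrite Cmod_0; auto. }
    assert (Hf : exists f, F f /\ exists w, Cmod w <= r / 8 /\ f (upd zeroX (S m) w) <> 0).
    { apply NNPP. intros Hn.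
      assert (Ew : RtoC (r/8) = 0).
      { rewrite <- (upd_eq zeroX (S m) (RtoC (r/8))). apply (H1 (upd zeroX (S m) (RtoC (r/8)))); try lia.
        - apply Hp. rewrite Cmod_R, Rabs_pos_eq; lra.
        - intros g Hg. apply NNPP. intros Hgn. apply Hn. exists g; split; auto. exists (RtoC (r/8)). split; auto.
          rewrite Cmod_R, Rabs_pos_eq; lra.
        - rewrite upd_neq by (unfold m; lia). auto. }
      apply RtoC_inj in Ew. lra. }
    destruct Hf as [f [HFf [w0 [Hw0 Hfw0]]]].
    assert (Hr1 : exists r1, 0 < r1 /\ forall w, 0 < Cmod w < r1 -> f (upd zeroX (S m) w) <> 0).
    { apply NNPP. intros Hn. apply Hfw0. apply (identity_thm r (fun t => f (upd zeroX (S m) t)) (r/8)); try lra.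
      - intros z Hz. apply (hol_at_slice (S (S m))); auto.
      - intros d Hd. apply NNPP. intros Hd'. apply Hn. exists d. split; auto. intros w Hw E0. apply Hd'. exists w.
        split. apply Cmod_gt_0; lra. split; auto. lra. }
    destruct Hr1 as [r1 [Hr1 Hnz]].
    destruct (elimination (S m) r F f r1 Hr HF HFf Hr1 Hnz) as [r2 [r0 [Hr2 [Hr0 [F' [HF' Hiff]]]]]].
    assert (Hlift : forall x w, poly (S m) (fun _ => r2) x -> Cmod w < r0 -> poly (S (S m)) (fun _ => r) (upd x (S m) w)).
    { intros x w Hx Hw i Hi. unfold upd. destruct (Nat.eqb_spec i (S m)). lra. specialize (Hx i ltac:(lia)). simpl in Hx. lra. }
    destruct (IHj r2 F') as [t0 [Ht0 K]]; auto; try lra; fold m.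
    + intros x Hx Hz i Hi. apply Hiff in Hz; auto. destruct Hz as [w [Hw Hz]].
      rewrite <- (upd_neq x (S m) w) by (unfold m; lia). apply (H0 (upd x (S m) w)); auto.
    + intros x Hx Hz Hk i Hi. apply Hiff in Hz; auto. destruct Hz as [w [Hw Hz]].
      rewrite <- (upd_neq x (S m) w) by lia. apply (H1 (upd x (S m) w)); auto; try lia.
      rewrite upd_neq by (unfold m; lia). auto.
    + intros d Hd. destruct (H2 (Rmin d (Rmin r2 r0))) as [x [Hx [Hz [i [Hi Hxi]]]]].
      apply Rmin_glb_lt; auto. apply Rmin_glb_lt; lra.
      assert (B1 : forall i, (i < S (S m))%nat -> Cmod (x i) < d) by (intros l Hl; apply (Rlt_le_trans _ _ _ (Hx l Hl)), Rmin_l).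
      assert (B2 : forall i, (i < S (S m))%nat -> Cmod (x i) < r2).
      { intros l Hl. apply (Rlt_le_trans _ _ _ (Hx l Hl)). eapply Rle_trans; [apply Rmin_r|apply Rmin_l]. }
      assert (B3 : forall i, (i < S (S m))%nat -> Cmod (x i) < r0).
      { intros l Hl. apply (Rlt_le_trans _ _ _ (Hx l Hl)). eapply Rle_trans; [apply Rmin_r|apply Rmin_r]. }
      exists x. split. intros l Hl; apply B1; lia. split.
      * apply Hiff. intros l Hl; apply B2; lia. exists (x (S m)). split. apply B3; lia. rewrite upd_self. auto.
      (* The projection cannot be 0: its k-th coordinate would be 0, and then x itself would be
         0. *)
      * apply NNPP. intros Hn. apply Hxi. apply (H1 x); auto.
        intros l Hl. apply Rlt_le_trans with r2; [|lra]. apply B2; auto.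
        apply NNPP. intros Hk. apply Hn. exists k. split; auto. unfold m; lia.
    + exists t0. split; auto. intros t Ht. destruct (K t Ht) as [x [Hx [Hz Hk]]]. fold m in Hx.
      apply Hiff in Hz; auto. destruct Hz as [w [Hw Hz]]. exists (upd x (S m) w). split; auto. split; auto.
      rewrite upd_neq by (unfold m; lia). auto.
Qed.

Lemma zero_locus_contains_slices n r (F : ((nat -> C) -> C) -> Prop) : 0 < r ->
  (forall g, F g -> forall x, poly (S n) (fun _ => r) x -> hol_at (S n) g x) ->
  (forall d, 0 < d -> exists x, poly (S n) (fun _ => d) x /\ (forall g, F g -> g x = 0) /\ exists i, (i < S n)%nat /\ x i <> 0) ->
  exists k t0, (k <= n)%nat /\ 0 < t0 /\ forall t, Cmod t < t0 ->
    exists x, poly (S n) (fun _ => r) x /\ (forall g, F g -> g x = 0) /\ (forall i, (i < k)%nat -> x i = 0) /\ x k = t.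
Proof.
  intros Hr HF Hni.
  set (NI := fun k => forall d, 0 < d -> exists x, poly (S n) (fun _ => d) x /\ (forall g, F g -> g x = 0) /\
    (forall i, (i < k)%nat -> x i = 0) /\ exists i, (i < S n)%nat /\ x i <> 0).
  assert (Hk : exists k, (k <= n)%nat /\ NI k /\ ~ NI (S k)).
  { assert (N0 : NI 0%nat). { intros d Hd. destruct (Hni d Hd) as [x [H1 [H2 H3]]]. exists x. repeat split; auto. intros; lia. }
    assert (N1 : ~ NI (S n)). { intros H. destruct (H 1 ltac:(lra)) as [x [_ [_ [H1 [i [Hi H2]]]]]]. auto. }
    apply NNPP. intros Hn. apply N1.
    assert (X : forall k, (k <= S n)%nat -> NI k).
    { induction k; auto. intros Hk. apply NNPP. intros Hnk. apply Hn. exists k. split; [lia|]. split; auto. apply IHk; lia. }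
    apply X; auto. }
  destruct Hk as [k [Hkn [N1 N2]]].
  apply not_all_ex_not in N2. destruct N2 as [r' N2]. apply imply_to_and in N2. destruct N2 as [Hr' N2].
  set (s := Rmin r r'). assert (Hs : 0 < s) by (apply Rmin_glb_lt; auto).
  assert (Hsr : forall x, poly (S n) (fun _ => s) x -> poly (S n) (fun _ => r) x).
  { intros x Hx i Hi. apply (Rlt_le_trans _ _ _ (Hx i Hi)), Rmin_l. }
  set (Fk := fun g => F g \/ exists i, (i < k)%nat /\ g = fun x : nat -> C => x i).
  assert (HZ : forall x, (forall g, Fk g -> g x = 0) <-> ((forall g, F g -> g x = 0) /\ forall i, (i < k)%nat -> x i = 0)).
  { intros x. split.
    - intros H. split. intros g Hg; apply H; left; auto. intros i Hi. apply (H (fun x => x i)). right. eauto.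
    - intros [H1 H2] g [Hg|[i [Hi ->]]]; auto. }
  destruct (zero_locus_hits_slices k (n - k) s Fk) as [t0 [Ht0 K]]; replace (k + (n - k))%nat with n in * by lia; auto.
  - intros g [Hg|[i [Hi ->]]] x Hx. apply HF; auto. apply hol_at_coord. lia.
  - intros x Hx Hz. apply HZ in Hz. apply Hz.
  - intros x Hx Hz Hxk i Hi. apply HZ in Hz. destruct Hz as [Hz1 Hz2]. apply NNPP. intros Hxi. apply N2. exists x.
    split. intros l Hl. apply (Rlt_le_trans _ _ _ (Hx l Hl)), Rmin_r. split; auto. split; eauto.
    intros l Hl. destruct (Nat.eq_dec l k) as [->|]; auto. apply Hz2; lia.
  - intros d Hd. destruct (N1 d Hd) as [x [A1 [A2 [A3 A4]]]]. exists x. split; auto. split; auto. apply HZ. auto.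
  - exists k, t0. split; auto. split; auto. intros t Ht. destruct (K t Ht) as [x [A1 [A2 A3]]].
    apply HZ in A2. exists x. split; [apply Hsr; auto|tauto].
Qed.

(** * From [CN N] to sequences of coordinates *)

Ltac cring := match goal with |- @eq _ ?a ?b => change (@eq C a b) end; ring.

Lemma Defs_Cmod z : Defs.Cmod z = Cmod z.
Proof. unfold Defs.Cmod, Cmod. f_equal. ring. Qed.

Definition fin_index {N} (i : Fin.t N) : nat := proj1_sig (Fin.to_nat i).
Definition extend0 {N} (z : CN N) (k : nat) : C :=
  match Compare_dec.lt_dec k N with left h => z (Fin.of_nat_lt h) | right _ => RtoC 0 end.

Lemma fin_index_lt {N} (i : Fin.t N) : (fin_index i < N)%nat.
Proof. unfold fin_index. apply (proj2_sig (Fin.to_nat i)). Qed.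

Lemma extend0_fi {N} (z : CN N) (i : Fin.t N) : extend0 z (fin_index i) = z i.
Proof.
  unfold extend0. destruct (Compare_dec.lt_dec (fin_index i) N) as [h|h]; [|exfalso; apply h, fin_index_lt].
  f_equal. transitivity (Fin.of_nat_lt (proj2_sig (Fin.to_nat i))). apply Fin.of_nat_ext. apply Fin.of_nat_to_nat_inv.
Qed.

Lemma fin_index_surj {N} k : (k < N)%nat -> exists i : Fin.t N, fin_index i = k.
Proof. intros h. exists (Fin.of_nat_lt h). unfold fin_index. rewrite Fin.to_nat_of_nat. auto. Qed.

Lemma fin_index_inj {N} (i j : Fin.t N) : fin_index i = fin_index j -> i = j.
Proof. apply Fin.to_nat_inj. Qed.

Lemma lim_sumC {P} (M : R -> P -> Prop) (HM : monoN M) N : forall (h : Fin.t N -> P -> C) (l : Fin.t N -> C),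
  (forall i, lim_at M (h i) (l i)) -> lim_at M (fun p => sumC N (fun i => h i p)) (sumC N l).
Proof.
  induction N; intros h l H; simpl. apply lim_const. apply (lim_plus M HM); auto.
Qed.

Lemma sumC_zero N : forall h : Fin.t N -> C, (forall i, h i = RtoC 0) -> sumC N h = RtoC 0.
Proof.
  induction N; intros h H; simpl; auto. rewrite IHN by auto. rewrite H. apply Cplus_0_r.
Qed.

Lemma sumC_single N : forall (i : Fin.t N) (h : Fin.t N -> C), (forall j, j <> i -> h j = 0) -> sumC N h = h i.
Proof.
  induction N; intros i; [inversion i|].
  refine (Fin.caseS' i (fun i => forall h : Fin.t (S N) -> C, (forall j, j <> i -> h j = 0) -> sumC (S N) h = h i) _ _); simpl.
  - intros h H. rewrite sumC_zero by (intros; apply H; discriminate). apply Cplus_0_r.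
  - intros p h H. rewrite (H Fin.F1) by discriminate.
    rewrite (IHN p (fun i => h (Fin.FS i))). apply Cplus_0_l.
    intros j Hj. apply H. intros E0. apply Hj. apply Fin.FS_inj; auto.
Qed.

Lemma sumR_zero N : forall h : Fin.t N -> R, (forall i, h i = 0) -> sumR N h = 0.
Proof. induction N; intros h H; simpl; auto. rewrite IHN by auto. rewrite H. ring. Qed.

Lemma sumR_single N : forall (i : Fin.t N) (h : Fin.t N -> R), (forall j, j <> i -> h j = 0) -> sumR N h = h i.
Proof.
  induction N; intros i; [inversion i|].
  refine (Fin.caseS' i (fun i => forall h : Fin.t (S N) -> R, (forall j, j <> i -> h j = 0) -> sumR (S N) h = h i) _ _); simpl.
  - intros h H. rewrite sumR_zero by (intros; apply H; discriminate). ring.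
  - intros p h H. rewrite (H Fin.F1) by discriminate.
    rewrite (IHN p (fun i => h (Fin.FS i))). ring.
    intros j Hj. apply H. intros E0. apply Hj. apply Fin.FS_inj; auto.
Qed.

Lemma sumR_const_le N : forall (h : Fin.t N -> R) c, (forall i, h i <= c) -> sumR N h <= INR N * c.
Proof.
  induction N; intros h c H. simpl; lra. rewrite S_INR. simpl. specialize (IHN (fun i => h (Fin.FS i)) c (fun i => H (Fin.FS i))).
  specialize (H Fin.F1). lra.
Qed.

(** Chart centred at q. Coordinate i is stored at index i + 1, because index 0 is reserved for the
    adjoined variable w = l(z), which [emb] forgets. *)
Definition emb {N} (q : CN N) (x : nat -> C) : CN N := fun i => (q i + x (S (fin_index i)))%C.

Lemma emb_upd_0 {N} (q : CN N) x w : emb q (upd x 0 w) = emb q x.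
Proof. apply functional_extensionality. intros i. unfold emb. rewrite upd_neq by lia. auto. Qed.

Lemma emb_ball {N} (q : CN N) r x : poly (S N) (fun _ => r) x -> Defs.ball q r (emb q x).
Proof.
  intros Hx i. rewrite Defs_Cmod. change (Cmod (q i + x (S (fin_index i)) - q i) < r).
  replace (q i + x (S (fin_index i)) - q i)%C with (x (S (fin_index i))) by cring. apply Hx. pose proof (fin_index_lt i). lia.
Qed.

(** The total differential gives joint continuity, since the linear form tends to 0 and the error
    with eps = 1 is at most the sum of the increments. Varying one coordinate alone gives the
    partial derivative [a i]; in variable 0 the function is constant. *)
Lemma hol_at_emb {N} (q : CN N) f x : C_differentiable_at f (emb q x) -> hol_at (S N) (fun y => f (emb q y)) x.
Proof.
  intros [a Ha].
  assert (Hb : forall d y, nX (S N) x d y -> Defs.ball (emb q x) d (emb q y)).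
  { intros d y Hy i. rewrite Defs_Cmod. change (Cmod (q i + y (S (fin_index i)) - (q i + x (S (fin_index i)))) < d).
    replace (q i + y (S (fin_index i)) - (q i + x (S (fin_index i))))%C with (y (S (fin_index i)) - x (S (fin_index i)))%C by cring.
    apply Hy. pose proof (fin_index_lt i). lia. }
  assert (Hsub : forall y i, Csub (emb q y i) (emb q x i) = (y (S (fin_index i)) - x (S (fin_index i)))%C).
  { intros y i. change (Csub (emb q y i) (emb q x i)) with (emb q y i - emb q x i)%C. unfold emb. cring. }
  split.
  - assert (HL : lim_at (nX (S N) x) (fun y => sumC N (fun i => Cmul (a i) (Csub (emb q y i) (emb q x i)))) 0).
    { replace (RtoC 0) with (sumC N (fun i => Cmult (a i) 0)) by (apply sumC_zero; intros; cring).
      apply (lim_sumC (nX (S N) x) (monoN_X _ _) N (fun i y => Cmult (a i) (Csub (emb q y i) (emb q x i)))).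
      intros i. apply lim_mult; auto with mono. apply lim_const.
      eapply lim_ext; auto with mono. exists 1; split; [lra|]. intros y _. symmetry. apply Hsub.
      replace (RtoC 0) with (x (S (fin_index i)) - x (S (fin_index i)))%C by cring. apply lim_minus; auto with mono.
      apply lim_coord. pose proof (fin_index_lt i). lia. apply lim_const. }
    intros e He. destruct (Ha 1 ltac:(lra)) as [d1 [Hd1 K1]]. destruct (HL (e/2) ltac:(lra)) as [d2 [Hd2 K2]].
    assert (Hd3 : 0 < e / (2 * (INR N + 1))) by (apply Rdiv_lt_0_compat; pose proof (pos_INR N); lra).
    exists (Rmin d1 (Rmin d2 (e / (2 * (INR N + 1))))). split. repeat apply Rmin_glb_lt; auto.
    intros y Hy.
    assert (Y1 : nX (S N) x d1 y) by (eapply monoN_X; [|apply Hy]; apply Rmin_l).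
    assert (Y2 : nX (S N) x d2 y) by (eapply monoN_X; [|apply Hy]; eapply Rle_trans; [apply Rmin_r|apply Rmin_l]).
    assert (Y3 : nX (S N) x (e / (2 * (INR N + 1))) y) by (eapply monoN_X; [|apply Hy]; eapply Rle_trans; [apply Rmin_r|apply Rmin_r]).
    specialize (K1 _ (Hb _ _ Y1)). specialize (K2 _ Y2). rewrite Defs_Cmod in K1.
    set (S0 := sumC N (fun i => Cmul (a i) (Csub (emb q y i) (emb q x i)))) in *.
    assert (HS : sumR N (fun i => Defs.Cmod (Csub (emb q y i) (emb q x i))) <= INR N * (e / (2 * (INR N + 1)))).
    { apply sumR_const_le. intros i. rewrite Defs_Cmod, Hsub. apply Rlt_le, Y3. pose proof (fin_index_lt i). lia. }
    assert (INR N * (e / (2 * (INR N + 1))) < e / 2).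
    { pose proof (pos_INR N). replace (e/2) with ((INR N + 1) * (e / (2 * (INR N + 1)))) by (field; lra). nra. }
    change (Cmod (f (emb q y) - f (emb q x) - S0) <= 1 * sumR N (fun i => Defs.Cmod (Csub (emb q y i) (emb q x i)))) in K1.
    replace (f (emb q y) - f (emb q x))%C with ((f (emb q y) - f (emb q x) - S0) + (S0 - 0))%C by cring.
    eapply Rle_lt_trans; [apply Cmod_triangle|]. lra.
  - intros i Hi. destruct i as [|j].
    + apply (cdiff_ext (fun _ => f (emb q x))). exists 1; split; [lra|]. intros. rewrite emb_upd_0. auto. apply cdiff_const.
    + destruct (@fin_index_surj N j ltac:(lia)) as [i0 Ei]. exists (a i0). apply isder_of_eps. intros e He.
      destruct (Ha e He) as [d [Hd K]]. exists d; split; auto. intros w Hw.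
      specialize (K (emb q (upd x (S j) w)) (Hb _ _ (nX_upd _ _ _ _ _ Hd Hw))).
      rewrite upd_self. rewrite Defs_Cmod in K.
      rewrite (sumC_single N i0) in K.
      2: { intros k Hk. rewrite Hsub. rewrite upd_neq. change (Cmult (a k) (x (S (fin_index k)) - x (S (fin_index k)))%C = 0). cring.
           intros E0. apply Hk. apply fin_index_inj. lia. }
      rewrite (sumR_single N i0) in K.
      2: { intros k Hk. rewrite Defs_Cmod, Hsub, upd_neq. apply Cmod_diag.
           intros E0. apply Hk. apply fin_index_inj. lia. }
      rewrite Defs_Cmod, Hsub, Ei, upd_eq in K. exact K.
Qed.

Definition nonisol {N} (A : CN N -> Prop) (p : CN N) : Prop :=
  A p /\ forall r, 0 < r -> exists z, A z /\ z <> p /\ Defs.ball p r z.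

Lemma hol_at_sumC n N : forall (h : Fin.t N -> (nat -> C) -> C) x, (forall i, hol_at n (h i) x) ->
  hol_at n (fun y => sumC N (fun i => h i y)) x.
Proof.
  induction N; intros h x H; simpl. apply hol_at_const. apply (hol_at_plus n (h Fin.F1)); auto.
Qed.

Lemma closed_seq {N} (A : CN N -> Prop) (u : nat -> CN N) z : is_closed A -> (forall n, A (u n)) ->
  (forall r, 0 < r -> exists n, Defs.ball z r (u n)) -> A z.
Proof.
  intros Hc Hu H. apply NNPP. intros Hn. destruct (Hc z Hn) as [r [Hr K]]. destruct (H r Hr) as [n Hn']. apply (K _ Hn'). auto.
Qed.

Lemma nonisol_max {N} (A : CN N -> Prop) q (a : Fin.t N -> C) r : analytic_subvariety A -> nonisol A q -> 0 < r ->
  exists z, nonisol A z /\ z <> q /\ Defs.ball q r z /\ 0 <= fst (sumC N (fun i => Cmult (a i) (z i - q i)%C)).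
Proof.
  intros [Hc HA] [Aq Hni] Hr. destruct (HA q Aq) as [rA [HrA [fs [Hfs Hfz]]]].
  (* Half of the minimum: a limit of points with coordinates below s still lies strictly inside the
     ball of radius r. *)
  set (s := Rmin rA r / 2).
  assert (Hm : 0 < Rmin rA r) by (apply Rmin_glb_lt; auto). pose proof (Rmin_l rA r). pose proof (Rmin_r rA r).
  assert (Hs : 0 < s < rA /\ s < r) by (unfold s; lra).
  set (L := fun x : nat -> C => sumC N (fun i => Cmult (a i) (x (S (fin_index i)))) : C).
  assert (HL : forall x, hol_at (S N) L x).
  { intros x. unfold L. apply hol_at_sumC. intros i. apply hol_at_mult. apply hol_at_const. apply hol_at_coord. pose proof (fin_index_lt i). lia. }
  (* These equations describe the graph of L over A, translated to the origin: the equations of A in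
     variables 1, ..., N together with x 0 = L x. *)
  set (F := fun g : (nat -> C) -> C => (exists f, In f fs /\ g = fun x => f (emb q x)) \/ g = fun x : nat -> C => (x 0%nat - L x)%C).
  assert (HZ : forall x, poly (S N) (fun _ => s) x -> (forall g, F g -> g x = 0) -> A (emb q x) /\ x 0%nat = L x).
  { intros x Hx Hz. split.
    - apply Hfz. apply emb_ball. intros i Hi. specialize (Hx i Hi). simpl in Hx. lra.
      intros f Hf. apply (Hz (fun x => f (emb q x))). left. eauto.
    - apply Ceq_minus. apply (Hz (fun x => x 0%nat - L x)%C). right. auto. }
  assert (embsub : forall x i, (emb q x i - q i)%C = x (S (fin_index i))) by (intros; unfold emb; cring).
  destruct (zero_locus_contains_slices N s F) as [k [t0 [Hk [Ht0 K]]]].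
  - lra.
  - intros g [[f [Hf ->]]| ->] x Hx.
    + apply hol_at_emb. apply (Hfs f Hf). apply emb_ball. intros i Hi. specialize (Hx i Hi). simpl in Hx. lra.
    + apply hol_at_minus; auto. apply hol_at_coord. lia.
  - intros d Hd. destruct (HL zeroX) as [LL _]. destruct (LL d Hd) as [d' [Hd' KL]].
    assert (L0 : L zeroX = 0) by (apply sumC_zero; intros; unfold zeroX; cring).
    destruct (Hni (Rmin rA (Rmin d d'))) as [z [Az [Hzq Hzb]]]. repeat apply Rmin_glb_lt; auto.
    set (x1 := fun j => match j with O => RtoC 0 | S j => (extend0 z j - extend0 q j)%C end).
    set (x := upd x1 0 (L x1)).
    assert (xS : forall i : Fin.t N, x (S (fin_index i)) = (z i - q i)%C).
    { intros i. unfold x. rewrite upd_neq by lia. simpl. rewrite !extend0_fi. auto. }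
    assert (x1S : forall i : Fin.t N, x1 (S (fin_index i)) = (z i - q i)%C) by (intros i; simpl; rewrite !extend0_fi; auto).
    assert (Ex : emb q x = z). { apply functional_extensionality. intros i. unfold emb. rewrite xS. cring. }
    assert (Bz : forall i, Cmod (z i - q i) < Rmin rA (Rmin d d')) by (intros i; rewrite <- Defs_Cmod; apply (Hzb i)).
    assert (Lx : L x = L x1).
    { unfold L. apply f_equal. apply functional_extensionality. intros i. rewrite xS, x1S. auto. }
    exists x. split; [|split].
    + intros i Hi. destruct i as [|j].
      * unfold x. rewrite upd_eq. specialize (KL x1). rewrite L0 in KL. replace (L x1 - 0)%C with (L x1) in KL by cring.
        apply KL. intros i Hi'. unfold zeroX. destruct i as [|j]. simpl. rewrite Cmod_diag; auto.
        destruct (@fin_index_surj N j ltac:(lia)) as [i0 <-]. rewrite x1S. replace (z i0 - q i0 - 0)%C with (z i0 - q i0)%C by cring.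
        apply (Rlt_le_trans _ _ _ (Bz i0)). eapply Rle_trans; [apply Rmin_r|apply Rmin_r].
      * destruct (@fin_index_surj N j ltac:(lia)) as [i0 <-]. rewrite xS.
        apply (Rlt_le_trans _ _ _ (Bz i0)). eapply Rle_trans; [apply Rmin_r|apply Rmin_l].
    + intros g [[f [Hf ->]]| ->].
      * rewrite Ex. apply Hfz; auto. intros i. eapply Rlt_le_trans; [apply (Hzb i)|]. apply Rmin_l.
      * rewrite Lx. unfold x at 1. rewrite upd_eq. cring.
    + apply NNPP. intros Hn. apply Hzq. rewrite <- Ex. apply functional_extensionality. intros i. unfold emb.
      replace (x (S (fin_index i))) with (RtoC 0). cring. symmetry. apply NNPP. intros Hx. apply Hn. exists (S (fin_index i)). split; auto.
      pose proof (fin_index_lt i). lia.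
  (* The parameters t n lie in (T, 2 * T], hence below t0, and tend to T without reaching it. That t
     n <> T separates the approximating points from their limit, which is thus non-isolated; that T
     <> 0 separates the limit from q. *)
  - set (T := t0 / 4). assert (HT : 0 < T) by (unfold T; lra).
    set (t := fun n => T + T * / (INR n + 1)).
    assert (HI : forall n, 0 < / (INR n + 1) <= 1).
    { intros n. pose proof (pos_INR n). split. apply Rinv_0_lt_compat; lra. rewrite <- Rinv_1. apply Rinv_le_contravar; lra. }
    assert (Ht : forall n, T < t n <= 2 * T) by (intros n; unfold t; specialize (HI n); nra).
    assert (X : forall n, exists x, poly (S N) (fun _ => s) x /\ (forall g, F g -> g x = 0) /\ (forall i, (i < k)%nat -> x i = 0) /\ x k = RtoC (t n)).
    { intros n. apply K. rewrite Cmod_R, Rabs_pos_eq; specialize (Ht n); unfold T in *; lra. }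
    destruct (choice _ X) as [x Hx]. clear X K.
    destruct (BW_X (S N) x s) as [phi [l [Hphi Hl]]]. intros n i Hi. apply Rlt_le. apply Hx; auto.
    assert (Hlk : l k = RtoC T).
    { apply (cvC_unique (fun n => x (phi n) k)). apply Hl; lia. intros e He.
      destruct (inv_INR_lt (e / T)) as [M HM]. apply Rdiv_lt_0_compat; auto. exists M. intros n Hn.
      destruct (Hx (phi n)) as [_ [_ [_ ->]]]. rewrite <- RtoC_minus, Cmod_R. unfold t.
      replace (T + T * / (INR (phi n) + 1) - T) with (T * / (INR (phi n) + 1)) by ring.
      rewrite Rabs_pos_eq by (apply Rlt_le, Rmult_lt_0_compat; auto; apply HI).
      specialize (HM (phi n) ltac:(specialize (Hphi n); lia)). apply (Rmult_lt_compat_l T) in HM; auto.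
      replace (T * (e / T)) with e in HM by (field; lra). auto. }
    assert (Hli : forall i, (i < k)%nat -> l i = 0).
    { intros i Hi. apply (cvC_unique (fun n => x (phi n) i)). apply Hl; lia. apply cvC_const. intros. apply Hx; auto. }
    assert (HlL : l 0%nat = L l).
    { apply (cvC_unique (fun n => x (phi n) 0%nat)). apply Hl; lia.
      intros e He. destruct (HL l) as [LL _]. destruct (lim_at_seq (S N) L l (fun n => x (phi n)) LL Hl e He) as [M HM].
      exists M. intros n Hn. destruct (Hx (phi n)) as [B1 [B2 _]]. destruct (HZ _ B1 B2) as [_ ->]. auto. }
    assert (Hball : forall d, 0 < d -> exists n, Defs.ball (emb q l) d (emb q (x (phi n)))).
    { intros d Hd. destruct (cvC_unif (S N) (fun n => x (phi n)) l Hl d Hd) as [M HM].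
      exists M. intros i. rewrite Defs_Cmod.
      change (Cmod (emb q (x (phi M)) i - emb q l i) < d). unfold emb.
      replace (q i + x (phi M) (S (fin_index i)) - (q i + l (S (fin_index i))))%C with (x (phi M) (S (fin_index i)) - l (S (fin_index i)))%C by cring.
      apply (HM M (Nat.le_refl _)). pose proof (fin_index_lt i); lia. }
    assert (HAx : forall n, A (emb q (x n))). { intros n. destruct (Hx n) as [B1 [B2 _]]. apply (HZ _ B1 B2). }
    (* A point of the graph is determined by its image under [emb], coordinate 0 being L of the
       others. So a difference in coordinate k is visible in [CN N] even when k = 0. *)
    assert (Hdist : forall y, y 0%nat = L y -> y k <> l k -> emb q y <> emb q l).
    { intros y Hy Hyk E0. assert (Ei : forall i : Fin.t N, y (S (fin_index i)) = l (S (fin_index i))).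
      { intros i. rewrite <- !embsub. rewrite E0. auto. }
      apply Hyk. destruct k as [|k'].
      - rewrite Hy, HlL. unfold L. apply f_equal. apply functional_extensionality. intros i. rewrite Ei. auto.
      - destruct (@fin_index_surj N k' ltac:(lia)) as [i <-]. auto. }
    exists (emb q l). split; [split|split; [|split]].
    + apply (closed_seq A (fun n => emb q (x (phi n)))); auto.
    + intros d Hd. destruct (Hball d Hd) as [n Hn]. exists (emb q (x (phi n))). split; auto. split; auto.
      apply Hdist. destruct (Hx (phi n)) as [B1 [B2 _]]. apply (HZ _ B1 B2).
      destruct (Hx (phi n)) as [_ [_ [_ ->]]]. rewrite Hlk. intros E0. apply RtoC_inj in E0. specialize (Ht (phi n)). lra.
    + assert (E0 : emb q zeroX = q) by (apply functional_extensionality; intros i; unfold emb, zeroX; cring).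
      rewrite <- E0 at 2. intros E1. symmetry in E1. revert E1. apply Hdist.
      unfold L, zeroX. rewrite sumC_zero; auto. intros; cring.
      rewrite Hlk. unfold zeroX. intros E1. apply RtoC_inj in E1. lra.
    + intros i. rewrite Defs_Cmod. change (Cmod (emb q l i - q i) < r). rewrite embsub.
      apply Rle_lt_trans with s; [|lra].
      pose proof (fin_index_lt i). apply (cvC_Cmod_le (fun n => x (phi n) (S (fin_index i)))). apply Hl; lia. intros n. apply Rlt_le. apply Hx. lia.
    + replace (sumC N (fun i => Cmult (a i) (emb q l i - q i)%C)) with (l 0%nat).
      2: { rewrite HlL. unfold L. apply f_equal. apply functional_extensionality. intros i. rewrite embsub. auto. }
      destruct k as [|k']. rewrite Hlk. simpl. lra. rewrite (Hli 0%nat) by lia. simpl. lra.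
Qed.

(** Shift one selected coordinate of p by a small w <> 0 and fill in the unselected coordinates by
    the graph map g. Since g depends on the selected coordinates only, filling in does not change
    its values, and the resulting point satisfies the graph equations. *)
Lemma positive_dimensional_nonisol {N} (A : CN N -> Prop) : positive_dimensional A -> exists p, nonisol A p.
Proof.
  intros [p [sel [[i0 Hi0] [Ap [r [Hr [g [Hg [Hdep Hgr]]]]]]]]].
  exists p. split; auto. intros d Hd.
  assert (Hpb : forall e, 0 < e -> Defs.ball p e p).
  { intros e He i. rewrite Defs_Cmod. change (Cmod (p i - p i) < e). rewrite Cmod_diag. auto. }
  assert (Hgp : forall j, sel j = false -> g j p = p j).
  { intros j Hj. symmetry. apply (proj1 (Hgr p (Hpb r Hr)) Ap); auto. }
  set (path := fun w : C => fun i : Fin.t N => if sel i then (if Fin.eq_dec i i0 then p i + w else p i)%C else p i).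
  assert (Epath : forall w, path w = emb p (upd zeroX (S (fin_index i0)) w)).
  { intros w. apply functional_extensionality. intros i. unfold path, emb.
    destruct (Fin.eq_dec i i0) as [->|Hn]. rewrite Hi0, upd_eq; auto.
    rewrite upd_neq. unfold zeroX. destruct (sel i); symmetry; apply Cplus_0_r. intros E0. apply Hn, fin_index_inj. lia. }
  assert (cont : forall j, lim_at (nC 0) (fun w => g j (path w)) (g j p)).
  { intros j. assert (Ep : p = emb p zeroX) by (apply functional_extensionality; intros i; unfold emb, zeroX; symmetry; cring).
    assert (HD : C_differentiable_at (g j) (emb p zeroX)) by (rewrite <- Ep; apply Hg; auto).
    destruct (hol_at_emb p (g j) zeroX HD) as [L _].
    rewrite Ep at 1. apply (lim_comp (nC 0) (nX (S N) zeroX) (fun w => upd zeroX (S (fin_index i0)) w)) in L.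
    - eapply lim_ext; [auto with mono| |apply L]. exists 1; split; [lra|]. intros w _. rewrite Epath. auto.
    - intros e He. exists e; split; auto. intros w Hw. apply nX_upd; auto. }
  set (e := Rmin d r).
  assert (He : 0 < e) by (apply Rmin_glb_lt; auto).
  assert (X : exists d', 0 < d' /\ forall w, nC 0 d' w -> forall j, Cmod (g j (path w) - g j p) < e).
  { clear - cont He.
    assert (Y : forall m, exists d', 0 < d' /\ forall w, nC 0 d' w -> forall j : Fin.t N, (fin_index j < m)%nat -> Cmod (g j (path w) - g j p) < e).
    { induction m. exists 1; split; [lra|]. intros; lia. destruct IHm as [d1 [H1 K1]].
      destruct (Compare_dec.le_lt_dec N m) as [HNm|HNm].
      - exists d1; split; auto. intros w Hw j Hj. apply K1; auto. pose proof (fin_index_lt j). lia.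
      - destruct (@fin_index_surj N m HNm) as [j0 Hj0]. destruct (cont j0 e He) as [d2 [H2 K2]].
        exists (Rmin d1 d2). split. apply Rmin_glb_lt; auto. intros w Hw j Hj.
        destruct (Nat.eq_dec (fin_index j) m) as [E0|].
        + replace j with j0 by (apply fin_index_inj; lia). apply K2. apply (Rlt_le_trans _ _ _ Hw), Rmin_r.
        + apply K1; try lia. apply (Rlt_le_trans _ _ _ Hw), Rmin_l. }
    destruct (Y N) as [d' [H1 H2]]. exists d'; split; auto. intros w Hw j. apply H2; auto. apply fin_index_lt. }
  destruct X as [d' [Hd' Hj]].
  set (w := RtoC (Rmin d' e / 2)).
  assert (Hw0 : 0 < Rmin d' e) by (apply Rmin_glb_lt; auto). pose proof (Rmin_l d' e). pose proof (Rmin_r d' e).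
  assert (Hw : Cmod w = Rmin d' e / 2) by (unfold w; rewrite Cmod_R, Rabs_pos_eq; lra).
  set (z := fun i => if sel i then path w i else g i (path w)).
  assert (Hsel : forall j, g j z = g j (path w)).
  { intros j. apply Hdep. intros i Hi. unfold z. rewrite Hi. auto. }
  assert (Hzb : Defs.ball p e z).
  { intros i. rewrite Defs_Cmod. change (Cmod (z i - p i) < e). unfold z. destruct (sel i) eqn:Ei.
    - unfold path. rewrite Ei. destruct (Fin.eq_dec i i0).
      replace (p i + w - p i)%C with w by cring. lra. rewrite Cmod_diag; auto.
    - rewrite <- (Hgp i Ei). apply Hj. unfold nC. replace (w - 0)%C with w by cring. lra. }
  exists z. split; [|split].
  - apply Hgr. intros i. eapply Rlt_le_trans; [apply (Hzb i)|]. apply Rmin_r.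
    intros j Hjs. rewrite Hsel. unfold z. rewrite Hjs. auto.
  - intros E0. assert (E1 : z i0 = p i0) by (rewrite E0; auto). unfold z in E1. rewrite Hi0 in E1. unfold path in E1.
    rewrite Hi0 in E1. destruct (Fin.eq_dec i0 i0) as [_|n]; [|auto].
    assert (w = 0) by (replace w with (p i0 + w - p i0)%C by cring; rewrite E1; cring).
    rewrite H1, Cmod_0 in Hw. lra.
  - intros i. eapply Rlt_le_trans; [apply (Hzb i)|]. apply Rmin_l.
Qed.

(** * Spheres, moves and the construction *)

Definition sqdist {N} (z w : CN N) : R := sumR N (fun i => Cmod (z i - w i) ^ 2).
Definition edist {N} (z w : CN N) : R := sqrt (sqdist z w).

Lemma sumR_nonneg N : forall h : Fin.t N -> R, (forall i, 0 <= h i) -> 0 <= sumR N h.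
Proof. induction N; intros h H; simpl. lra. apply Rplus_le_le_0_compat; auto. Qed.

Lemma sumR_term N : forall (i : Fin.t N) (h : Fin.t N -> R), (forall i, 0 <= h i) -> h i <= sumR N h.
Proof.
  induction N; intros i; [inversion i|].
  refine (Fin.caseS' i (fun i => forall h : Fin.t (S N) -> R, (forall i, 0 <= h i) -> h i <= sumR (S N) h) _ _); simpl; intros.
  - pose proof (sumR_nonneg N (fun i => h (Fin.FS i)) (fun i => H (Fin.FS i))). lra.
  - pose proof (IHN p (fun i => h (Fin.FS i)) (fun i => H (Fin.FS i))). pose proof (H Fin.F1). simpl in *. lra.
Qed.

Lemma sqdist_nonneg {N} (z w : CN N) : 0 <= sqdist z w.
Proof. apply sumR_nonneg. intros; apply pow2_ge_0. Qed.

Lemma edist_nonneg {N} (z w : CN N) : 0 <= edist z w.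
Proof. apply sqrt_pos. Qed.

Lemma edist_sq {N} (z w : CN N) : edist z w ^ 2 = sqdist z w.
Proof. unfold edist. apply pow2_sqrt, sqdist_nonneg. Qed.

Lemma edist_sym {N} (z w : CN N) : edist z w = edist w z.
Proof.
  unfold edist, sqdist. do 2 f_equal. apply functional_extensionality. intros i. rewrite Cmod_sub_sym. auto.
Qed.

Lemma edist_refl {N} (z : CN N) : edist z z = 0.
Proof.
  unfold edist, sqdist. rewrite sumR_zero. apply sqrt_0. intros i. rewrite Cmod_diag. ring.
Qed.

(** The induction step is the triangle inequality in the plane for the vectors (a_1, sqrt A) and
    (b_1, sqrt B), where A and B are the sums of squares of the remaining entries. *)
Lemma minkowski N : forall a b c : Fin.t N -> R, (forall i, 0 <= a i) -> (forall i, 0 <= b i) -> (forall i, 0 <= c i <= a i + b i) ->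
  sqrt (sumR N (fun i => c i ^ 2)) <= sqrt (sumR N (fun i => a i ^ 2)) + sqrt (sumR N (fun i => b i ^ 2)).
Proof.
  induction N; intros a b c Ha Hb Hc; cbn [sumR].
  - rewrite sqrt_0. lra.
  - specialize (IHN (fun i => a (Fin.FS i)) (fun i => b (Fin.FS i)) (fun i => c (Fin.FS i))
      (fun i => Ha (Fin.FS i)) (fun i => Hb (Fin.FS i)) (fun i => Hc (Fin.FS i))).
    set (A := sumR N (fun i => a (Fin.FS i) ^ 2)) in *. set (B := sumR N (fun i => b (Fin.FS i) ^ 2)) in *.
    set (D := sumR N (fun i => c (Fin.FS i) ^ 2)) in *.
    assert (0 <= A) by (apply sumR_nonneg; intros; apply pow2_ge_0).
    assert (0 <= B) by (apply sumR_nonneg; intros; apply pow2_ge_0).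
    assert (0 <= D) by (apply sumR_nonneg; intros; apply pow2_ge_0).
    pose proof (Cmod_triangle (a Fin.F1, sqrt A) (b Fin.F1, sqrt B)) as T.
    unfold Cmod, Cplus in T. cbn [fst snd] in T. rewrite !pow2_sqrt in T by auto.
    eapply Rle_trans; [|apply T]. apply sqrt_le_1_alt. apply Rplus_le_compat.
    + specialize (Hc Fin.F1). apply pow_incr. auto.
    + rewrite <- (pow2_sqrt D) by auto. apply pow_incr. split; auto. apply sqrt_pos.
Qed.

Lemma edist_tri {N} (z p w : CN N) : edist z w <= edist z p + edist p w.
Proof.
  unfold edist, sqdist. apply (minkowski N (fun i => Cmod (z i - p i)) (fun i => Cmod (p i - w i)) (fun i => Cmod (z i - w i)));
  intros; try apply Cmod_ge_0. split. apply Cmod_ge_0. apply Cmod_tri.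
Qed.

Lemma edist_diff {N} (z w c : CN N) : Rabs (edist z c - edist w c) <= edist z w.
Proof.
  pose proof (edist_tri z w c). pose proof (edist_tri w z c). rewrite (edist_sym w z) in H0. apply Rabs_le. lra.
Qed.

Lemma coord_le_ed {N} (z w : CN N) i : Cmod (z i - w i) <= edist z w.
Proof.
  rewrite <- (sqrt_pow2 (Cmod (z i - w i))) by apply Cmod_ge_0. apply sqrt_le_1_alt.
  apply (sumR_term N i (fun i => Cmod (z i - w i) ^ 2)). intros; apply pow2_ge_0.
Qed.

(** The constant N + 1 is crude but positive for every N, so that radii can be divided by it when
    passing between polydiscs and Euclidean balls. *)
Lemma edist_le_coord {N} (z w : CN N) d : 0 <= d -> (forall i, Cmod (z i - w i) <= d) -> edist z w <= (INR N + 1) * d.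
Proof.
  intros Hd H. pose proof (pos_INR N).
  rewrite <- (sqrt_pow2 ((INR N + 1) * d)) by (apply Rmult_le_pos; lra). apply sqrt_le_1_alt.
  eapply Rle_trans. apply (sumR_const_le N _ (d ^ 2)). intros i. apply pow_incr. split; auto. apply Cmod_ge_0.
  rewrite Rpow_mult_distr. apply Rmult_le_compat_r. apply pow2_ge_0. nra.
Qed.

Lemma edist_pos {N} (z w : CN N) : z <> w -> 0 < edist z w.
Proof.
  intros H. destruct (edist_nonneg z w) as [|E0]; auto. exfalso. apply H. apply functional_extensionality. intros i.
  apply Ceq_minus. apply Cmod_eq_0. apply Rle_antisym; [|apply Cmod_ge_0]. rewrite E0. apply coord_le_ed.
Qed.

Lemma ball_of_ed {N} (p z : CN N) r : edist z p < r -> Defs.ball p r z.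
Proof. intros H i. rewrite Defs_Cmod. eapply Rle_lt_trans; [apply (coord_le_ed z p i)|auto]. Qed.

Lemma edist_of_ball {N} (p z : CN N) r : 0 < r -> Defs.ball p r z -> edist z p <= (INR N + 1) * r.
Proof.
  intros Hr H. apply edist_le_coord; [lra|]. intros i. specialize (H i). rewrite Defs_Cmod in H. apply Rlt_le, H.
Qed.

Lemma closed_ed {N} (X : CN N -> Prop) (u : nat -> CN N) q : is_closed X -> (forall n, X (u n)) ->
  (forall e, 0 < e -> exists M, forall n, (M <= n)%nat -> edist (u n) q < e) -> X q.
Proof.
  intros Hc Hu H. apply (closed_seq X u q Hc Hu). intros r Hr. destruct (H r Hr) as [M HM]. exists M.
  apply ball_of_ed, HM. auto.
Qed.

Lemma BW_CN {N} (u : nat -> CN N) p M : (forall n, edist (u n) p <= M) ->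
  exists phi q, (forall n, (n <= phi n)%nat) /\ forall e, 0 < e -> exists M, forall n, (M <= n)%nat -> edist (u (phi n)) q < e.
Proof.
  intros H.
  destruct (BW_X N (fun n => extend0 (fun i => (u n i - p i)%C)) M) as [phi [l [Hp Hl]]].
  { intros n i Hi. destruct (@fin_index_surj N i Hi) as [j <-]. rewrite extend0_fi. eapply Rle_trans; [apply coord_le_ed|auto]. }
  exists phi, (fun i => (p i + l (fin_index i))%C). split; auto. intros e He.
  set (d := e / (2 * (INR N + 1))). assert (Hd : 0 < d) by (apply Rdiv_lt_0_compat; pose proof (pos_INR N); lra).
  destruct (cvC_unif N _ _ Hl d Hd) as [K HK]. exists K. intros n Hn.
  apply Rle_lt_trans with ((INR N + 1) * d).
  - apply edist_le_coord; [lra|]. intros i. specialize (HK n Hn (fin_index i) (fin_index_lt i)). rewrite extend0_fi in HK.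
    replace (u (phi n) i - (p i + l (fin_index i)))%C with (u (phi n) i - p i - l (fin_index i))%C by cring. lra.
  - pose proof (pos_INR N). replace ((INR N + 1) * d) with (e / 2) by (unfold d; field; lra). lra.
Qed.

(** * The maximum property and moves of prescribed length *)

Lemma sum_expansion N : forall (A B A' B' D : Fin.t N -> R) (G : Fin.t N -> C),
  (forall i, A i - /2 * B i - A' i + /2 * B' i = fst (G i) + /2 * D i) ->
  sumR N A - /2 * sumR N B - sumR N A' + /2 * sumR N B' = fst (sumC N G) + /2 * sumR N D.
Proof.
  induction N; intros A B A' B' D G H; simpl. lra.
  specialize (IHN _ _ _ _ _ _ (fun i => H (Fin.FS i))). specialize (H Fin.F1). lra.
Qed.

(** Expanding both squares at q, the quadratic parts leave 1 - 1/2 of |z-q|^2, and the linear parts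
    combine to the real part of a complex linear form, whose coefficients are the conjugates of 2 (q
    - c) - (q - p). *)
Lemma sqdist_expansion {N} (z q c p : CN N) :
  (sqdist z c - /2 * sqdist z p) - (sqdist q c - /2 * sqdist q p) =
  fst (sumC N (fun i => Cmult (Cconj (2 * (q i - c i) - (q i - p i))) (z i - q i)%C)) + /2 * sqdist z q.
Proof.
  transitivity (sqdist z c - /2 * sqdist z p - sqdist q c + /2 * sqdist q p). ring.
  apply sum_expansion. intros i. rewrite !Cmod2_alt. destruct (z i), (q i), (c i), (p i).
  unfold Cconj, Cminus, Cplus, Copp, Cmult, Re, Im, RtoC; simpl. field.
Qed.

(** The inequality is weak but the point differs from q: the term |z-q|^2/2 of [sqdist_expansion]
    turns z <> q into a strict increase. *)
Definition max_property {N} (X : CN N -> Prop) : Prop :=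
  forall q (a : Fin.t N -> C) r, X q -> 0 < r ->
  exists z, X z /\ z <> q /\ Defs.ball q r z /\ 0 <= fst (sumC N (fun i => Cmult (a i) (z i - q i)%C)).

Lemma move {N} (X : CN N -> Prop) p c s : is_closed X -> max_property X -> X p -> 0 < s ->
  exists z, X z /\ edist z p = s /\ edist p c ^ 2 + s ^ 2 / 2 <= edist z c ^ 2.
Proof.
  intros Hc Hm Xp Hs. set (phi := fun z => sqdist z c - /2 * sqdist z p).
  set (V := fun v => exists z, X z /\ edist z p <= s /\ v = phi z).
  destruct (completeness V) as [M [HM1 HM2]].
  - exists ((s + edist p c) ^ 2). intros v [z [Xz [Hz ->]]]. unfold phi.
    pose proof (sqdist_nonneg z p). rewrite <- (edist_sq z c). pose proof (edist_tri z p c). pose proof (edist_nonneg z c).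
    assert (edist z c ^ 2 <= (s + edist p c) ^ 2) by (apply pow_incr; lra). lra.
  - exists (phi p), p. rewrite edist_refl. split; auto. split; [lra|auto].
  - assert (Y : forall n : nat, exists z, X z /\ edist z p <= s /\ M - / (INR n + 1) <= phi z).
    { intros n. apply NNPP. intros Hn.
      assert (0 < / (INR n + 1)) by (apply Rinv_0_lt_compat; pose proof (pos_INR n); lra).
      assert (M <= M - / (INR n + 1)). { apply HM2. intros v [z [Xz [Hz ->]]].
        destruct (Rle_lt_dec (phi z) (M - / (INR n + 1))); auto. exfalso. apply Hn. exists z. split; auto. split; auto. lra. }
      lra. }
    destruct (choice _ Y) as [u Hu].
    destruct (BW_CN u p s) as [ph [q [Hph Hq]]]. intros n; apply Hu.
    assert (Xq : X q). { apply (closed_ed X (fun n => u (ph n))); auto. intros n; apply Hu. }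
    assert (Lc : forall w, is_lim_seq (fun n => edist (u (ph n)) w) (edist q w)).
    { intros w. apply is_lim_seq_spec. intros e. destruct (Hq e (cond_pos e)) as [K HK]. exists K. intros n Hn.
      eapply Rle_lt_trans; [apply edist_diff|]. auto. }
    assert (Hqs : edist q p <= s).
    { apply (is_lim_seq_le (fun n => edist (u (ph n)) p) (fun _ => s) (edist q p) s); auto. intros n; apply Hu. apply is_lim_seq_const. }
    assert (HqM : M <= phi q).
    { apply (is_lim_seq_le (fun n => M - / (INR n + 1)) (fun n => edist (u (ph n)) c * edist (u (ph n)) c - /2 * (edist (u (ph n)) p * edist (u (ph n)) p)) M (phi q)).
      - intros n. destruct (Hu (ph n)) as [_ [_ B]]. unfold phi in B. rewrite <- !edist_sq in B.
        assert (/ (INR (ph n) + 1) <= / (INR n + 1)).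
        { apply Rinv_le_contravar. pose proof (pos_INR n); lra. specialize (Hph n). apply le_INR in Hph. lra. }
        simpl in B. lra.
      - replace (Finite M) with (Finite (M - 0)) by (f_equal; ring). apply is_lim_seq_minus'. apply is_lim_seq_const.
        apply is_lim_seq_spec. intros e. destruct (inv_INR_lt e (cond_pos e)) as [K HK]. exists K. intros n Hn.
        rewrite Rminus_0_r, Rabs_pos_eq; auto. apply Rlt_le, Rinv_0_lt_compat. pose proof (pos_INR n); lra.
      - unfold phi. rewrite <- !edist_sq. replace (edist q c ^ 2 - / 2 * edist q p ^ 2) with (edist q c * edist q c - /2 * (edist q p * edist q p)) by ring.
        apply is_lim_seq_minus'. apply is_lim_seq_mult'; auto. apply is_lim_seq_mult'. apply is_lim_seq_const. apply is_lim_seq_mult'; auto. }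
    assert (Hmax : forall z, X z -> edist z p <= s -> phi z <= phi q).
    { intros z Xz Hz. apply Rle_trans with M; auto. apply HM1. exists z; auto. }
    destruct (Rle_lt_or_eq_dec _ _ Hqs) as [Hlt|Heq].
    (* An interior maximum is impossible: the radius (s - |q-p|) / (N + 1) keeps the new point in
       the ball |z-p| <= s, and there phi exceeds phi q by at least |z-q|^2/2 > 0. *)
    + exfalso.
      assert (Hrr : 0 < (s - edist q p) / (INR N + 1)) by (apply Rdiv_lt_0_compat; pose proof (pos_INR N); lra).
      destruct (Hm q (fun i => Cconj (2 * (q i - c i) - (q i - p i))) ((s - edist q p) / (INR N + 1)) Xq Hrr) as [z [Xz [Hzq [Hzb Hre]]]].
      pose proof (sqdist_expansion z q c p) as Ex. fold (phi z) (phi q) in Ex.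
      assert (0 < sqdist z q). { rewrite <- edist_sq. apply pow_lt. apply edist_pos; auto. }
      assert (phi z <= phi q). { apply Hmax; auto. pose proof (edist_tri z q p).
        pose proof (edist_of_ball q z _ Hrr Hzb).
        replace ((INR N + 1) * ((s - edist q p) / (INR N + 1))) with (s - edist q p) in H1 by (field; pose proof (pos_INR N); lra). lra. }
      lra.
    (* On the sphere |q-p| = s, the inequality phi p <= phi q is the claim. *)
    + exists q. split; auto. split; auto. pose proof (Hmax p Xp ltac:(rewrite edist_refl; lra)) as B. unfold phi in B.
      rewrite <- !edist_sq, edist_refl, Heq in B. simpl in *. lra.
Qed.

(** * Moving past the shells *)

Section Shells.
Variables (N : nat) (sphere_center : nat -> CN N) (rho : nat -> R).
Hypothesis Hrho : forall k, 0 <= rho k.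

(* All moves after the k-th have total length at most [2 * step_len (S k) = shell_width k / 32]. *)
Fixpoint step_len (k : nat) : R := match k with O => 1 | S k => step_len k ^ 2 / (8 * (rho k + 1)) / 64 end.
(** Crossing a shell of half-width m about the radius rho costs (rho + m)^2 - (rho - m)^2 = 4 rho m
    in squared distance. With m = s^2 / (8 (rho + 1)) this is at most s^2/2, the gain of a single
    move of length s. *)
Definition shell_width (k : nat) : R := step_len k ^ 2 / (8 * (rho k + 1)).

Lemma step_len_S k : step_len (S k) = shell_width k / 64.
Proof. reflexivity. Qed.

Lemma shell_width_le s a : 0 < s <= 1 -> 0 <= a -> 0 < s ^ 2 / (8 * (a + 1)) <= s / 8.
Proof.
  intros Hs Ha. split. apply Rdiv_lt_0_compat. apply pow_lt; lra. lra.
  apply Rmult_le_reg_r with (8 * (a + 1)); [lra|]. unfold Rdiv at 1. rewrite Rmult_assoc, Rinv_l by lra. nra.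
Qed.

Lemma step_len_bound k : 0 < step_len k <= 1.
Proof.
  induction k. simpl; lra. rewrite step_len_S. unfold shell_width. pose proof (shell_width_le (step_len k) (rho k) IHk (Hrho k)). lra.
Qed.

Lemma shell_width_bound k : 0 < shell_width k <= step_len k / 8.
Proof. apply shell_width_le; auto. apply step_len_bound. Qed.

Lemma step_len_half k : step_len (S k) <= step_len k / 2.
Proof. rewrite step_len_S. pose proof (shell_width_bound k). pose proof (step_len_bound k). lra. Qed.

Lemma step_len_anti k j : step_len (k + j) <= step_len k.
Proof.
  induction j. rewrite Nat.add_0_r; lra. rewrite Nat.add_succ_r. pose proof (step_len_half (k + j)). pose proof (step_len_bound (k + j)). lra.
Qed.

Lemma step_len_small e : 0 < e -> exists K, forall k, (K <= k)%nat -> step_len k < e.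
Proof.
  intros He. destruct (pow_lt_1_zero (/2) ltac:(rewrite Rabs_pos_eq; lra) e He) as [K HK]. exists K. intros k Hk.
  assert (step_len k <= (/2) ^ k). { clear - Hrho. induction k; simpl; [lra|]. pose proof (step_len_half k). simpl in H. lra. }
  specialize (HK k Hk). rewrite Rabs_pos_eq in HK by (apply pow_le; lra). lra.
Qed.

Section Hit.
Variable X : CN N -> Prop.
Hypotheses (Hc : is_closed X) (Hm : max_property X).

Lemma leave_shell k p : X p -> exists z, X z /\ edist z p <= step_len k /\ shell_width k <= Rabs (edist z (sphere_center k) - rho k).
Proof.
  intros Xp. pose proof (step_len_bound k) as Hs. pose proof (shell_width_bound k) as Hmk.
  destruct (Rle_lt_dec (shell_width k) (Rabs (edist p (sphere_center k) - rho k))) as [L|L].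
  - exists p. rewrite edist_refl. split; auto. split; auto. lra.
  - destruct (move X p (sphere_center k) (step_len k) Hc Hm Xp ltac:(lra)) as [z [Xz [Hz Hd]]].
    exists z. split; auto. split; [lra|]. apply Rabs_def2 in L.
    assert (Em : step_len k ^ 2 = 8 * (rho k + 1) * shell_width k) by (unfold shell_width; field; pose proof (Hrho k); lra).
    pose proof (edist_nonneg p (sphere_center k)). pose proof (edist_nonneg z (sphere_center k)). pose proof (Hrho k).
    assert (rho k + shell_width k <= edist z (sphere_center k)); [|rewrite Rabs_pos_eq; lra].
    apply Rsqr_incr_0_var; auto. unfold Rsqr. simpl in Hd, Em.
    assert (shell_width k <= 1) by lra.
    destruct (Rle_lt_dec (shell_width k) (rho k)).
    + assert ((rho k - shell_width k) * (rho k - shell_width k) <= edist p (sphere_center k) * edist p (sphere_center k)) by (apply Rmult_le_compat; lra). nra.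
    (* Here the shell contains its centre and the bound |p-c|^2 >= 0 is all that is used; with m =
       [shell_width k], (rho + m)^2 <= 4 m^2 <= 4 m <= s^2/2 suffices. *)
    + nra.
Qed.

(** The shells k1, k1 + 1, ... are left one after the other. The moves following the k-th use up at
    most 1/32 of the clearance gained there, so the limit keeps well over the 3/4 that is
    recorded. *)
Lemma reach_outside_shells k1 p : X p -> exists p', X p' /\ edist p' p <= 2 * step_len k1 /\
  forall k, (k1 <= k)%nat -> 3 / 4 * shell_width k <= Rabs (edist p' (sphere_center k) - rho k).
Proof.
  intros Xp.
  assert (St : forall kp : nat * CN N, exists z, X (snd kp) -> X z /\ edist z (snd kp) <= step_len (fst kp) /\
     shell_width (fst kp) <= Rabs (edist z (sphere_center (fst kp)) - rho (fst kp))).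
  { intros [k w]; simpl. destruct (classic (X w)) as [Xw|]. destruct (leave_shell k w Xw) as [z Hz]. exists z; auto. exists w; tauto. }
  destruct (choice _ St) as [nxt Hn].
  set (P := fix P j := match j with O => p | S j => nxt ((k1 + j)%nat, P j) end).
  assert (XP : forall j, X (P j)). { induction j; auto. simpl. apply (Hn ((k1 + j)%nat, P j)). auto. }
  (* Telescoping: since the lengths at least halve, a move of length s_k is at most 2 s_k - 2
     s_(k+1). *)
  assert (Dist : forall j i, edist (P (j + i)%nat) (P j) <= 2 * step_len (k1 + j) - 2 * step_len (k1 + (j + i))).
  { intros j i. induction i. rewrite Nat.add_0_r, edist_refl. lra.
    rewrite Nat.add_succ_r. pose proof (edist_tri (P (S (j + i))) (P (j + i)%nat) (P j)).
    destruct (Hn ((k1 + (j + i))%nat, P (j + i)%nat) (XP _)) as [_ [D _]]. cbn [fst snd] in D.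
    change (nxt ((k1 + (j + i))%nat, P (j + i)%nat)) with (P (S (j + i))) in D.
    rewrite Nat.add_succ_r. pose proof (step_len_half (k1 + (j + i))). lra. }
  (* The limit is obtained as a cluster point; [Dist] then bounds its distance to every P j. *)
  destruct (BW_CN P p 2) as [phi [q [Hphi Hq]]].
  { intros n. pose proof (Dist 0%nat n) as D. rewrite Nat.add_0_r in D. simpl in D.
    pose proof (step_len_bound k1). pose proof (step_len_bound (k1 + n)). lra. }
  assert (Dq : forall j, edist q (P j) <= 2 * step_len (k1 + j)).
  { intros j. apply le_epsilon. intros e He. destruct (Hq e He) as [K HK]. set (n := max K j).
    specialize (HK n ltac:(lia)). specialize (Hphi n).
    replace (phi n) with (j + (phi n - j))%nat in HK by lia. pose proof (Dist j (phi n - j)%nat).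
    pose proof (edist_tri q (P (j + (phi n - j))%nat) (P j)). rewrite (edist_sym q (P (j + (phi n - j))%nat)) in H0.
    pose proof (step_len_bound (k1 + (j + (phi n - j)))). lra. }
  exists q. split; [|split].
  - apply (closed_ed X (fun n => P (phi n))); auto.
  - pose proof (Dq 0%nat). rewrite Nat.add_0_r in H. auto.
  - intros k Hk. set (j := (k - k1)%nat). destruct (Hn ((k1 + j)%nat, P j) (XP j)) as [_ [_ L]]. cbn [fst snd] in L.
    change (nxt ((k1 + j)%nat, P j)) with (P (S j)) in L. replace (k1 + j)%nat with k in L by (unfold j; lia).
    pose proof (Dq (S j)) as D. replace (k1 + S j)%nat with (S k) in D by (unfold j; lia). rewrite step_len_S in D.
    pose proof (edist_diff q (P (S j)) (sphere_center k)) as D2.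
    pose proof (Rabs_triang_inv (edist (P (S j)) (sphere_center k) - rho k) (edist (P (S j)) (sphere_center k) - edist q (sphere_center k))) as T.
    replace (edist (P (S j)) (sphere_center k) - rho k - (edist (P (S j)) (sphere_center k) - edist q (sphere_center k))) with (edist q (sphere_center k) - rho k) in T by ring.
    rewrite (Rabs_minus_sym (edist (P (S j)) (sphere_center k)) (edist q (sphere_center k))) in T. pose proof (shell_width_bound k). lra.
Qed.
End Hit.

(** Two clearances provide room for perturbation. Finitely many shells have a common positive slack
    above 1/2 because the inequality is strict; the remaining ones have slack 1/4 of their width. A
    small move, followed by pushing out of all late shells, therefore stays in the set, and
    [reach_outside_shells] restores the bound 3/4 for late shells. *)
Definition strictly_outside (z : CN N) : Prop :=
  (forall k, shell_width k / 2 < Rabs (edist z (sphere_center k) - rho k)) /\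
  exists k0, forall k, (k0 <= k)%nat -> 3 / 4 * shell_width k <= Rabs (edist z (sphere_center k) - rho k).

Definition shell_complement (z : CN N) : Prop := forall r, 0 < r -> exists w, strictly_outside w /\ edist w z < r.

Lemma shell_complement_closed : is_closed shell_complement.
Proof.
  intros p Hp. apply not_all_ex_not in Hp. destruct Hp as [r Hr]. apply imply_to_and in Hr. destruct Hr as [Hr Hn].
  assert (0 < r / (2 * (INR N + 1))) by (apply Rdiv_lt_0_compat; pose proof (pos_INR N); lra).
  exists (r / (2 * (INR N + 1))). split; auto. intros z Hz Kz. apply Hn.
  destruct (Kz (r/2) ltac:(lra)) as [w [Ew Hw]]. exists w. split; auto.
  pose proof (edist_of_ball _ _ _ H Hz). replace ((INR N + 1) * (r / (2 * (INR N + 1)))) with (r/2) in H0 by (field; pose proof (pos_INR N); lra).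
  pose proof (edist_tri w z p). lra.
Qed.

Lemma shell_complement_avoid z k : shell_complement z -> shell_width k / 2 <= Rabs (edist z (sphere_center k) - rho k).
Proof.
  intros Kz. apply le_epsilon. intros e He. destruct (Kz e He) as [w [[Ew _] Hw]]. specialize (Ew k).
  pose proof (edist_diff w z (sphere_center k)). pose proof (Rabs_triang (edist z (sphere_center k) - rho k) (edist w (sphere_center k) - edist z (sphere_center k))).
  replace (edist z (sphere_center k) - rho k + (edist w (sphere_center k) - edist z (sphere_center k))) with (edist w (sphere_center k) - rho k) in H0 by ring. lra.
Qed.

Lemma edist_open (c : CN N) (P : R -> Prop) : (forall t, P t -> exists e, 0 < e /\ forall s, Rabs (s - t) < e -> P s) ->
  is_open (fun z => P (edist z c)).
Proof.
  intros HP p Hp. destruct (HP _ Hp) as [e [He K]].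
  assert (0 < e / (2 * (INR N + 1))) by (apply Rdiv_lt_0_compat; pose proof (pos_INR N); lra).
  exists (e / (2 * (INR N + 1))). split; auto. intros z Hz. apply K.
  pose proof (edist_of_ball _ _ _ H Hz). replace ((INR N + 1) * (e / (2 * (INR N + 1)))) with (e/2) in H0 by (field; pose proof (pos_INR N); lra).
  pose proof (edist_diff z p c). lra.
Qed.

Lemma shell_complement_totally_disconnected :
  (forall z w : CN N, z <> w -> exists k, (edist z (sphere_center k) - rho k) * (edist w (sphere_center k) - rho k) < 0) -> totally_disconnected shell_complement.
Proof.
  intros Hsep X HX Hconn z w Xz Xw. apply NNPP. intros Hn. destruct (Hsep z w Hn) as [k Hk].
  destruct (Hconn (fun z => edist z (sphere_center k) < rho k) (fun z => rho k < edist z (sphere_center k))) as [H|H].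
  - apply (edist_open (sphere_center k) (fun t => t < rho k)). intros t Ht. exists (rho k - t). split; [lra|]. intros s Hs. apply Rabs_def2 in Hs. lra.
  - apply (edist_open (sphere_center k) (fun t => rho k < t)). intros t Ht. exists (t - rho k). split; [lra|]. intros s Hs. apply Rabs_def2 in Hs. lra.
  - intros y Xy. pose proof (shell_complement_avoid y k (HX y Xy)). pose proof (shell_width_bound k).
    destruct (Rtotal_order (edist y (sphere_center k)) (rho k)) as [|[E0|]]; auto. rewrite E0 in H. replace (rho k - rho k) with 0 in H by ring. rewrite Rabs_R0 in H. lra.
  - intros y [_ [H1 H2]]. lra.
  - pose proof (H z Xz). pose proof (H w Xw). simpl in *. nra.
  - pose proof (H z Xz). pose proof (H w Xw). simpl in *. nra.
Qed.

Lemma shell_complement_perfect : max_property (fun _ : CN N => True) -> perfect_set shell_complement.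
Proof.
  intros Hm. split. apply shell_complement_closed.
  assert (Hc : is_closed (fun _ : CN N => True)) by (intros p Hp; exfalso; auto).
  assert (HE : forall z r, strictly_outside z -> 0 < r -> exists w, strictly_outside w /\ w <> z /\ edist w z < r).
  { intros z r [E1 [k0 E2]] Hr.
    assert (Mu : exists mu, 0 < mu /\ forall k, (k < k0)%nat -> shell_width k / 2 + mu <= Rabs (edist z (sphere_center k) - rho k)).
    { clear E2. induction k0. exists 1; split; [lra|]. intros; lia. destruct IHk0 as [mu [Hmu K]].
      specialize (E1 k0). exists (Rmin mu (Rabs (edist z (sphere_center k0) - rho k0) - shell_width k0 / 2)). split. apply Rmin_glb_lt; lra.
      intros k Hk. destruct (Nat.eq_dec k k0) as [->|].
      pose proof (Rmin_r mu (Rabs (edist z (sphere_center k0) - rho k0) - shell_width k0 / 2)). lra.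
      specialize (K k ltac:(lia)). pose proof (Rmin_l mu (Rabs (edist z (sphere_center k0) - rho k0) - shell_width k0 / 2)). lra. }
    destruct Mu as [mu [Hmu Mu]].
    (* The total displacement will be at most 5 * step_len k1, less than both the slack mu and the
       radius r. *)
    destruct (step_len_small (Rmin mu r / 6)) as [K HK]. assert (0 < Rmin mu r) by (apply Rmin_glb_lt; auto). lra.
    set (k1 := max K k0). specialize (HK k1 ltac:(lia)). pose proof (Rmin_l mu r). pose proof (Rmin_r mu r).
    pose proof (step_len_bound k1).
    (* This reaches a point at distance exactly 3 s from z, where s = [step_len k1]. Pushing out of
       the later shells moves it by at most 2 s, so the final point is at distance between s and 5
       s, in particular different from z. *)
    destruct (move _ z z (3 * step_len k1) Hc Hm I ltac:(lra)) as [z1 [_ [D1 _]]].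
    destruct (reach_outside_shells _ Hc Hm k1 z1 I) as [w [_ [D2 Hw]]].
    assert (Dw : edist w z <= 5 * step_len k1) by (pose proof (edist_tri w z1 z); lra).
    assert (Near : forall k, Rabs (edist z (sphere_center k) - rho k) - 5 * step_len k1 <= Rabs (edist w (sphere_center k) - rho k)).
    { intros k. pose proof (edist_diff w z (sphere_center k)).
      pose proof (Rabs_triang_inv (edist z (sphere_center k) - rho k) (edist z (sphere_center k) - edist w (sphere_center k))) as T.
      replace (edist z (sphere_center k) - rho k - (edist z (sphere_center k) - edist w (sphere_center k))) with (edist w (sphere_center k) - rho k) in T by ring.
      rewrite (Rabs_minus_sym (edist z (sphere_center k)) (edist w (sphere_center k))) in T. lra. }
    exists w. split; [split|split].
    - intros k. pose proof (shell_width_bound k). destruct (Nat.le_gt_cases k1 k) as [L|L]. specialize (Hw k L). lra.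
      specialize (Near k). destruct (Nat.le_gt_cases k0 k) as [L0|L0].
      (* For k0 <= k < k1 the displacement is at most 5 * step_len (S k), that is 5/64 of
         [shell_width k], within the slack 3/4 - 1/2. *)
      + specialize (E2 k L0). pose proof (step_len_anti (S k) (k1 - S k)) as An. replace (S k + (k1 - S k))%nat with k1 in An by lia.
        rewrite step_len_S in An. lra.
      + specialize (Mu k L0). lra.
    - exists k1. auto.
    - intros ->. rewrite edist_sym in D1. lra.
    - lra. }
  intros p Kp r Hr. destruct (classic (strictly_outside p)) as [Ep|Ep].
  - destruct (HE p r Ep Hr) as [w [Ew [Hw D]]]. exists w. split. intros e He. exists w. rewrite edist_refl. auto.
    split; auto. apply ball_of_ed; auto.
  - destruct (Kp r Hr) as [w [Ew D]]. exists w. split. intros e He. exists w. rewrite edist_refl. auto.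
    split. intros ->; auto. apply ball_of_ed; auto.
Qed.

Lemma shell_complement_hits (X : CN N -> Prop) p : is_closed X -> max_property X -> X p -> exists z, shell_complement z /\ X z.
Proof.
  intros Hc Hm Xp. destruct (reach_outside_shells X Hc Hm 0 p Xp) as [z [Xz [_ Hz]]]. exists z. split; auto.
  intros r Hr. exists z. rewrite edist_refl. split; auto. split. intros k. specialize (Hz k ltac:(lia)). pose proof (shell_width_bound k). lra.
  exists 0%nat. auto.
Qed.
End Shells.

(* The centres 0, e_i and i e_i suffice: |z - c|^2 - |z|^2 recovers Re z_i and Im z_i. *)
Definition center (N i m : nat) : CN N :=
  fun j => if Nat.eq_dec (fin_index j) i then match m with O => RtoC 0 | S O => RtoC 1 | _ => Ci end else RtoC 0.

(** An enumeration of all quadruples (i, m, a, b): the centre of kind m on coordinate axis i, with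
    the radius a / (b + 1). Every centre thus occurs with every non-negative rational radius. *)
Definition quad_of_nat (k : nat) : (nat * nat) * (nat * nat) :=
  let p := Cantor.of_nat k in (Cantor.of_nat (fst p), Cantor.of_nat (snd p)).

Lemma quad_of_nat_surj i m a b : exists k, quad_of_nat k = ((i, m), (a, b)).
Proof.
  exists (Cantor.to_nat (Cantor.to_nat (i, m), Cantor.to_nat (a, b))). unfold quad_of_nat.
  rewrite Cantor.cancel_of_to. cbn [fst snd]. rewrite !Cantor.cancel_of_to. auto.
Qed.

Definition sphere_center (N k : nat) : CN N := center N (fst (fst (quad_of_nat k))) (snd (fst (quad_of_nat k))).
Definition sphere_radius (k : nat) : R := INR (fst (snd (quad_of_nat k))) / (INR (snd (snd (quad_of_nat k))) + 1).

Lemma sphere_radius_nonneg k : 0 <= sphere_radius k.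
Proof. unfold sphere_radius. apply Rdiv_le_0_compat. apply pos_INR. pose proof (pos_INR (snd (snd (quad_of_nat k)))). lra. Qed.

Lemma rational_between x y : 0 <= x < y -> exists a b : nat, x < INR a / (INR b + 1) < y.
Proof.
  intros H. destruct (inv_INR_lt (y - x) ltac:(lra)) as [b Hb]. specialize (Hb b (Nat.le_refl _)).
  pose proof (pos_INR b). destruct (archimed (x * (INR b + 1))) as [A1 A2].
  assert (0 <= x * (INR b + 1)) by (apply Rmult_le_pos; lra).
  assert (Hu : (0 <= up (x * (INR b + 1)))%Z) by (apply le_IZR; lra).
  exists (Z.to_nat (up (x * (INR b + 1)))), b. rewrite INR_IZR_INZ, Z2Nat.id by auto.
  assert (0 < / (INR b + 1)) by (apply Rinv_0_lt_compat; lra).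
  split.
  - apply Rmult_lt_reg_r with (INR b + 1); [lra|]. unfold Rdiv. rewrite Rmult_assoc, Rinv_l; lra.
  - apply Rmult_lt_reg_r with (INR b + 1); [lra|]. unfold Rdiv. rewrite Rmult_assoc, Rinv_l by lra.
    apply (Rmult_lt_compat_r (INR b + 1)) in Hb; [|lra]. rewrite Rinv_l in Hb by lra. lra.
Qed.

Lemma sumR_minus N : forall g h : Fin.t N -> R, sumR N (fun i => g i - h i) = sumR N g - sumR N h.
Proof. induction N; intros g h; simpl. ring. rewrite IHN. ring. Qed.

Lemma sqdist_center {N} (z : CN N) (i : Fin.t N) m : sqdist z (center N (fin_index i) m) - sqdist z (center N (fin_index i) 0) =
  Cmod (z i - center N (fin_index i) m i) ^ 2 - Cmod (z i - 0) ^ 2.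
Proof.
  unfold sqdist. rewrite <- sumR_minus. rewrite (sumR_single N i).
  - f_equal. unfold center. destruct (Nat.eq_dec (fin_index i) (fin_index i)); auto.
  - intros j Hj. unfold center. destruct (Nat.eq_dec (fin_index j) (fin_index i)) as [E0|]. exfalso; apply Hj, fin_index_inj; auto. ring.
Qed.

Lemma centers_separate {N} (z w : CN N) : z <> w -> exists i m, edist z (center N i m) <> edist w (center N i m).
Proof.
  intros H. apply NNPP. intros Hn. apply H. apply functional_extensionality. intros i.
  assert (E0 : forall m, sqdist z (center N (fin_index i) m) = sqdist w (center N (fin_index i) m)).
  { intros m. rewrite <- !edist_sq. f_equal. apply NNPP. intros Hm. apply Hn. eauto. }
  pose proof (sqdist_center z i 1) as Z1. pose proof (sqdist_center w i 1) as W1.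
  pose proof (sqdist_center z i 2) as Z2. pose proof (sqdist_center w i 2) as W2.
  rewrite !E0 in *. unfold center in *. destruct (Nat.eq_dec (fin_index i) (fin_index i)) as [_|n]; [|tauto].
  destruct (z i) as [a b], (w i) as [c d]. rewrite !Cmod2_alt in *.
  unfold Cminus, Cplus, Copp, RtoC, Ci, Re, Im in *; simpl in *. f_equal; lra.
Qed.

Lemma sphere_center_separates {N} (z w : CN N) : z <> w -> exists k, (edist z (sphere_center N k) - sphere_radius k) * (edist w (sphere_center N k) - sphere_radius k) < 0.
Proof.
  intros H. destruct (centers_separate z w H) as [i [m Hne]].
  pose proof (edist_nonneg z (center N i m)). pose proof (edist_nonneg w (center N i m)).
  destruct (Rdichotomy _ _ Hne) as [L|L].
  - destruct (rational_between _ _ (conj H0 L)) as [a [b Hab]]. destruct (quad_of_nat_surj i m a b) as [k Hk].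
    exists k. unfold sphere_center, sphere_radius. rewrite Hk. cbn [fst snd]. nra.
  - destruct (rational_between _ _ (conj H1 L)) as [a [b Hab]]. destruct (quad_of_nat_surj i m a b) as [k Hk].
    exists k. unfold sphere_center, sphere_radius. rewrite Hk. cbn [fst snd]. nra.
Qed.

(** A real step along the first coordinate, with the sign of the real part of its coefficient; this
    requires at least one coordinate, hence [S N]. *)
Lemma max_property_full N : max_property (fun _ : CN (S N) => True).
Proof.
  intros q a r _ Hr.
  assert (Hw : exists w : C, w <> RtoC 0 /\ Cmod w < r /\ 0 <= fst (a Fin.F1 * w)%C).
  { destruct (Rle_lt_dec 0 (fst (a Fin.F1))) as [L|L].
    - exists (RtoC (r/2)). split. intros E0. apply RtoC_inj in E0. lra. split. rewrite Cmod_R, Rabs_pos_eq; lra. simpl. nra.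
    - exists (RtoC (-(r/2))). split. intros E0. apply RtoC_inj in E0. lra. split. rewrite Cmod_R, Rabs_Ropp, Rabs_pos_eq; lra. simpl. nra. }
  destruct Hw as [w [Hw0 [Hwr Hre]]].
  set (z := fun i : Fin.t (S N) => if Fin.eq_dec i Fin.F1 then (q i + w)%C else q i).
  assert (z1 : (z Fin.F1 - q Fin.F1)%C = w).
  { unfold z. destruct (Fin.eq_dec Fin.F1 Fin.F1) as [_|n]; [|tauto]. cring. }
  assert (zn : forall i, i <> Fin.F1 -> z i = q i).
  { intros i Hi. unfold z. destruct (Fin.eq_dec i Fin.F1); tauto. }
  exists z. split; auto. split; [|split].
  - intros E0. apply Hw0. rewrite <- z1, E0. cring.
  - intros i. rewrite Defs_Cmod. change (Cmod (z i - q i) < r). destruct (Fin.eq_dec i Fin.F1) as [->|Hn].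
    rewrite z1; auto. rewrite zn, Cmod_diag by auto. auto.
  - rewrite (sumC_single (S N) Fin.F1). rewrite z1. auto. intros j Hj. rewrite zn by auto. cring.
Qed.

Lemma nonisol_closed {N} (A : CN N -> Prop) : is_closed A -> is_closed (nonisol A).
Proof.
  intros Hc p Hp. destruct (classic (A p)) as [Ap|Ap].
  - assert (Hn : exists r, 0 < r /\ forall z, A z -> Defs.ball p r z -> z = p).
    { apply NNPP. intros Hn. apply Hp. split; auto. intros r Hr. apply NNPP. intros Hz. apply Hn. exists r. split; auto.
      intros z Az Hb. apply NNPP. intros Hne. apply Hz. eauto. }
    destruct Hn as [r [Hr K]]. exists r. split; auto. intros z Hz [Az Hni].
    rewrite (K z Az Hz) in Hni. destruct (Hni r Hr) as [y [Ay [Hy Hb]]]. apply Hy, K; auto.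
  - destruct (Hc p Ap) as [r [Hr K]]. exists r. split; auto. intros z Hz [Az _]. apply (K z Hz Az).
Qed.

Theorem theorem6p2 :
  forall N : nat, (2 <= N)%nat ->
  exists K : CN N -> Prop,
    totally_disconnected K /\ perfect_set K /\
    forall A : CN N -> Prop,
      analytic_subvariety A -> positive_dimensional A ->
      exists z, K z /\ A z.
Proof.
  intros N HN. exists (shell_complement N (sphere_center N) sphere_radius). split; [|split].
  - apply shell_complement_totally_disconnected. apply sphere_radius_nonneg. apply sphere_center_separates.
  - destruct N; [lia|]. apply shell_complement_perfect. apply sphere_radius_nonneg. apply max_property_full.
  - intros A HA Hpos. destruct (positive_dimensional_nonisol A Hpos) as [p Hp].
    destruct (shell_complement_hits N (sphere_center N) sphere_radius sphere_radius_nonneg (nonisol A) p) as [z [Kz [Az _]]].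
    + apply nonisol_closed, HA.
    + intros q a r Hq Hr. apply nonisol_max; auto.
    + auto.
    + exists z. auto.
Qed.
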